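(* Let $\mathfrak{so}_8$ be the complex simple Lie algebra of type $D_4$ with simple roots $\alpha_1,\alpha_2,\alpha_3,\alpha_4$ (Bourbaki numbering, $\alpha_2$ the central node), equipped with the action of $\mathfrak{S}_4$ in which $(1\,2)$ acts by the diagram automorphism $\gamma_{13}$ swapping $\alpha_1,\alpha_3$ and fixing $\alpha_2,\alpha_4$; $(2\,3)$ acts by the diagram automorphism $\gamma_{34}$ swapping $\alpha_3,\alpha_4$; and $(3\,4)$ acts by $\gamma_{13}\circ\mathrm{Ad}(\alpha_1^\vee(\sqrt{-1})\alpha_3^\vee(-\sqrt{-1}))$. Let $\mathcal{O}_{\min}$ be the minimal nilpotent orbit of $\mathfrak{so}_8$. Let $V=\mathbb{C}^3$ with standard basis $v_1,v_2,v_3$ and dual basis $\chi_1,\chi_2,\chi_3$ of $V^*$, and let $\mathfrak{z}=\{(\lambda_1,\lambda_2,\lambda_3)\in\mathbb{C}^3:\lambda_1+\lambda_2+\lambda_3=0\}$; for $z=(\lambda_1,\lambda_2,\lambda_3)$ put $\Delta(z)=\mathrm{diag}(\lambda_1,\lambda_2,\lambda_3)$, with indices read modulo $3$. Define $\psi:\mathrm{SL}_3\times\mathfrak{z}\to\mathfrak{sl}_3\oplus S^2V\oplus S^2V^*$ by $$\psi(g,z)=\Big(g\Delta(z)g^{-1},\ \sum_{i}(\lambda_i-\lambda_{i+1})^2\,gv_i\otimes gv_i,\ \sum_i(\lambda_i-\lambda_{i-1})^2\,\chi_ig^{-1}\otimes\chi_ig^{-1}\Big).$$ Then $\overline{\mathcal{O}_{\min}}/\mathfrak{S}_4$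 is isomorphic to the closure of the image of $\psi$.
   Context: The action of $\mathfrak{S}_4$ described is a well-defined action by automorphisms; its fixed-point subalgebra is isomorphic to $\mathfrak{sl}_3$. Here $S^2V$ and $S^2V^*$ denote symmetric squares, and $gv$ (resp. $\chi g^{-1}$) is the natural action of $\mathrm{SL}_3$ on column (resp. row) vectors. *)

(* Defs.v *)
From HB Require Import structures.
From mathcomp Require Import all_boot all_order all_algebra all_fingroup.
From mathcomp Require Import mpoly.
Set Implicit Arguments. Unset Strict Implicit. Unset Printing Implicit Defensive.
Import Order.TTheory GRing.Theory Num.Theory.
Local Open Scope ring_scope.

Section D4.
Variable F : numClosedFieldType.

(* Coordinates 0..7 carry the weights e1,e2,e3,e4,-e4,-e3,-e2,-e1.           *)
Definition J8 : 'M[F]_8 := \matrix_(i, j) ((i + j == 7)%N)%:R.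

Definition in_so8 (X : 'M[F]_8) : bool := X^T *m J8 + J8 *m X == 0.

Definition in_SO8 (g : 'M[F]_8) : bool := (g^T *m J8 *m g == J8) && (\det g == 1).

Definition lie (X Y : 'M[F]_8) : 'M[F]_8 := X *m Y - Y *m X.

Definition dm (a b : nat) : 'M[F]_8 := delta_mx (inord a) (inord b).

(* Chevalley generators, Bourbaki numbering:
   a1 = e1-e2, a2 = e2-e3, a3 = e3-e4, a4 = e3+e4 (indices 0..3 in 'I_4). *)
Definition chev_e (i : 'I_4) : 'M[F]_8 :=
  match val i with
  | 0 => dm 0 1 - dm 6 7
  | 1 => dm 1 2 - dm 5 6
  | 2 => dm 2 3 - dm 4 5
  | _ => dm 2 4 - dm 3 5
  end.
Definition chev_f (i : 'I_4) : 'M[F]_8 := (chev_e i)^T.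

(* highest root vector, root e1+e2 *)
Definition E_theta : 'M[F]_8 := dm 0 6 - dm 1 7.

Definition Omin (x : 'M[F]_8) : Prop :=
  exists2 g, in_SO8 g & x = g *m E_theta *m invmx g.

Definition diagram_aut (s : 'I_4 -> 'I_4) (phi : 'M[F]_8 -> 'M[F]_8) : Prop :=
  [/\ forall x, in_so8 x -> in_so8 (phi x),
      forall a x y, in_so8 x -> in_so8 y -> phi (a *: x + y) = a *: phi x + phi y,
      forall x y, in_so8 x -> in_so8 y -> phi (lie x y) = lie (phi x) (phi y),
      forall i, phi (chev_e i) = chev_e (s i) &
      forall i, phi (chev_f i) = chev_f (s i)].

Definition swap13 : 'I_4 -> 'I_4 := tperm (@inord 3 0) (@inord 3 2).
Definition swap34 : 'I_4 -> 'I_4 := tperm (@inord 3 2) (@inord 3 3).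

Definition coroot1 (a : F) : 'M[F]_8 :=
  diag_mx (\row_(k < 8) [:: a; a^-1; 1; 1; 1; 1; a; a^-1]`_k).
Definition coroot3 (b : F) : 'M[F]_8 :=
  diag_mx (\row_(k < 8) [:: 1; 1; b; b^-1; b; b^-1; 1; 1]`_k).
Definition Ad (t : 'M[F]_8) (x : 'M[F]_8) : 'M[F]_8 := t *m x *m invmx t.
Definition t34 : 'M[F]_8 := coroot1 'i *m coroot3 (- 'i).

(* S^2 V is realised inside 3x3 matrices via v (x) w |-> v w^T (symmetric
   matrices), likewise S^2 V^* via chi (x) chi' |-> chi^T chi'. *)
Definition psi (g : 'M[F]_3) (l : 'I_3 -> F) : 'M[F]_3 * 'M[F]_3 * 'M[F]_3 :=
  ( g *m diag_mx (\row_k l k) *m invmx g,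
    \sum_(i < 3) (l i - l (ordS i)) ^+ 2 *: (col i g *m (col i g)^T),
    \sum_(i < 3) (l i - l (ord_pred i)) ^+ 2 *:
                   ((row i (invmx g))^T *m row i (invmx g)) ).

Definition in_image_psi (y : 'M[F]_3 * 'M[F]_3 * 'M[F]_3) : Prop :=
  exists g l, [/\ \det g = 1, \sum_(i < 3) l i = 0 & y = psi g l].

Definition coord8 (x : 'M[F]_8) : 'I_(8 * 8) -> F := fun k => mxvec x 0 k.
Definition coordT (y : 'M[F]_3 * 'M[F]_3 * 'M[F]_3) : 'I_(3 * (3 + (3 + 3))) -> F :=
  fun k => mxvec (row_mx y.1.1 (row_mx y.1.2 y.2)) 0 k.

End D4.

(* Main.v *)
(* Let sl_3 be the fixed subalgebra of S_4. As a module over sl_3 x S_4, so_8 is the sum of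
   sl_3, of z, and of three copies of V and of V^*, so that x in so_8 has coordinates A in sl_3,
   l_1, l_2, l_3 with sum zero, v_1, v_2, v_3 in V and c_1, c_2, c_3 in V^*. The subgroup S_3
   permutes the triples (l_i, v_i, c_i), and V_4 changes the signs of the pairs (v_i, c_i).

   On the minimal orbit, for {i, j, k} = {1, 2, 3}, the quadrics of the Joseph ideal read
     A v_i = l_i v_i,  c_i A = l_i c_i,  v_i c_i = (A - l_j) (A - l_k),  c_i v_j = 0,
     v_i v_j^T = - (A - l_j) [c_k],  c_i^T c_j = (A^T - l_j) [v_k],
   where [c] is the skew matrix of c. When the l_i are distinct, they say that
   A = g diag(l) g^-1, v_i = (l_i - l_(i+1)) g e_i and c_i = (l_i - l_(i-1)) e_i^T g^-1 for some g
   in SL_3; hence x |-> (A, \sum v_i v_i, \sum c_i c_i) maps a dense open subset of the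
   irreducible variety Omin onto the regular part of the image of psi.

   The same relations reduce every V_4-invariant function to a polynomial in A, l_i, v_i v_i and
   c_i c_i. By polarisation the S_3-invariants among these are polynomials in A and in the power
   sums \sum_i l_i^k, \sum_i v_i^(2n) and \sum_i c_i^(2n), which an induction on n expresses
   through A, \sum v_i v_i and \sum c_i c_i. *)
Require Import Defs.
From HB Require Import structures.
From mathcomp Require Import all_boot all_order all_algebra all_fingroup.
From mathcomp Require Import mpoly ring.
Set Implicit Arguments. Unset Strict Implicit. Unset Printing Implicit Defensive.
Import Order.TTheory GRing.Theory Num.Theory.
Local Open Scope ring_scope.

(** * Coordinates and the Joseph relations *)

(** Both closures enter only through their coordinate rings, so everything concerns polynomials and
    may be tested on dense subsets. The obstacle is that [g13] and [g34] are abstract: they are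
    given on the Chevalley generators, and [g13] is not conjugation by a matrix (it does not
    preserve ranks), so that [Omin], an orbit under conjugation, is not visibly stable. The quadrics
    are visibly stable under permutations and sign changes of the triples; hence the dense subset
    [W] is defined by them and by distinctness of the l_i, and is compared with [Omin] afterwards.
    Its density rests on irreducibility, obtained from an explicit form of Witt's theorem: four
    reflections with denominators cleared reach every point, so two points lie on one polynomial
    curve. The quadrics have two sources: the Pluecker relations of a decomposable bivector, and x^2
    = 0, which says that its plane is isotropic. The factors l_i - l_(i+1) in [psi] are those by
    which the v_i must be divided to form a matrix of determinant 1. *)

Definition i0 : 'I_3 := @Ordinal 3 0 isT.
Definition i1 : 'I_3 := @Ordinal 3 1 isT.
Definition i2 : 'I_3 := @Ordinal 3 2 isT.
Definition q0 : 'I_8 := @Ordinal 8 0 isT.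
Definition q1 : 'I_8 := @Ordinal 8 1 isT.
Definition q2 : 'I_8 := @Ordinal 8 2 isT.
Definition q3 : 'I_8 := @Ordinal 8 3 isT.
Definition q4 : 'I_8 := @Ordinal 8 4 isT.
Definition q5 : 'I_8 := @Ordinal 8 5 isT.
Definition q6 : 'I_8 := @Ordinal 8 6 isT.
Definition q7 : 'I_8 := @Ordinal 8 7 isT.

Lemma ord3_ind (P : 'I_3 -> Prop) : P i0 -> P i1 -> P i2 -> forall i, P i.
Proof.
move=> h0 h1 h2 [[|[|[|//]]] lt]; rewrite (bool_irrelevance lt isT);
  [exact: h0 | exact: h1 | exact: h2].
Qed.

Lemma ord8_ind (P : 'I_8 -> Prop) :
  P q0 -> P q1 -> P q2 -> P q3 -> P q4 -> P q5 -> P q6 -> P q7 ->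
  forall i, P i.
Proof.
move=> h0 h1 h2 h3 h4 h5 h6 h7 [[|[|[|[|[|[|[|[|//]]]]]]]] lt];
  rewrite (bool_irrelevance lt isT);
  [exact: h0|exact: h1|exact: h2|exact: h3|exact: h4|exact: h5|exact: h6|exact: h7].
Qed.

Lemma big3 (V : nmodType) (f : 'I_3 -> V) : \sum_(i < 3) f i = f i0 + f i1 + f i2.
Proof.
rewrite !big_ord_recr big_ord0 /= add0r.
by congr (f _ + f _ + f _); apply: val_inj.
Qed.

Lemma big8 (V : nmodType) (f : 'I_8 -> V) :
  \sum_(i < 8) f i = f q0 + f q1 + f q2 + f q3 + f q4 + f q5 + f q6 + f q7.
Proof.
rewrite !big_ord_recr big_ord0 /= add0r.
by congr (f _ + f _ + f _ + f _ + f _ + f _ + f _ + f _); apply: val_inj.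
Qed.

Definition mx3 (R : nmodType) (s : seq (seq R)) : 'M[R]_3 :=
  \matrix_(a, b) nth 0 (nth [::] s a) b.

Lemma mx3E (R : nmodType) (x00 x01 x02 x10 x11 x12 x20 x21 x22 : R) :
  let x := mx3 [:: [:: x00; x01; x02]; [:: x10; x11; x12]; [:: x20; x21; x22]] in
  ((x i0 i0 = x00) * (x i0 i1 = x01) * (x i0 i2 = x02) *
   (x i1 i0 = x10) * (x i1 i1 = x11) * (x i1 i2 = x12) *
   (x i2 i0 = x20) * (x i2 i1 = x21) * (x i2 i2 = x22))%type.
Proof. by rewrite /= !mxE. Qed.

Definition skew3 (R : zmodType) (c : 'I_3 -> R) : 'M[R]_3 :=
  mx3 [:: [:: 0; c i2; - c i1]; [:: - c i2; 0; c i0]; [:: c i1; - c i0; 0]].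

Section Data.
Variable F : numClosedFieldType.
Implicit Types (x : 'M[F]_8) (A v c : 'M[F]_3) (l : 'I_3 -> F).

(* Indices [q0], [q6], [q5] carry the weights e1, -e2, -e3 of V, and [q7], [q1], [q2]
   those of V^*. Under the sl_3 acting on V, an element of so_8 is the sum of [dA] in sl_3,
   of [dl] in z, of the three columns of [dv] in V and of the three rows of [dc] in V^*. *)
Definition blocktr x := x q0 q0 + x q6 q6 + x q5 q5.

Definition dA x : 'M[F]_3 := mx3
  [:: [:: x q0 q0 - blocktr x / 3; x q0 q6; x q0 q5];
      [:: x q6 q0; x q6 q6 - blocktr x / 3; x q6 q5];
      [:: x q5 q0; x q5 q6; x q5 q5 - blocktr x / 3]].

Definition dl x : 'I_3 -> F := fun i => nth 0
  [:: blocktr x / 6 - x q3 q3 / 2; blocktr x / 6 + x q3 q3 / 2; - blocktr x / 3] i.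

Definition dv x : 'M[F]_3 := mx3
  [:: [:: - x q0 q3; - x q0 q4; - x q1 q5];
      [:: x q4 q1; x q3 q1; - x q2 q0];
      [:: x q4 q2; x q3 q2; x q1 q0]].

Definition dc x : 'M[F]_3 := mx3
  [:: [:: x q3 q0; - x q1 q4; - x q2 q4];
      [:: x q4 q0; - x q1 q3; - x q2 q3];
      [:: x q5 q1; x q0 q2; - x q0 q1]].

(* Apart from the two linear ones, these span the quadrics of the Joseph ideal of so_8. *)
Record joseph A l v c : Prop := Joseph {
  j_trA : \sum_a A a a = 0;
  j_suml : \sum_i l i = 0;
  j_trA2 : \sum_a \sum_e A a e * A e a = \sum_i l i ^+ 2;
  j_Av : forall i a, \sum_b A a b * v b i = l i * v a i;
  j_cA : forall i a, \sum_b c i b * A b a = l i * c i a;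
  j_vc : forall i a b, v a i * c i b =
     \sum_e A a e * A e b + l i * A a b + (l i ^+ 2 - (\sum_k l k ^+ 2) / 2) * (a == b)%:R;
  j_cv0 : forall i j, i != j -> \sum_a c i a * v a j = 0;
  j_vv : forall i j k, i != j -> j != k -> i != k -> forall a b,
     v a i * v b j = - \sum_e (A a e - l j * (a == e)%:R) * skew3 (c k) e b;
  j_cc : forall i j k, i != j -> j != k -> i != k -> forall a b,
     c i a * c j b = \sum_e (A e a - l j * (a == e)%:R) * skew3 (v^~ k) e b }.

(** For A of trace 0, A [c] + [c] A^T = - [c A]. With c A = lk c and li + lj + lk = 0, the transpose
    of (A - lj) [c] is therefore (A - li) [c]. This exchanges i and j in [j_vv], and in [j_cc]
    through A^T. *)
Lemma skew3_swap A (c : 'I_3 -> F) (li lj lk : F) : \sum_a A a a = 0 ->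
  (forall a, \sum_b c b * A b a = lk * c a) -> li + lj + lk = 0 -> forall a b,
  \sum_e (A b e - lj * (b == e)%:R) * skew3 c e a =
  \sum_e (A a e - li * (a == e)%:R) * skew3 c e b.
Proof.
rewrite big3 => trA cA sl a b.
have s0 (f : 'I_3 -> F) : (forall k, f k = 0) -> skew3 f a b = 0.
  by move=> f0; elim/ord3_ind: a; elim/ord3_ind: b; rewrite /skew3 mx3E ?f0 ?oppr0.
have {}cA k : \sum_b c b * A b k - lk * c k = 0 by rewrite cA subrr.
have t0 k : (A i0 i0 + A i1 i1 + A i2 i2) * c k = 0 by rewrite trA mul0r.
have l0 k : (li + lj + lk) * c k = 0 by rewrite sl mul0r.
apply/eqP; rewrite -subr_eq0; apply/eqP.
transitivity (skew3 (fun k => \sum_b c b * A b k - lk * c k) a b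
  - skew3 (fun k => (A i0 i0 + A i1 i1 + A i2 i2) * c k) a b
  + skew3 (fun k => (li + lj + lk) * c k) a b); last by rewrite !s0 // subr0 addr0.
by rewrite !big3; elim/ord3_ind: a {s0}; elim/ord3_ind: b; rewrite /skew3 !mx3E ?big3 /=; ring.
Qed.

(** * Decomposable bivectors of isotropic planes satisfy the relations *)

Section Wedge.
Variables u w : 'I_8 -> F.
Hypothesis huu : u q0 * u q7 + u q1 * u q6 + u q2 * u q5 + u q3 * u q4 = 0.
Hypothesis hww : w q0 * w q7 + w q1 * w q6 + w q2 * w q5 + w q3 * w q4 = 0.
Hypothesis huw : u q0 * w q7 + u q1 * w q6 + u q2 * w q5 + u q3 * w q4 +
   u q4 * w q3 + u q5 * w q2 + u q6 * w q1 + u q7 * w q0 = 0.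

(** The bivector of u and w, under the identification of so_8 with the exterior square of C^8 given
    by the form: u w^T J - w u^T J. The hypotheses say that u and w span an isotropic subspace. *)
Definition wedgex : 'M[F]_8 := \matrix_(i, j) (u i * w (rev_ord j) - w i * u (rev_ord j)).

(* Each relation below is a combination of at most four [Q p q], with coefficients found by
   linear algebra. *)
Let Q p q := (u q0 * u q7 + u q1 * u q6 + u q2 * u q5 + u q3 * u q4) * (w p * w q)
  + (w q0 * w q7 + w q1 * w q6 + w q2 * w q5 + w q3 * w q4) * (u p * u q)
  - (u q0 * w q7 + u q1 * w q6 + u q2 * w q5 + u q3 * w q4 +
   u q4 * w q3 + u q5 * w q2 + u q6 * w q1 + u q7 * w q0) * (u p * w q + u q * w p) / 2.

(** [Q p q] is -1/2 times the entry at (p, [rev_ord q]) of the square of [wedgex], hence zero by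
    isotropy. The quadratic relations below that [field] proves without [byQ] follow from the
    Pluecker relations and hold for all u and w. *)
Lemma byQ (p q : 'I_8) (c a b : F) : a - b = c * Q p q -> a = b.
Proof.
rewrite /Q huu hww huw !mul0r !addr0 subr0 mulr0 => /eqP.
by rewrite subr_eq0 => /eqP.
Qed.

Lemma rev8 : (rev_ord q0 = q7) * (rev_ord q1 = q6) * (rev_ord q2 = q5) * (rev_ord q3 = q4)
  * (rev_ord q4 = q3) * (rev_ord q5 = q2) * (rev_ord q6 = q1) * (rev_ord q7 = q0).
Proof. by do !split; apply: val_inj. Qed.

Lemma wedgexE :
  ((forall i, wedgex i q0 = u i * w q7 - w i * u q7) *
  (forall i, wedgex i q1 = u i * w q6 - w i * u q6) *
  (forall i, wedgex i q2 = u i * w q5 - w i * u q5) *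
  (forall i, wedgex i q3 = u i * w q4 - w i * u q4) *
  (forall i, wedgex i q4 = u i * w q3 - w i * u q3) *
  (forall i, wedgex i q5 = u i * w q2 - w i * u q2) *
  (forall i, wedgex i q6 = u i * w q1 - w i * u q1) *
  (forall i, wedgex i q7 = u i * w q0 - w i * u q0))%type.
Proof. by do !split; move=> i; rewrite mxE rev8. Qed.

Let V (a : 'I_3) : 'I_8 := nth q0 [:: q0; q6; q5] a.
Let V' (a : 'I_3) : 'I_8 := nth q0 [:: q7; q1; q2] a.
Let x := wedgex.

Ltac entries := rewrite /dA /dv /dc /skew3 ?mx3E /dl /blocktr /x /V /V' /= ?mx3E ?wedgexE.

Lemma wedge_trA2 : \sum_a \sum_e dA x a e * dA x e a = \sum_i dl x i ^+ 2.
Proof.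
rewrite !big3.
(* In total, tr A^2 - \sum_i l_i^2 = Q q3 q4 - Q q0 q7 - Q q1 q6 - Q q2 q5, a combination of
   diagonal entries of x^2. *)
apply: (@byQ q0 q7 (-1)); apply/eqP; rewrite -subr_eq0; apply/eqP.
apply: (@byQ q1 q6 (-1)); apply/eqP; rewrite -subr_eq0; apply/eqP.
apply: (@byQ q2 q5 (-1)); apply/eqP; rewrite -subr_eq0; apply/eqP.
by apply: (@byQ q3 q4 1); rewrite /Q; entries; field.
Qed.

Lemma wedge_Av i a : \sum_b dA x a b * dv x b i = dl x i * dv x a i.
Proof.
rewrite big3; elim/ord3_ind: i.
- by apply: (@byQ (V a) q4 1); rewrite /Q; elim/ord3_ind: a; entries; field.
- by apply: (@byQ (V a) q3 1); rewrite /Q; elim/ord3_ind: a; entries; field.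
- by elim/ord3_ind: a; entries; field.
Qed.

Lemma wedge_cA i a : \sum_b dc x i b * dA x b a = dl x i * dc x i a.
Proof.
rewrite big3; elim/ord3_ind: i.
- by apply: (@byQ (V' a) q3 (-1)); rewrite /Q; elim/ord3_ind: a; entries; field.
- by apply: (@byQ (V' a) q4 (-1)); rewrite /Q; elim/ord3_ind: a; entries; field.
- by elim/ord3_ind: a; entries; field.
Qed.

Lemma wedge_vc i a b : dv x a i * dc x i b = \sum_e dA x a e * dA x e b + dl x i * dA x a b
  + (dl x i ^+ 2 - (\sum_k dl x k ^+ 2) / 2) * (a == b)%:R.
Proof.
elim/ord3_ind: i.
- apply: (@byQ (V a) (V' b) 1); rewrite /Q !big3.
  by elim/ord3_ind: a; elim/ord3_ind: b; entries; field.
- apply: (@byQ (V a) (V' b) 1); rewrite /Q !big3.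
  by elim/ord3_ind: a; elim/ord3_ind: b; entries; field.
(* For the third index, isotropy enters only through tr A^2 = \sum_i l_i^2; what remains is of
   Pluecker type. *)
- rewrite -wedge_trA2 !big3.
  by elim/ord3_ind: a; elim/ord3_ind: b; entries; field.
Qed.

Lemma wedge_cv0 i j : i != j -> \sum_a dc x i a * dv x a j = 0.
Proof.
elim/ord3_ind: i; elim/ord3_ind: j => // _; rewrite big3.
- by apply: (@byQ q3 q3 1); rewrite /Q; entries; field.
- by entries; field.
- by apply: (@byQ q4 q4 1); rewrite /Q; entries; field.
- by entries; field.
- by entries; field.
- by entries; field.
Qed.

Lemma wedge_trA : \sum_a dA x a a = 0.
Proof. by rewrite big3; entries; field. Qed.

Lemma wedge_suml : \sum_i dl x i = 0.
Proof. by rewrite big3; entries; field. Qed.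

Let suml3 i j k : i != j -> j != k -> i != k -> dl x i + dl x j + dl x k = 0.
Proof.
rewrite -wedge_suml big3.
by elim/ord3_ind: i; elim/ord3_ind: j => //; elim/ord3_ind: k => // _ _ _; ring.
Qed.

Let vv i j k a b := dv x a i * dv x b j =
  - \sum_e (dA x a e - dl x j * (a == e)%:R) * skew3 (dc x k) e b.

Let vv_sym i j k : i != j -> j != k -> i != k ->
  (forall a b, vv i j k a b) -> forall a b, vv j i k a b.
Proof.
move=> ij jk ik h a b; rewrite /vv mulrC h; congr (- _).
exact: skew3_swap wedge_trA (wedge_cA k) (suml3 ij jk ik) a b.
Qed.

Lemma wedge_vv i j k : i != j -> j != k -> i != k -> forall a b,
  dv x a i * dv x b j =
  - \sum_e (dA x a e - dl x j * (a == e)%:R) * skew3 (dc x k) e b.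
Proof.
have h01 a b : vv i0 i1 i2 a b.
  rewrite /vv big3; apply: (@byQ (V a) (V b) 1); rewrite /Q.
  by elim/ord3_ind: a; elim/ord3_ind: b; entries; field.
have h02 a b : vv i0 i2 i1 a b.
  by rewrite /vv big3; elim/ord3_ind: a; elim/ord3_ind: b; entries; field.
have h12 a b : vv i1 i2 i0 a b.
  by rewrite /vv big3; elim/ord3_ind: a; elim/ord3_ind: b; entries; field.
elim/ord3_ind: i; elim/ord3_ind: j => //; elim/ord3_ind: k => // _ _ _;
  first [exact: h01 | exact: h02 | exact: h12 | exact: vv_sym h01 | exact: vv_sym h02 | exact: vv_sym h12].
Qed.

Let cc i j k a b := dc x i a * dc x j b =
  \sum_e (dA x e a - dl x j * (a == e)%:R) * skew3 (dv x ^~ k) e b.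

Let cc_sym i j k : i != j -> j != k -> i != k ->
  (forall a b, cc i j k a b) -> forall a b, cc j i k a b.
Proof.
move=> ij jk ik h a b; rewrite /cc mulrC h.
have tE p q (t : F) : \sum_e (dA x e p - t * (p == e)%:R) * skew3 (dv x ^~ k) e q =
    \sum_e ((dA x)^T p e - t * (p == e)%:R) * skew3 (dv x ^~ k) e q.
  by apply: eq_bigr => e _; rewrite [_^T _ _]mxE.
rewrite !tE; apply: (skew3_swap (lk := dl x k)).
- by rewrite -[RHS]wedge_trA; apply: eq_bigr => e _; rewrite mxE.
- by move=> e; rewrite -wedge_Av; apply: eq_bigr => d _; rewrite [_^T _ _]mxE mulrC.
- exact: suml3.
Qed.

Lemma wedge_cc i j k : i != j -> j != k -> i != k -> forall a b,
  dc x i a * dc x j b =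
  \sum_e (dA x e a - dl x j * (a == e)%:R) * skew3 (dv x ^~ k) e b.
Proof.
have h01 a b : cc i0 i1 i2 a b.
  rewrite /cc big3; apply: (@byQ (V' a) (V' b) 1); rewrite /Q.
  by elim/ord3_ind: a; elim/ord3_ind: b; entries; field.
have h02 a b : cc i0 i2 i1 a b.
  by rewrite /cc big3; elim/ord3_ind: a; elim/ord3_ind: b; entries; field.
have h12 a b : cc i1 i2 i0 a b.
  by rewrite /cc big3; elim/ord3_ind: a; elim/ord3_ind: b; entries; field.
elim/ord3_ind: i; elim/ord3_ind: j => //; elim/ord3_ind: k => // _ _ _;
  first [exact: h01 | exact: h02 | exact: h12 | exact: cc_sym h01 | exact: cc_sym h02 | exact: cc_sym h12].
Qed.

Lemma wedge_joseph : joseph (dA x) (dl x) (dv x) (dc x).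
Proof.
split.
- exact: wedge_trA.
- exact: wedge_suml.
- exact: wedge_trA2.
- exact: wedge_Av.
- exact: wedge_cA.
- exact: wedge_vc.
- exact: wedge_cv0.
- exact: wedge_vv.
- exact: wedge_cc.
Qed.

End Wedge.
End Data.

(** * Isotropic planes and reflections *)

Section Forms.
Variable F : numClosedFieldType.
Implicit Types (x g : 'M[F]_8) (u v w y z : 'cV[F]_8).
Local Notation J := (J8 F).

Lemma J8E i j : J i j = (i == rev_ord j)%:R.
Proof.
by elim/ord8_ind: i; elim/ord8_ind: j; rewrite mxE.
Qed.

Lemma mulmxJ n (M : 'M[F]_(n, 8)) i j : (M *m J) i j = M i (rev_ord j).
Proof.
rewrite mxE (bigD1 (rev_ord j)) //= big1 ?addr0 => [|k nk]; rewrite J8E.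
  by rewrite eqxx mulr1.
by rewrite (negPf nk) mulr0.
Qed.

Lemma mulJmx n (M : 'M[F]_(8, n)) i j : (J *m M) i j = M (rev_ord i) j.
Proof.
rewrite mxE (bigD1 (rev_ord i)) //= big1 ?addr0 => [|k nk]; rewrite J8E.
  by rewrite rev_ordK eqxx mul1r.
by rewrite -(inj_eq rev_ord_inj) rev_ordK eq_sym (negPf nk) mul0r.
Qed.

Lemma J8T : J^T = J.
Proof. by apply/matrixP => i j; rewrite !mxE addnC. Qed.

Lemma J8K : J *m J = 1%:M.
Proof. by apply/matrixP => i j; rewrite mulJmx J8E !mxE (inj_eq rev_ord_inj). Qed.

Lemma so8P x : reflect (forall i j, x i j = - x (rev_ord j) (rev_ord i)) (in_so8 x).
Proof.
have E i j : (x^T *m J + J *m x) i j = x (rev_ord j) i + x (rev_ord i) j.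
  by rewrite mxE mulmxJ mulJmx mxE.
apply: (iffP eqP) => [h i j|h].
  by apply/eqP; rewrite -addr_eq0 addrC -{2}[i]rev_ordK -E h mxE.
by apply/matrixP => i j; rewrite E mxE h rev_ordK addNr.
Qed.

Definition bf u w : F := \sum_i u i 0 * w (rev_ord i) 0.

Definition wedge u w : 'M[F]_8 := wedgex (u^~ 0) (w^~ 0).

Lemma bfE u w : u^T *m J *m w = (bf u w)%:M.
Proof.
apply/matrixP => i j; rewrite !ord1 mxE mxE eqxx mulr1n [RHS](reindex_inj rev_ord_inj).
by apply: eq_bigr => k _; rewrite mulmxJ mxE rev_ordK.
Qed.

Lemma bfC u w : bf u w = bf w u.
Proof.
rewrite /bf (reindex_inj rev_ord_inj); apply: eq_bigr => i _.
by rewrite rev_ordK mulrC.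
Qed.

Lemma bfDl u v w : bf (u + v) w = bf u w + bf v w.
Proof. by rewrite -big_split; apply: eq_bigr => i _; rewrite mxE mulrDl. Qed.

Lemma bfZl a u w : bf (a *: u) w = a * bf u w.
Proof. by rewrite mulr_sumr; apply: eq_bigr => i _; rewrite mxE mulrA. Qed.

Lemma bfDr u v w : bf w (u + v) = bf w u + bf w v.
Proof. by rewrite !(bfC w) bfDl. Qed.

Lemma bfZr a u w : bf w (a *: u) = a * bf w u.
Proof. by rewrite !(bfC w) bfZl. Qed.

Lemma bfN u w : ((bf (- u) w = - bf u w) * (bf w (- u) = - bf w u))%type.
Proof. by split; rewrite -scaleN1r ?bfZl ?bfZr mulN1r. Qed.

Definition ev (k : 'I_8) : 'cV[F]_8 := delta_mx k 0.

Lemma bf_ev k u : bf (ev k) u = u (rev_ord k) 0.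
Proof.
rewrite /bf (bigD1 k) //= big1 ?addr0 => [|j nj]; rewrite mxE.
  by rewrite !eqxx mul1r.
by rewrite (negPf nj) mul0r.
Qed.

Lemma wedgeE u w : wedge u w = u *m w^T *m J - w *m u^T *m J.
Proof.
apply/matrixP => i j; rewrite [RHS]mxE [(- _ : 'M__) _ _]mxE !mulmxJ.
by rewrite !mxE !big_ord1 !mxE.
Qed.

Lemma wedgeZ a b u w : wedge (a *: u) (b *: w) = (a * b) *: wedge u w.
Proof. by apply/matrixP => i j; rewrite !mxE; ring. Qed.

Lemma wedge_conj (M : 'M[F]_8) u w :
  M^T *m J = J *m M -> M *m wedge u w *m M = wedge (M *m u) (M *m w).
Proof.
move=> h; rewrite !wedgeE mulmxBr mulmxBl !trmx_mul.
by rewrite -!mulmxA h !mulmxA.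
Qed.

(** [bf v v] times the orthogonal reflection in v. With the denominator cleared it is polynomial in
    v, as curves through families of reflections require. *)
Definition refl v : 'M[F]_8 := bf v v *: 1%:M - 2 *: (v *m v^T *m J).

Lemma reflE v y : refl v *m y = bf v v *: y - (2 * bf v y) *: v.
Proof.
rewrite mulmxBl -!scalemxAl mul1mx -!mulmxA [v^T *m _]mulmxA bfE.
by rewrite mul_mx_scalar scalerA.
Qed.

Lemma refl_adj v : (refl v)^T *m J = J *m refl v.
Proof.
have -> : (refl v)^T = bf v v *: 1%:M - 2 *: (J *m (v *m v^T)).
  by rewrite /refl linearB /= !linearZ /= trmx1 !trmx_mul trmxK J8T.
rewrite /refl.
by rewrite mulmxBl mulmxBr -!scalemxAl -!scalemxAr mul1mx mulmx1 !mulmxA.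
Qed.

Lemma reflK v : refl v *m refl v = bf v v ^+ 2 *: 1%:M.
Proof.
rewrite /refl; set P := v *m v^T *m J.
have PP : P *m P = bf v v *: P.
  rewrite /P -!mulmxA [v^T *m (J *m (v *m _))]mulmxA.
  by rewrite [X in v *m X]mulmxA bfE mul_scalar_mx -scalemxAr.
rewrite mulmxBl !mulmxBr -!scalemxAl -!scalemxAr !mul1mx mulmx1 PP.
by apply/matrixP => i j; rewrite !mxE; ring.
Qed.

Fixpoint refls (vs : seq 'cV[F]_8) : 'M[F]_8 :=
  if vs is v :: vs' then refl v *m refls vs' else 1%:M.

Definition anisotropic vs := all (fun v => bf v v != 0) vs.

Lemma refls_orth vs : anisotropic vs ->
  exists2 g, g^T *m J *m g = J & exists2 c, c != 0 & refls vs = c *: g.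
Proof.
elim: vs => [_|v vs IH /= /andP[nv /IH[g og [c nc ->]]]].
  by exists 1%:M; [rewrite trmx1 mul1mx mulmx1 | exists 1; rewrite ?oner_eq0 ?scale1r].
exists ((bf v v)^-1 *: (refl v *m g)).
  rewrite [(_ *: _)^T]linearZ /= trmx_mul -!scalemxAl -scalemxAr.
  have -> : g^T *m (refl v)^T *m J *m (refl v *m g) = bf v v ^+ 2 *: J.
    rewrite -[X in X *m _]mulmxA refl_adj -[X in _ = _ *: X]og.
    rewrite -!mulmxA [refl v *m (refl v *m g)]mulmxA reflK -scalemxAl mul1mx.
    by rewrite -!scalemxAr.
  by rewrite !scalerA; apply/matrixP => i j; rewrite !mxE; field.
exists (bf v v * c); first by rewrite mulf_neq0.
by rewrite -scalemxAr scalerA mulrAC divff // mul1r.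
Qed.

Lemma orth_bf g i j : g^T *m J *m g = J -> bf (col i g) (col j g) = J i j.
Proof.
move=> og; rewrite -og [RHS]mxE /bf [RHS](reindex_inj rev_ord_inj).
by apply: eq_bigr => k _; rewrite mulmxJ !mxE rev_ordK.
Qed.

Lemma orth_inv g : g^T *m J *m g = J -> g \in unitmx /\ invmx g = J *m g^T *m J.
Proof.
move=> og; have h : J *m g^T *m J *m g = 1%:M by rewrite -!mulmxA [g^T *m (J *m g)]mulmxA og J8K.
have ug : g \in unitmx by have [] := mulmx1_unit h.
by split=> //; rewrite -[RHS]mulmx1 -(mulmxV ug) mulmxA h mul1mx.
Qed.

Lemma inord8 : (inord 0 = q0) * (inord 1 = q1) * (inord 2 = q2) * (inord 3 = q3)
  * (inord 4 = q4) * (inord 5 = q5) * (inord 6 = q6) * (inord 7 = q7).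
Proof. by do !split; apply: val_inj; rewrite /= inordK. Qed.

Lemma mul_delta_col g (i j : 'I_8) : g *m delta_mx i j = col i g *m (ev j)^T.
Proof. by rewrite colE -mulmxA trmx_delta mul_delta_mx. Qed.

Lemma conj_Etheta g : g^T *m J *m g = J ->
  g *m E_theta F *m invmx g = wedge (col q0 g) (col q1 g).
Proof.
move=> og; have [ug ->] := orth_inv og.
rewrite /E_theta /dm !inord8 mulmxBr !mul_delta_col mulmxBl wedgeE !mulmxA.
have h k : (ev k)^T *m J *m g^T = (col (rev_ord k) g)^T.
  have -> : (ev k)^T *m J = (ev (rev_ord k))^T.
    apply/matrixP => i j; rewrite mulmxJ !mxE; congr (_ && _)%:R.
    by rewrite -(inj_eq rev_ord_inj) rev_ordK.
  by rewrite -trmx_mul -colE.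
by rewrite -!mulmxA !(mulmxA (ev _)^T) !(mulmxA ((ev _)^T *m J)) !h !rev8.
Qed.

Lemma det_orth g : g^T *m J *m g = J -> \det g = 1 \/ \det g = -1.
Proof.
move=> /(congr1 (fun M => \det (M *m J))).
rewrite J8K !det_mulmx det_tr det1 => h.
have : \det J * \det J = 1 by rewrite -det_mulmx J8K det1.
move=> hJ; have /eqP : \det g ^+ 2 = 1.
  by rewrite -[RHS]h -[LHS]mul1r -hJ; ring.
by rewrite sqrf_eq1 => /orP[] /eqP; [left | right].
Qed.

(** The orbit under SO_8 absorbs both the sign of det g and the factor t: some isometries of
    determinant -1 fix [ev q0] and [ev q1], and a torus scales [ev q0] alone among the two. *)
Lemma Omin_orth g t : g^T *m J *m g = J -> t != 0 ->
  Omin (t *: wedge (col q0 g) (col q1 g)).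
Proof.
move=> og nt.
(* The last entry, on the coordinate [q7] dual to [q0], makes this scaling an isometry. *)
pose d : 'M[F]_8 := diag_mx (\row_k [:: t; 1; 1; 1; 1; 1; 1; t^-1]`_k).
have od : d^T *m J *m d = J.
  rewrite tr_diag_mx; apply/matrixP => i j.
  rewrite mul_mx_diag mul_diag_mx !mxE.
  by elim/ord8_ind: i; elim/ord8_ind: j; rewrite /= ?mulr0 ?mul0r ?mulr1 ?mul1r ?divff ?mulVf.
have dd : \det d = 1.
  rewrite det_diag !big_ord_recr big_ord0 /= !mxE /=; field.
  by rewrite nt.
(* Exchanging the mutually dual coordinates [q2] and [q5] is an isometry of determinant -1, used
   when det g = -1. *)
pose s : 'M[F]_8 := tperm_mx q2 q5.
have os : s^T *m J *m s = J.
  rewrite /s /tperm_mx tr_perm_mx tpermV -row_permE -{2}[tperm q2 q5]tpermV -col_permE.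
  apply/matrixP => i j; rewrite !mxE.
  by elim/ord8_ind: i; elim/ord8_ind: j; rewrite !permE.
have ds : \det s = -1 by rewrite det_perm odd_tperm.
pose h b : 'M[F]_8 := if b then s else 1%:M.
have [b gb] : exists b, \det (g *m d *m h b) = 1.
  have [e | e] := det_orth og; [exists false | exists true];
    by rewrite !det_mulmx dd e ?det1 ?ds; ring.
have oh : (h b)^T *m J *m h b = J.
  by case: b {gb} => //; rewrite trmx1 mul1mx mulmx1.
have o : (g *m d *m h b)^T *m J *m (g *m d *m h b) = J.
  rewrite !trmx_mul -[RHS]oh -[X in _ = _ *m X *m _]od.
  by rewrite -[X in _ = _ *m (_ *m X *m _) *m _]og !mulmxA.
exists (g *m d *m h b); first by rewrite /in_SO8 gb o !eqxx.
rewrite conj_Etheta //.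
have ch k : k != q2 -> k != q5 -> col k (h b) = ev k.
  move=> n2 n5; rewrite /h; case: b {gb oh o}; rewrite colE ?mul1mx //.
  apply/matrixP => i j; rewrite -colE !mxE !ord1 eqxx andbT.
  by rewrite -(inj_eq (@perm_inj _ (tperm q2 q5))) tpermK tpermD // eq_sym.
have cE k (M N : 'M[F]_8) : col k (M *m N) = M *m col k N by rewrite !colE mulmxA.
rewrite !cE !ch //.
have d0 : d *m ev q0 = t *: ev q0.
  by apply/matrixP => i j; rewrite mul_diag_mx !mxE; elim/ord8_ind: i; rewrite /= ?mulr0.
have d1 : d *m ev q1 = 1 *: ev q1.
  by apply/matrixP => i j; rewrite mul_diag_mx !mxE; elim/ord8_ind: i; rewrite /= ?mulr0.
by rewrite -!mulmxA d0 d1 -!scalemxAr wedgeZ mulr1 !colE.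
Qed.

(** The number n of reflections is fixed so that the reflection vectors of two points can be paired
    one by one. The factor t absorbs the scalars left by the unnormalised reflections. *)
Definition reach n x := exists t vs,
  [/\ t != 0, size vs = n, anisotropic vs
    & x = t *: wedge (refls vs *m ev q0) (refls vs *m ev q1)].

Lemma reach_Omin n x : reach n x -> Omin x.
Proof.
case=> t [vs [nt _ /refls_orth[g og [c nc ->]] ->]].
rewrite -!scalemxAl wedgeZ scalerA -!colE.
by apply: Omin_orth og _; rewrite !mulf_neq0.
Qed.

Lemma reach_refl n v u w : bf v v != 0 ->
  reach n (wedge (refl v *m u) (refl v *m w)) -> reach n.+1 (wedge u w).
Proof.
move=> nv [t [vs [nt sz a E]]].
(* A second application of [refl v] multiplies u and w by [bf v v ^+ 2] each, hence the bivector by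
   the fourth power. *)
exists (t / bf v v ^+ 4), (v :: vs); split=> //=.
- by rewrite mulf_neq0 ?invr_eq0 ?expf_neq0.
- by rewrite sz.
- by rewrite nv.
have := congr1 (fun M => refl v *m M *m refl v) E.
rewrite -!scalemxAr -scalemxAl !wedge_conj ?refl_adj // !mulmxA !reflK.
rewrite -!scalemxAl !mul1mx wedgeZ => /(congr1 (fun M => (bf v v ^+ 4)^-1 *: M)).
rewrite !scalerA -exprD mulVf ?expf_neq0 // scale1r => ->.
by rewrite mulrC.
Qed.

(** A reflection vector orthogonal to [ev q0] and [ev q1] acts on both as the scalar [bf v v], here
    2, and so multiplies the bivector by 4. It is put at the end of the list, where it acts
    first. *)
Lemma reach_pad n x : reach n x -> reach n.+1 x.
Proof.
case=> t [vs [nt sz a E]].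
have e : (bf (ev q2 + ev q5) (ev q2 + ev q5) = 2) *
         (bf (ev q2 + ev q5) (ev q0) = 0) * (bf (ev q2 + ev q5) (ev q1) = 0).
  by split; [split|]; rewrite !(bfDl, bfDr) !bf_ev !mxE /=; ring.
have rc : refls (rcons vs (ev q2 + ev q5)) = refls vs *m refl (ev q2 + ev q5).
  by elim: (vs) => [|v l IH] /=; rewrite ?mul1mx ?mulmx1 // IH mulmxA.
exists (t / 4), (rcons vs (ev q2 + ev q5)); split.
- by rewrite mulf_neq0 // invr_eq0 pnatr_eq0.
- by rewrite size_rcons sz.
- by rewrite /anisotropic all_rcons e pnatr_eq0.
rewrite rc -!mulmxA !reflE !e !mulr0 !scale0r !subr0 -!scalemxAr wedgeZ scalerA.
by rewrite -mulrA -natrM mulVf ?pnatr_eq0 // mulr1.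
Qed.

Lemma bf_refl v u w : bf (refl v *m u) (refl v *m w) = bf v v ^+ 2 * bf u w.
Proof. by rewrite !reflE !(bfDl, bfDr, bfN, bfZl, bfZr) (bfC u v); ring. Qed.

Lemma wedge_refl_neq0 v u w : bf v v != 0 -> wedge u w != 0 ->
  wedge (refl v *m u) (refl v *m w) != 0.
Proof.
move=> nv; apply: contraNneq => h.
have := wedge_conj (refl v *m u) (refl v *m w) (refl_adj v).
rewrite h mulmx0 mul0mx !mulmxA !reflK -!scalemxAl !mul1mx wedgeZ => /esym/eqP.
by rewrite scaler_eq0 mulf_eq0 !expf_eq0 /= (negPf nv).
Qed.

Lemma wedgeZl a u w : wedge (a *: u) w = a *: wedge u w.
Proof. by rewrite -{1}[w]scale1r wedgeZ mulr1. Qed.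

Lemma reach0 a b : a != 0 -> b != 0 -> reach 0 (wedge (a *: ev q0) (b *: ev q1)).
Proof.
move=> na nb; exists (a * b), [::]; split=> //=; first by rewrite mulf_neq0.
by rewrite !mul1mx wedgeZ.
Qed.

Lemma reachZ n a x : a != 0 -> reach n x -> reach n (a *: x).
Proof.
move=> na [t [vs [nt sz an ->]]]; exists (a * t), vs; split=> //.
  by rewrite mulf_neq0.
by rewrite scalerA.
Qed.

Let n2 : (2 : F) != 0. Proof. by rewrite pnatr_eq0. Qed.

Lemma bfw_ev k u : bf u (ev k) = u (rev_ord k) 0. Proof. by rewrite bfC bf_ev. Qed.

Lemma cV8_neq0 (u : 'cV[F]_8) : u != 0 -> exists k, u k 0 != 0.
Proof.
move=> nu; have [/existsP//|] := boolP [exists k, u k 0 != 0].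
rewrite negb_exists => /forallP h; case/eqP: nu.
by apply/matrixP => i j; rewrite ord1 mxE; apply/eqP; rewrite -[_ == _]negbK.
Qed.

(** Up to scalars, the reflection in [w - ev q1] interchanges the isotropic vectors w and [ev q1],
    whose pairing [w q6 0] is nonzero, and it fixes [ev q0] because [w q7 0 = 0]. *)
Lemma witt_e0e6 w : bf w w = 0 -> w q7 0 = 0 -> w q6 0 != 0 ->
  reach 1 (wedge (ev q0) w).
Proof.
move=> hw w7 w6.
have bv : bf (w - ev q1) (w - ev q1) = - 2 * w q6 0.
  by rewrite !(bfDl, bfDr, bfN) hw bf_ev bfw_ev !bf_ev rev8 mxE /=; ring.
have nv : bf (w - ev q1) (w - ev q1) != 0.
  by rewrite bv mulf_neq0 // oppr_eq0.
apply: (reach_refl nv); rewrite !reflE bv.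
have -> : bf (w - ev q1) (ev q0) = 0.
  by rewrite !(bfDl, bfN) bfw_ev bf_ev !rev8 w7 mxE /=; ring.
have -> : bf (w - ev q1) w = - w q6 0.
  by rewrite !(bfDl, bfN) hw bf_ev rev8 add0r.
rewrite mulr0 scale0r subr0.
have -> : (-2 * w q6 0) *: w - (2 * - w q6 0) *: (w - ev q1) = (-2 * w q6 0) *: ev q1.
  by apply/matrixP => i j; rewrite !mxE; ring.
by apply: reach0; rewrite -bv.
Qed.

Lemma witt_e0 w : bf w w = 0 -> w q7 0 = 0 -> wedge (ev q0) w != 0 ->
  reach 2 (wedge (ev q0) w).
Proof.
move=> hw w7 nw; have [w6|w6] := eqVneq (w q6 0) 0; last first.
  exact: reach_pad (witt_e0e6 hw w7 w6).
(* One more reflection, fixing the line of [ev q0], makes the coordinate [q6] nonzero. *)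
have [v [nv v7 v6 bvw]] : exists v, [/\ bf v v != 0, v q7 0 = 0, v q6 0 != 0 & bf v w != 0].
  have [w1|w1] := eqVneq (w q1 0) 0; last first.
    exists (ev q6 + ev q1); split; rewrite ?(bfDl, bfDr) ?bf_ev ?rev8 ?mxE /= ?w6 ?addr0 ?add0r ?oner_neq0 //.
  (* A multiple of [ev q0] added to w does not change the bivector, so w - w_0 e_0 is nonzero; as
     w_1, w_6, w_7 vanish, a middle coordinate does not. *)
  have [k nk kin] : exists2 k, w k 0 != 0 & k \in [:: q2; q3; q4; q5].
    have /cV8_neq0[k] : w - w q0 0 *: ev q0 != 0.
      apply: contraNneq nw => /eqP; rewrite subr_eq0 => /eqP ->.
      by apply/eqP/matrixP => i j; rewrite !mxE; ring.
    rewrite !mxE; elim/ord8_ind: k; rewrite /= ?mulr1 ?mulr0 ?subr0 ?subrr ?w1 ?w6 ?w7 ?eqxx // => nk;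
    by [exists q2 | exists q3 | exists q4 | exists q5].
  exists (ev q6 + ev q1 + ev (rev_ord k)).
  by move: nk kin; elim/ord8_ind: k => //= nk _; rewrite ?rev8; split;
    rewrite ?(bfDl, bfDr) ?bf_ev ?rev8 ?mxE /= ?w6 ?w1 ?addr0 ?add0r ?oner_neq0.
apply: (reach_refl nv); rewrite (reflE v (ev q0)) bfw_ev rev8 v7 mulr0 scale0r subr0.
rewrite wedgeZl; apply: reachZ => //; apply: witt_e0e6.
- by rewrite bf_refl hw mulr0.
- by rewrite reflE !mxE w7 v7; ring.
- by rewrite reflE !mxE w6 mulr0 add0r oppr_eq0 !mulf_neq0.
Qed.

(** The reflection in [u - ev q0] carries u to a multiple of [ev q0], since their pairing [u q7 0]
    is nonzero. The image of w stays orthogonal to it, so its coordinate [q7] vanishes and [witt_e0]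
    applies. *)
Lemma witt_q7 u w : bf u u = 0 -> bf u w = 0 -> bf w w = 0 -> wedge u w != 0 ->
  u q7 0 != 0 -> reach 3 (wedge u w).
Proof.
move=> hu huw hw nuw u7.
have bv : bf (u - ev q0) (u - ev q0) = - 2 * u q7 0.
  by rewrite !(bfDl, bfDr, bfN) hu bf_ev bfw_ev !bf_ev rev8 mxE /=; ring.
have nv : bf (u - ev q0) (u - ev q0) != 0.
  by rewrite bv mulf_neq0 // oppr_eq0.
have E : refl (u - ev q0) *m u = (-2 * u q7 0) *: ev q0.
  rewrite reflE bv; have -> : bf (u - ev q0) u = - u q7 0.
    by rewrite !(bfDl, bfN) hu bf_ev rev8 add0r.
  by apply/matrixP => i j; rewrite !mxE; ring.
have n7 : -2 * u q7 0 != 0 by rewrite -bv.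
apply: (reach_refl nv).
have := bf_refl (u - ev q0) u w; have := wedge_refl_neq0 nv nuw.
rewrite E huw mulr0 bfZl bf_ev rev8 wedgeZl scaler_eq0 negb_or n7 /= => ne /eqP.
rewrite mulf_eq0 (negPf n7) /= => /eqP w7; apply: reachZ => //.
by apply: witt_e0 => //; rewrite bf_refl hw mulr0.
Qed.

(** Witt's theorem for isotropic planes, with a count: one reflection to make [u q7 0] nonzero, one
    to move u to the line of [ev q0], two for w. Padding makes the number exactly four. *)
Lemma witt u w : bf u u = 0 -> bf u w = 0 -> bf w w = 0 -> wedge u w != 0 ->
  reach 4 (wedge u w).
Proof.
move=> hu huw hw nuw; have [u7|u7] := eqVneq (u q7 0) 0; last first.
  exact: reach_pad (witt_q7 hu huw hw nuw u7).
have [v [nv v7 bvu]] : exists v, [/\ bf v v != 0, v q7 0 != 0 & bf v u != 0].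
  have [u0|u0] := eqVneq (u q0 0) 0; last first.
    exists (ev q7 + ev q0); split; rewrite ?(bfDl, bfDr) ?bf_ev ?rev8 ?mxE /= ?u7 ?addr0 ?add0r ?oner_neq0 //.
  have /cV8_neq0[k nk] : u != 0.
    by apply: contraNneq nuw => ->; apply/eqP/matrixP => i j; rewrite !mxE; ring.
  exists (ev q7 + ev q0 + ev (rev_ord k)).
  by move: nk; elim/ord8_ind: k; rewrite ?u0 ?u7 ?eqxx // ?rev8 => nk; split;
    rewrite ?(bfDl, bfDr) ?bf_ev ?rev8 ?mxE /= ?u0 ?u7 ?addr0 ?add0r ?oner_neq0.
apply: (reach_refl nv); apply: witt_q7.
- by rewrite bf_refl hu mulr0.
- by rewrite bf_refl huw mulr0.
- by rewrite bf_refl hw mulr0.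
- exact: wedge_refl_neq0.
- by rewrite reflE !mxE u7 mulr0 add0r oppr_eq0 !mulf_neq0.
Qed.

Lemma Omin_wedge x : Omin x -> exists u w,
  [/\ bf u u = 0, bf u w = 0, bf w w = 0, x != 0 & x = wedge u w].
Proof.
case=> g /andP[/eqP og _ ->]; have [ug _] := orth_inv og.
exists (col q0 g), (col q1 g); rewrite !orth_bf // !J8E !rev8; split=> //.
  apply/eqP => h.
  have : E_theta F = 0 by rewrite -[LHS](mulKmx ug) -[g *m _](mulmxKV ug) h mul0mx mulmx0.
  move/matrixP/(_ q0 q6); rewrite /E_theta /dm !inord8 !mxE /= subr0 => /eqP.
  by rewrite oner_eq0.
exact: conj_Etheta.
Qed.

Lemma Omin_reach x : Omin x -> reach 4 x.
Proof. by case/Omin_wedge=> u [w [hu huw hw nx E]]; move: nx; rewrite E; apply: witt. Qed.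

Lemma Omin_so8 x : Omin x -> in_so8 x.
Proof.
case/Omin_wedge=> u [w [_ _ _ _ ->]]; apply/so8P => i j.
by rewrite !mxE rev_ordK; ring.
Qed.

Lemma Omin_joseph x : Omin x -> joseph (dA x) (dl x) (dv x) (dc x).
Proof.
case/Omin_wedge=> u [w [hu huw hw _ ->]].
have half y : bf y y = 2 * (y q0 0 * y q7 0 + y q1 0 * y q6 0 + y q2 0 * y q5 0 + y q3 0 * y q4 0).
  by rewrite /bf big8 !rev8; ring.
apply: wedge_joseph.
- by move/eqP: hu; rewrite half mulf_eq0 (negPf n2) => /eqP.
- by move/eqP: hw; rewrite half mulf_eq0 (negPf n2) => /eqP.
- by rewrite -huw /bf big8 !rev8.
Qed.

End Forms.

(** * Irreducibility of the minimal orbit *)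

Section PolynomialFunctions.
Variable F : numClosedFieldType.

Definition upoly (f : F -> F) := exists p : {poly F}, forall t, f t = p.[t].

Lemma upoly_ext f g : f =1 g -> upoly f -> upoly g.
Proof. by move=> e [p hp]; exists p => t; rewrite -e. Qed.

Lemma upoly_const a : upoly (fun=> a).
Proof. by exists a%:P => t; rewrite hornerC. Qed.

Lemma upoly_id : upoly id.
Proof. by exists 'X => t; rewrite hornerX. Qed.

Lemma upolyD f g : upoly f -> upoly g -> upoly (fun t => f t + g t).
Proof. by move=> [p hp] [q hq]; exists (p + q) => t; rewrite hornerD hp hq. Qed.

Lemma upolyM f g : upoly f -> upoly g -> upoly (fun t => f t * g t).
Proof. by move=> [p hp] [q hq]; exists (p * q) => t; rewrite hornerM hp hq. Qed.

Lemma upolyB f g : upoly f -> upoly g -> upoly (fun t => f t - g t).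
Proof. by move=> [p hp] [q hq]; exists (p - q) => t; rewrite hornerD hornerN hp hq. Qed.

Lemma upolyX f n : upoly f -> upoly (fun t => f t ^+ n).
Proof. by move=> [p hp]; exists (p ^+ n) => t; rewrite horner_exp hp. Qed.

Lemma upoly_sum (I : Type) (r : seq I) (f : I -> F -> F) :
  (forall i, upoly (f i)) -> upoly (fun t => \sum_(i <- r) f i t).
Proof.
move=> h; elim: r => [|i r IH].
  by apply: upoly_ext (upoly_const 0) => t; rewrite big_nil.
by apply: upoly_ext (upolyD (h i) IH) => t; rewrite big_cons.
Qed.

Lemma upoly_prod (I : Type) (r : seq I) (f : I -> F -> F) :
  (forall i, upoly (f i)) -> upoly (fun t => \prod_(i <- r) f i t).
Proof.
move=> h; elim: r => [|i r IH].
  by apply: upoly_ext (upoly_const 1) => t; rewrite big_nil.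
by apply: upoly_ext (upolyM (h i) IH) => t; rewrite big_cons.
Qed.

Lemma upoly_meval n (p : {mpoly F[n]}) (v : F -> 'I_n -> F) :
  (forall i, upoly (v^~ i)) -> upoly (fun t => p.@[v t]).
Proof.
move=> h; have h' : upoly (fun t => \sum_(m <- msupp p) p@_m * \prod_i v t i ^+ m i).
  apply: upoly_sum => m; apply: upolyM; first exact: upoly_const.
  by apply: upoly_prod => i; apply: upolyX.
by apply: upoly_ext h' => t; rewrite mevalE.
Qed.

Lemma upoly_nonroot (f g h : F -> F) a b c :
  upoly f -> upoly g -> upoly h -> f a != 0 -> g b != 0 -> h c != 0 ->
  exists t, [/\ f t != 0, g t != 0 & h t != 0].
Proof.
move=> [p hp] [q hq] [r hr]; rewrite hp hq hr => fa gb hc.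
have nz (s : {poly F}) d : s.[d] != 0 -> s != 0.
  by apply: contraNneq => ->; rewrite horner0.
have /closed_nonrootP[t] : p * q * r != 0 by rewrite !mulf_neq0 ?(nz _ _ fa) ?(nz _ _ gb) ?(nz _ _ hc).
rewrite rootE !hornerM !mulf_eq0 !negb_or -andbA => /and3P[h1 h2 h3].
by exists t; rewrite hp hq hr.
Qed.

Definition upolymx m n (M : F -> 'M[F]_(m, n)) := forall i j, upoly (fun t => M t i j).

Lemma upolymx_const m n (M : 'M[F]_(m, n)) : upolymx (fun=> M).
Proof. by move=> i j; apply: upoly_const. Qed.

Lemma upolymxD m n (M N : F -> 'M[F]_(m, n)) :
  upolymx M -> upolymx N -> upolymx (fun t => M t + N t).
Proof.
by move=> hM hN i j; apply: upoly_ext (upolyD (hM i j) (hN i j)) => t; rewrite mxE.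
Qed.

Lemma upolymxZ m n (a : F -> F) (M : F -> 'M[F]_(m, n)) :
  upoly a -> upolymx M -> upolymx (fun t => a t *: M t).
Proof.
by move=> ha hM i j; apply: upoly_ext (upolyM ha (hM i j)) => t; rewrite mxE.
Qed.

Lemma upolymxM m n p (M : F -> 'M[F]_(m, n)) (N : F -> 'M[F]_(n, p)) :
  upolymx M -> upolymx N -> upolymx (fun t => M t *m N t).
Proof.
move=> hM hN i j.
have h : upoly (fun t => \sum_k M t i k * N t k j).
  by apply: upoly_sum => k; apply: upolyM.
by apply: upoly_ext h => t; rewrite mxE.
Qed.

Lemma upoly_bf (u w : F -> 'cV[F]_8) :
  upolymx u -> upolymx w -> upoly (fun t => bf (u t) (w t)).
Proof. by move=> hu hw; apply: upoly_sum => i; apply: upolyM. Qed.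

Lemma upolymx_wedge (u w : F -> 'cV[F]_8) :
  upolymx u -> upolymx w -> upolymx (fun t => wedge (u t) (w t)).
Proof.
move=> hu hw i j.
have h := upolyB (upolyM (hu i 0) (hw (rev_ord j) 0)) (upolyM (hw i 0) (hu (rev_ord j) 0)).
by apply: upoly_ext h => t; rewrite mxE.
Qed.

Lemma upolymx_refl (v : F -> 'cV[F]_8) : upolymx v -> upolymx (fun t => refl (v t)).
Proof.
move=> hv; apply: upolymxD.
  by apply: upolymxZ; [apply: upoly_bf | apply: upolymx_const].
have h : upolymx (fun t => (-2) *: (v t *m (v t)^T *m J8 F)).
  apply: upolymxZ; first exact: upoly_const.
  apply: upolymxM; last exact: upolymx_const.
  by apply: upolymxM => // i j; apply: upoly_ext (hv j i) => t; rewrite mxE.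
by move=> i j; apply: upoly_ext (h i j) => t; rewrite scaleNr.
Qed.

Definition segment (n m : nat) (a b : 'M[F]_(n, m)) t := (1 - t) *: a + t *: b.

Lemma upolymx_segment n m (a b : 'M[F]_(n, m)) : upolymx (segment a b).
Proof.
apply: upolymxD; apply: upolymxZ; try exact: upolymx_const; last exact: upoly_id.
by apply: upolyB; [apply: upoly_const | apply: upoly_id].
Qed.

(* Two points of the orbit are values at t = 0 and t = 1 of one polynomial curve,
   obtained by joining the two families of reflection vectors by segments. *)
Lemma Omin_irreducible (f h : {mpoly F[8 * 8]}) x y : Omin x -> Omin y ->
  f.@[coord8 x] != 0 -> h.@[coord8 y] != 0 ->
  exists z, [/\ Omin z, f.@[coord8 z] != 0 & h.@[coord8 z] != 0].
Proof.
move=> /Omin_reach[a [vs [na sz an xE]]] /Omin_reach[b [ws [nb sz' bn yE]]] fx hy.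
pose V t := [seq segment p.1 p.2 t | p <- zip vs ws].
pose T t := (1 - t) * a + t * b.
pose c t := T t *: wedge (refls (V t) *m ev F q0) (refls (V t) *m ev F q1).
have V0 : V 0 = vs.
  rewrite -[RHS](@unzip1_zip _ _ vs ws) ?sz ?sz' //; apply: eq_map => p.
  by rewrite /segment subr0 scale1r scale0r addr0.
have V1 : V 1 = ws.
  rewrite -[RHS](@unzip2_zip _ _ vs ws) ?sz ?sz' //; apply: eq_map => p.
  by rewrite /segment subrr scale1r scale0r add0r.
have T0 : T 0 = a by rewrite /T subr0 mul1r mul0r addr0.
have T1 : T 1 = b by rewrite /T subrr mul1r mul0r add0r.
have c0 : c 0 = x by rewrite /c V0 T0.
have c1 : c 1 = y by rewrite /c V1 T1.
have pT : upoly T.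
  apply: upolyD; apply: upolyM; try exact: upoly_const; last exact: upoly_id.
  by apply: upolyB; [apply: upoly_const | apply: upoly_id].
have pR : upolymx (fun t => refls (V t)).
  rewrite /V; elim: (zip vs ws) => [|p s IH] /=; first exact: upolymx_const.
  by apply: upolymxM IH; apply/upolymx_refl/upolymx_segment.
have pc : upolymx c.
  by apply: upolymxZ => //; apply: upolymx_wedge; apply: upolymxM => //; apply: upolymx_const.
have pm (p : {mpoly F[8 * 8]}) : upoly (fun t => p.@[coord8 (c t)]).
  apply: upoly_meval => k; rewrite /coord8.
  by case/mxvec_indexP: k => i j; apply: upoly_ext (pc i j) => t; rewrite mxvecE.
(* The curve lies in the orbit wherever [T t] and all [bf v v] are nonzero; as one polynomial, this
   condition is avoided together with the zeros of f and h. *)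
have pN : upoly (fun t => T t * \prod_(v <- V t) bf v v).
  apply: upolyM => //; rewrite /V; elim: (zip vs ws) => [|p s IH].
    by apply: upoly_ext (upoly_const 1) => t; rewrite big_nil.
  have h' := upolyM (upoly_bf (upolymx_segment p.1 p.2) (upolymx_segment p.1 p.2)) IH.
  by apply: upoly_ext h' => t; rewrite big_cons.
have N0 : T 0 * \prod_(v <- V 0) bf v v != 0.
  by rewrite T0 V0 mulf_neq0 // prodf_seq_neq0; apply: sub_all an => v ->.
have [||t [ft ht Nt]] := @upoly_nonroot _ _ _ 0 1 0 (pm f) (pm h) pN _ _ N0.
- by rewrite c0.
- by rewrite c1.
exists (c t); split=> //; apply: (@reach_Omin _ 4).
move: Nt; rewrite mulf_eq0 negb_or => /andP[Tt Pt].
exists (T t), (V t); split=> //.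
  by rewrite size_map size_zip sz sz' minnn.
by move: Pt; rewrite prodf_seq_neq0; apply: sub_all.
Qed.

End PolynomialFunctions.

(** * Regular points *)

Lemma det3 (R : comNzRingType) (g : 'M[R]_3) : \det g =
  g i0 i0 * (g i1 i1 * g i2 i2 - g i1 i2 * g i2 i1)
  - g i0 i1 * (g i1 i0 * g i2 i2 - g i1 i2 * g i2 i0)
  + g i0 i2 * (g i1 i0 * g i2 i1 - g i1 i1 * g i2 i0).
Proof.
rewrite (expand_det_row _ i0) big3 /cofactor !(expand_det_row _ ord0).
rewrite !big_ord_recl !big_ord0 /cofactor !det_mx11 !mxE /=.
have in1 (a : 'I_1) : (lift (ord0 : 'I_2) a = @Ordinal 2 1 isT) *
    (lift (@Ordinal 2 1 isT) a = ord0 :> 'I_2).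
  by rewrite ord1; split; apply: val_inj.
have in2 : (lift i0 ord0 = i1) * (lift i0 (@Ordinal 2 1 isT) = i2) *
    (lift i1 ord0 = i0) * (lift i1 (@Ordinal 2 1 isT) = i2) *
    (lift i2 ord0 = i0) * (lift i2 (@Ordinal 2 1 isT) = i1).
  by do !split; apply: val_inj.
rewrite !in1 !in2 /bump /=.
ring.
Qed.

Section OpenSet.
Variable F : numClosedFieldType.
Implicit Types (x : 'M[F]_8) (A v c g : 'M[F]_3) (l : 'I_3 -> F).

(** Inverse of the coordinates [dA], [dl], [dv], [dc]. The matrix is antisymmetric about the
    antidiagonal for arbitrary data; the coordinates are recovered when A and l have sum zero on the
    diagonal and over the indices. *)
Definition X8 A l v c : 'M[F]_8 := \matrix_(i, j) nth 0 (nth [::]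
  [:: [:: A i0 i0 - l i2; - c i2 i2; c i2 i1; - v i0 i0; - v i0 i1; A i0 i2; A i0 i1; 0];
      [:: v i2 i2; l i2 - A i1 i1; - A i2 i1; - c i1 i1; - c i0 i1; - v i0 i2; 0; - A i0 i1];
      [:: - v i1 i2; - A i1 i2; l i2 - A i2 i2; - c i1 i2; - c i0 i2; 0; v i0 i2; - A i0 i2];
      [:: c i0 i0; v i1 i1; v i2 i1; l i1 - l i0; 0; c i0 i2; c i0 i1; v i0 i1];
      [:: c i1 i0; v i1 i0; v i2 i0; 0; l i0 - l i1; c i1 i2; c i1 i1; v i0 i0];
      [:: A i2 i0; c i2 i0; 0; - v i2 i0; - v i2 i1; A i2 i2 - l i2; A i2 i1; - c i2 i1];
      [:: A i1 i0; 0; - c i2 i0; - v i1 i0; - v i1 i1; A i1 i2; A i1 i1 - l i2; c i2 i2];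
      [:: 0; - A i1 i0; - A i2 i0; - c i1 i0; - c i0 i0; v i1 i2; - v i2 i2; l i2 - A i0 i0]] i) j.

Lemma so8_mid0 x i : in_so8 x -> x i (rev_ord i) = 0.
Proof.
move=> /so8P/(_ i (rev_ord i)); rewrite rev_ordK => /eqP.
by rewrite -addr_eq0 -mulr2n mulrn_eq0 => /eqP.
Qed.

Lemma so8E x : in_so8 x -> x = X8 (dA x) (dl x) (dv x) (dc x).
Proof.
move=> sx; have/so8P h := sx; have h0 i := so8_mid0 i sx.
move: (h0 q0) (h0 q1) (h0 q2) (h0 q3) (h0 q4) (h0 q5) (h0 q6) (h0 q7).
rewrite !rev8 => e0 e1 e2 e3 e4 e5 e6 e7.
apply/matrixP => i j; rewrite [RHS]mxE.
elim/ord8_ind: i; elim/ord8_ind: j; rewrite /= ?(e0, e1, e2, e3, e4, e5, e6, e7) //;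
  rewrite /dA /dv /dc ?mx3E /dl /blocktr /=;
  first [by field | by rewrite [LHS]h !rev8; field].
Qed.

Lemma X8_so8 A l v c : in_so8 (X8 A l v c).
Proof.
apply/so8P => i j; rewrite !mxE.
by elim/ord8_ind: i; elim/ord8_ind: j; rewrite /=; ring.
Qed.

Lemma mx3_eq (R : nmodType) (M N : 'M[R]_3) :
  M i0 i0 = N i0 i0 -> M i0 i1 = N i0 i1 -> M i0 i2 = N i0 i2 ->
  M i1 i0 = N i1 i0 -> M i1 i1 = N i1 i1 -> M i1 i2 = N i1 i2 ->
  M i2 i0 = N i2 i0 -> M i2 i1 = N i2 i1 -> M i2 i2 = N i2 i2 -> M = N.
Proof.
by move=> *; apply/matrixP; do 2![elim/ord3_ind].
Qed.

Lemma X8_data A l v c (x := X8 A l v c) : \sum_a A a a = 0 -> \sum_i l i = 0 ->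
  [/\ dA x = A, dl x =1 l, dv x = v & dc x = c].
Proof.
rewrite !big3 => hA hl.
have {hA}hA : A i2 i2 = - A i0 i0 - A i1 i1.
  by apply/eqP; rewrite -subr_eq0 -hA; apply/eqP; ring.
have {hl}hl : l i2 = - l i0 - l i1.
  by apply/eqP; rewrite -subr_eq0 -hl; apply/eqP; ring.
split.
- by apply: mx3_eq; rewrite /dA mx3E /blocktr !mxE //= hA hl; field.
- by elim/ord3_ind; rewrite /dl /blocktr !mxE /= hA hl; field.
- by apply: mx3_eq; rewrite /dv mx3E !mxE /= ?opprK.
- by apply: mx3_eq; rewrite /dc mx3E !mxE /= ?opprK.
Qed.

Lemma eq_cof (y z d e : F) : d = 0 -> y - z = e * d -> y = z.
Proof. by move=> ->; rewrite mulr0 => /eqP; rewrite subr_eq0 => /eqP. Qed.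

(** * The relations place a point with l_0 different from l_1 in the orbit *)

Section JosephWedge.
Variables (A v c : 'M[F]_3) (l : 'I_3 -> F).
Hypothesis J : joseph A l v c.

Let l2E : l i2 = - l i0 - l i1.
Proof.
by apply: (@eq_cof _ _ (\sum_i l i) 1 (j_suml J)); rewrite big3; ring.
Qed.

Lemma vc_diff a b :
  v a i0 * c i0 b - v a i1 * c i1 b = (l i0 - l i1) * (A a b - l i2 * (a == b)%:R).
Proof. by rewrite !(j_vc J) l2E; ring. Qed.

Lemma vv_diff a b : v a i0 * v b i1 - v a i1 * v b i0 = (l i1 - l i0) * skew3 (c i2) a b.
Proof.
rewrite !(@j_vv _ _ _ _ _ J _ _ i2) // !big3.
by elim/ord3_ind: a; elim/ord3_ind: b; rewrite /=; ring.
Qed.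

Lemma cc_diff a b :
  c i0 a * c i1 b - c i1 a * c i0 b = (l i0 - l i1) * skew3 (v^~ i2) a b.
Proof.
rewrite !(@j_cc _ _ _ _ _ J _ _ i2) // !big3.
by elim/ord3_ind: a; elim/ord3_ind: b; rewrite /=; ring.
Qed.

Lemma cv_diag i : \sum_a c i a * v a i = 3 * l i ^+ 2 - (\sum_k l k ^+ 2) / 2.
Proof.
under eq_bigr do rewrite mulrC (j_vc J).
rewrite !big_split /= (j_trA2 J) -mulr_sumr (j_trA J) !big3 /=.
by field.
Qed.

Let x := X8 A l v c.
Let V (a : 'I_3) : 'I_8 := nth q0 [:: q0; q6; q5] a.
Let V' (a : 'I_3) : 'I_8 := nth q0 [:: q7; q1; q2] a.

Let xVV a b : x (V a) (V b) = A a b - l i2 * (a == b)%:R.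
Proof. by rewrite mxE; elim/ord3_ind: a; elim/ord3_ind: b; rewrite /=; ring. Qed.
Let xV'V' a b : x (V' a) (V' b) = l i2 * (a == b)%:R - A b a.
Proof. by rewrite mxE; elim/ord3_ind: a; elim/ord3_ind: b; rewrite /=; ring. Qed.
Let xVV' a b : x (V a) (V' b) = - skew3 (c i2) a b.
Proof. by rewrite mxE; elim/ord3_ind: a; elim/ord3_ind: b; rewrite /skew3 mx3E /=; ring. Qed.
Let xV'V a b : x (V' a) (V b) = - skew3 (v^~ i2) a b.
Proof. by rewrite mxE; elim/ord3_ind: a; elim/ord3_ind: b; rewrite /skew3 mx3E /=; ring. Qed.
Let xV3 a : ((x (V a) q3 = - v a i0) * (x (V a) q4 = - v a i1) *
  (x (V' a) q3 = - c i1 a) * (x (V' a) q4 = - c i0 a))%type.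
Proof. by rewrite !mxE; elim/ord3_ind: a. Qed.
Let x3V a : ((x q3 (V a) = c i0 a) * (x q4 (V a) = c i1 a) *
  (x q3 (V' a) = v a i1) * (x q4 (V' a) = v a i0))%type.
Proof. by rewrite !mxE; elim/ord3_ind: a. Qed.
Let x33 : ((x q3 q3 = l i1 - l i0) * (x q3 q4 = 0) * (x q4 q3 = 0) * (x q4 q4 = l i0 - l i1))%type.
Proof. by rewrite !mxE. Qed.

Let index_ind (P : 'I_8 -> Prop) :
  (forall a, P (V a)) -> (forall a, P (V' a)) -> P q3 -> P q4 -> forall i, P i.
Proof.
move=> hV hV' h3 h4; have := (hV i0, hV i1, hV i2, hV' i0, hV' i1, hV' i2).
by case=> [[[[[? ?] ?] ?] ?] ?]; elim/ord8_ind.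
Qed.

Let revV a : ((rev_ord (V a) = V' a) * (rev_ord (V' a) = V a))%type.
Proof. by split; elim/ord3_ind: a; apply: val_inj. Qed.

(** The entry at ([q3], [q3]) is l_1 - l_0. Where this Pluecker coordinate is nonzero, a
    decomposable bivector is recovered from its columns [q3] and [q4]. The blocks are differences of
    two relations for the indices 0 and 1, whose leading terms in A cancel. *)
Lemma X8_pluecker i j :
  (l i0 - l i1) * x i j = x i q3 * x (rev_ord j) q4 - x i q4 * x (rev_ord j) q3.
Proof.
elim/index_ind: i => [a|a||]; elim/index_ind: j => [b|b||];
  rewrite ?revV ?rev8 ?xVV ?xV'V' ?xVV' ?xV'V ?xV3 ?x3V ?x33; try ring.
- by rewrite -vc_diff; ring.
- by rewrite mulrN -mulNr opprB -vv_diff; ring.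
- by rewrite mulrN -cc_diff; ring.
- by rewrite [a == b]eq_sym -[X in _ * X]opprB mulrN -vc_diff; ring.
Qed.

Lemma X8_Omin : l i0 != l i1 -> Omin x.
Proof.
rewrite -subr_eq0 => nl.
have co p i : col p x i 0 = x i p by rewrite !mxE.
have sc a p i : (a *: col p x) i 0 = a * x i p by rewrite mxE co.
have E : x = wedge ((l i0 - l i1)^-1 *: col q3 x) (col q4 x).
  apply/matrixP => i j; rewrite [RHS]mxE.
  apply: (mulfI nl); rewrite X8_pluecker !sc !co.
  by field.
(* Isotropy of the two columns: their norms vanish by [j_cv0], and their pairing by [cv_diag] at
   [i0] and [i1]. *)
have H : ((bf (col q3 x) (col q3 x) = 0) * (bf (col q3 x) (col q4 x) = 0) *
    (bf (col q4 x) (col q4 x) = 0))%type.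
  have Q p q : bf (col p x) (col q x) = \sum_a x (V a) p * x (V' a) q +
      \sum_a x (V' a) p * x (V a) q + x q3 p * x q4 q + x q4 p * x q3 q.
    by rewrite /bf big8 !big3 !rev8 !co /V /V' /=; ring.
  have c10 := @j_cv0 _ _ _ _ _ J i1 i0 isT.
  have c01 := @j_cv0 _ _ _ _ _ J i0 i1 isT.
  move: (cv_diag i0) (cv_diag i1) c10 c01.
  rewrite !Q !big3 !xV3 !x33 l2E => d0 d1 c10 c01.
  split; [split|].
  - apply: (eq_cof (e := 2) c10); ring.
  - move/eqP: d0; rewrite -subr_eq0 => /eqP d0; move/eqP: d1; rewrite -subr_eq0 => /eqP d1.
    by apply: (eq_cof (e := 1) d0); apply: (eq_cof (e := 1) d1); field.
  - apply: (eq_cof (e := 2) c01); ring.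
have nx : x q3 q3 != 0 by rewrite x33 -opprB oppr_eq0.
rewrite E; apply: (@reach_Omin _ 4); apply: witt; rewrite ?bfZl ?bfZr ?H ?mulr0 //.
by rewrite -E; apply: contraNneq nx => ->; rewrite mxE.
Qed.

End JosephWedge.

Definition D x := (dl x i0 - dl x i1) * (dl x i1 - dl x i2) * (dl x i2 - dl x i0).

(** Defined by relations symmetric in the three triples, so that stability under the group is a
    direct check. [W_Omin] and [Omin_W] identify it with the part of [Omin] where [D] is nonzero. *)
Definition W x := [/\ in_so8 x, joseph (dA x) (dl x) (dv x) (dc x) & D x != 0].

Lemma W_Omin x : W x -> Omin x.
Proof.
case=> sx jx Dx; rewrite (so8E sx); apply: X8_Omin => //.
by apply: contraNneq Dx => e; rewrite /D e subrr !mul0r.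
Qed.

Lemma Omin_W x : Omin x -> D x != 0 -> W x.
Proof. by move=> ox Dx; split=> //; [apply: Omin_so8 | apply: Omin_joseph]. Qed.

End OpenSet.

(** * The image of psi *)

Lemma ordS3 : (ordS i0 = i1) * (ordS i1 = i2) * (ordS i2 = i0) *
  (ord_pred i0 = i2) * (ord_pred i1 = i0) * (ord_pred i2 = i1).
Proof. by do !split; apply: val_inj. Qed.

Section Psi.
Variable F : numClosedFieldType.
Implicit Types (x : 'M[F]_8) (A v c g : 'M[F]_3) (l : 'I_3 -> F).

Definition adj3 g : 'M[F]_3 := mx3
  [:: [:: g i1 i1 * g i2 i2 - g i1 i2 * g i2 i1;
          g i0 i2 * g i2 i1 - g i0 i1 * g i2 i2;
          g i0 i1 * g i1 i2 - g i0 i2 * g i1 i1];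
      [:: g i1 i2 * g i2 i0 - g i1 i0 * g i2 i2;
          g i0 i0 * g i2 i2 - g i0 i2 * g i2 i0;
          g i0 i2 * g i1 i0 - g i0 i0 * g i1 i2];
      [:: g i1 i0 * g i2 i1 - g i1 i1 * g i2 i0;
          g i0 i1 * g i2 i0 - g i0 i0 * g i2 i1;
          g i0 i0 * g i1 i1 - g i0 i1 * g i1 i0]].

Lemma mulmx1_inv (n : nat) (M N : 'M[F]_n) : M *m N = 1%:M -> invmx M = N.
Proof.
move=> h; have [uM _] := mulmx1_unit h.
by rewrite -[LHS]mulmx1 -h mulKmx.
Qed.

Lemma invmx_adj3 g : \det g = 1 -> invmx g = adj3 g.
Proof.
move=> dg; apply: mulmx1_inv; rewrite -dg det3.
by apply: mx3_eq; rewrite !mxE big3 /adj3 !mx3E /=; ring.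
Qed.

(* [psi g l] is the image of the point with coordinates [psi_A], [l], [psi_v], [psi_c]. *)
Definition psi_v g l : 'M[F]_3 := \matrix_(a, i) ((l i - l (ordS i)) * g a i).

Definition psi_c g l : 'M[F]_3 := \matrix_(i, b) ((l i - l (ord_pred i)) * invmx g i b).

Definition psi_A g l : 'M[F]_3 := g *m diag_mx (\row_k l k) *m invmx g.

Lemma psi_AE g l a b : psi_A g l a b = \sum_k g a k * l k * invmx g k b.
Proof. by rewrite mxE; apply: eq_bigr => k _; rewrite mul_mx_diag !mxE. Qed.

(** The cofactor identity g^T [g e_k] g = det g [e_k], multiplied by g^-1 on the right. *)
Lemma skew3_mx g m k b : \det g = 1 ->
  \sum_e g e m * skew3 (g^~ k) e b = - skew3 (invmx g ^~ b) m k.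
Proof.
move=> dg; rewrite invmx_adj3 // big3.
elim/ord3_ind: m; elim/ord3_ind: k; elim/ord3_ind: b;
  by rewrite /skew3 !mx3E /adj3 ?mx3E; ring.
Qed.

Lemma eq_skew3 (R : zmodType) (f f' : 'I_3 -> R) : f =1 f' -> skew3 f = skew3 f'.
Proof. by move=> e; rewrite /skew3 !e. Qed.

Lemma skew3_invmx g m k b : \det g = 1 ->
  \sum_e invmx g m e * skew3 (invmx g k) e b = - skew3 (g b) m k.
Proof.
move=> dg; have dh : \det (invmx g)^T = 1 by rewrite det_tr det_inv dg invr1.
have := skew3_mx m k b dh; rewrite -trmx_inv invmxK.
have -> : skew3 ((invmx g)^T^~ k) = skew3 (invmx g k) by apply: eq_skew3 => i; rewrite mxE.
have -> : skew3 (g^T^~ b) = skew3 (g b) by apply: eq_skew3 => i; rewrite mxE.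
by move=> <-; apply: eq_bigr => e _; congr (_ * _); rewrite mxE.
Qed.

Lemma skew3Z (R : comNzRingType) (t : R) (f : 'I_3 -> R) e b :
  skew3 (fun i => t * f i) e b = t * skew3 f e b.
Proof. by elim/ord3_ind: e; elim/ord3_ind: b; rewrite /skew3 !mx3E; ring. Qed.

Lemma psi_joseph g l : \det g = 1 -> \sum_i l i = 0 ->
  joseph (psi_A g l) l (psi_v g l) (psi_c g l).
Proof.
move=> dg hl.
have l2E : l i2 = - l i0 - l i1 by apply: (eq_cof (e := 1) hl); rewrite big3; ring.
have ug : g \in unitmx by rewrite unitmxE dg unitr1.
have gh a b : (a == b)%:R = \sum_k g a k * invmx g k b.
  by have := mulmxV ug => /matrixP/(_ a b); rewrite !mxE => ->.
have hg k i : \sum_b invmx g k b * g b i = (k == i)%:R.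
  by have := mulVmx ug => /matrixP/(_ k i); rewrite !mxE => ->.
have mmE (M N : 'M[F]_3) a b : \sum_e M a e * N e b = (M *m N) a b by rewrite mxE.
have A2E a b : \sum_e psi_A g l a e * psi_A g l e b = \sum_k g a k * l k ^+ 2 * invmx g k b.
  rewrite mmE /psi_A !mulmxA mulmxKV // -(mulmxA g) mulmx_diag mxE.
  by apply: eq_bigr => k _; rewrite mul_mx_diag !mxE.
have vE a i : psi_v g l a i = (l i - l (ordS i)) * g a i by rewrite mxE.
have cE i b : psi_c g l i b = (l i - l (ord_pred i)) * invmx g i b by rewrite mxE.
have Ag a i : \sum_b psi_A g l a b * g b i = l i * g a i.
  by rewrite mmE mulmxKV // mul_mx_diag !mxE mulrC.
have hA i a : \sum_b invmx g i b * psi_A g l b a = l i * invmx g i a.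
  by rewrite mmE /psi_A -mulmxA mulKmx // mul_diag_mx !mxE.
have tr1 (m : 'I_3 -> F) : \sum_a \sum_k g a k * m k * invmx g k a = \sum_k m k.
  rewrite exchange_big; apply: eq_bigr => k _ /=.
  under eq_bigr do rewrite [g _ _ * _]mulrC -mulrA [g _ _ * _]mulrC.
  by rewrite -mulr_sumr hg eqxx mulr1.
split=> //.
- by under eq_bigr do rewrite psi_AE; rewrite tr1.
- by under eq_bigr do rewrite A2E; rewrite tr1.
- move=> i a; under eq_bigr do rewrite vE mulrCA.
  by rewrite -mulr_sumr Ag vE; ring.
- move=> i a; under eq_bigr do rewrite cE -mulrA.
  by rewrite -mulr_sumr hA cE; ring.
- move=> i a b; rewrite vE cE A2E psi_AE gh !big3 l2E.
  by elim/ord3_ind: i; rewrite !ordS3 ?l2E; field.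
- move=> i j ij; under eq_bigr do rewrite cE vE mulrACA.
  by rewrite -mulr_sumr hg (negPf ij) mulr0.
- move=> i j k ij jk ik a b.
  (* In the eigenbasis g, the matrix A - l_j is diagonal with entries l_m - l_j. The term m = j
     vanishes by this factor and m = k by antisymmetry; the term m = i is the product of the two
     columns. *)
  have -> : \sum_e (psi_A g l a e - l j * (a == e)%:R) * skew3 (psi_c g l k) e b =
      - \sum_m g a m * (l m - l j) * (l k - l (ord_pred k)) * skew3 (g b) m k.
    under [X in _ = - X]eq_bigr do rewrite -[skew3 _ _ _]opprK -skew3_invmx // mulrN.
    have sE e : skew3 (psi_c g l k) e b = (l k - l (ord_pred k)) * skew3 (invmx g k) e b.
      by rewrite -skew3Z (eq_skew3 (cE k)).
    under [X in X = _]eq_bigr do rewrite sE psi_AE gh.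
    by rewrite !big3; ring.
  rewrite big3 !vE; move: ij jk ik.
  by elim/ord3_ind: i; elim/ord3_ind: j => //; elim/ord3_ind: k => // _ _ _;
    rewrite !ordS3 /skew3 !mx3E l2E; ring.
- move=> i j k ij jk ik a b.
  have -> : \sum_e (psi_A g l e a - l j * (a == e)%:R) * skew3 (psi_v g l ^~ k) e b =
      - \sum_m invmx g m a * (l m - l j) * (l k - l (ordS k)) * skew3 (invmx g ^~ b) m k.
    under [X in _ = - X]eq_bigr do rewrite -[skew3 _ _ _]opprK -skew3_mx // mulrN.
    have sE e : skew3 (psi_v g l ^~ k) e b = (l k - l (ordS k)) * skew3 (g^~ k) e b.
      by rewrite -skew3Z (eq_skew3 (vE^~ k)).
    under [X in X = _]eq_bigr do rewrite sE psi_AE eq_sym gh.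
    by rewrite !big3; ring.
  rewrite big3 !cE; move: ij jk ik.
  by elim/ord3_ind: i; elim/ord3_ind: j => //; elim/ord3_ind: k => // _ _ _;
    rewrite !ordS3 /skew3 !mx3E l2E; ring.
Qed.

Definition lqf x := (dA x, dv x *m (dv x)^T, (dc x)^T *m dc x).

Lemma psiE g l :
  psi g l = (psi_A g l, psi_v g l *m (psi_v g l)^T, (psi_c g l)^T *m psi_c g l).
Proof.
rewrite /psi; congr (_, _, _).
  apply/matrixP => a b; rewrite [RHS]mxE [LHS]summxE; apply: eq_bigr => i _.
  by rewrite !mxE big_ord1 !mxE; ring.
apply/matrixP => a b; rewrite [RHS]mxE [LHS]summxE; apply: eq_bigr => i _.
by rewrite !mxE big_ord1 !mxE; ring.
Qed.

Lemma psi_lqf g l x : dA x = psi_A g l -> dv x = psi_v g l -> dc x = psi_c g l ->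
  lqf x = psi g l.
Proof. by move=> hA hv hc; rewrite psiE /lqf hA hv hc. Qed.

Lemma eq_joseph A l l' v c : l =1 l' -> joseph A l v c -> joseph A l' v c.
Proof.
move=> e [j1 j2 j3 j4 j5 j6 j7 j8 j9]; split=> //.
- by rewrite -[RHS]j2; apply: eq_bigr => i _; rewrite e.
- by rewrite j3; apply: eq_bigr => i _; rewrite e.
- by move=> i a; rewrite -e.
- by move=> i a; rewrite -e.
- move=> i a b; rewrite -e j6; congr (_ + (_ - _ / _) * _).
  by apply: eq_bigr => k _; rewrite e.
- by move=> i j k h1 h2 h3 a b; rewrite -e; apply: j8.
- by move=> i j k h1 h2 h3 a b; rewrite -e; apply: j9.
Qed.

Definition regular l := (l i0 - l i1) * (l i1 - l i2) * (l i2 - l i0) != 0.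

Lemma psi_W g l : \det g = 1 -> \sum_i l i = 0 -> regular l ->
  exists2 x, W x & lqf x = psi g l.
Proof.
move=> dg hl rl; have J := psi_joseph dg hl.
exists (X8 (psi_A g l) l (psi_v g l) (psi_c g l));
  have [hA hl' hv hc] := X8_data (psi_v g l) (psi_c g l) (j_trA J) hl.
  split; first exact: X8_so8.
    by rewrite hA hv hc; apply: eq_joseph J => i.
  by rewrite /D !hl'.
exact: psi_lqf.
Qed.

Lemma joseph_psi A l v c : joseph A l v c -> regular l ->
  exists g, [/\ \det g = 1, A = psi_A g l, v = psi_v g l & c = psi_c g l].
Proof.
move=> J; rewrite /regular !mulf_eq0 !negb_or -!andbA => /and3P[n01 n12 n20].
have l2E : l i2 = - l i0 - l i1.
  by apply: (eq_cof (e := 1) (j_suml J)); rewrite big3; ring.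
have nS i : l i - l (ordS i) != 0 by elim/ord3_ind: i; rewrite ordS3.
have nP i : l i - l (ord_pred i) != 0.
  by elim/ord3_ind: i; rewrite ordS3 -opprB oppr_eq0.
pose g : 'M[F]_3 := \matrix_(a, i) (v a i / (l i - l (ordS i))).
pose h : 'M[F]_3 := \matrix_(i, b) (c i b / (l i - l (ord_pred i))).
(* Lagrange interpolation: v_i c_i divided by (l_i - l_j) (l_i - l_k) is the idempotent of A for
   l_i, and the three idempotents sum to 1. *)
have gh : g *m h = 1%:M.
  apply/matrixP => a b; rewrite mxE [RHS]mxE big3 !mxE !ordS3.
  have E (p q r s : F) : p / r * (q / s) = p * q / (r * s) by rewrite invfM; ring.
  rewrite !E !(j_vc J) !big3 l2E.
  move: (nS i0) (nS i1) (nS i2) (nP i0) (nP i1) (nP i2); rewrite !ordS3 l2E.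
  by move=> m1 m2 m3 m4 m5 m6; field; rewrite m1 m2 m3 m4 m5 m6.
have hE := mulmx1_inv gh.
have vE a i : v a i = (l i - l (ordS i)) * g a i by rewrite mxE mulrC divfK.
have cE i b : c i b = (l i - l (ord_pred i)) * h i b by rewrite mxE mulrC divfK.
(* By [vv_diff] the cross product of v_0 and v_1 is (l_1 - l_0) c_2; pairing with v_2 gives det v,
   as c_2 v_2 = (l_2 - l_0) (l_2 - l_1). The product is that of the three divisors l_i - l_(i+1). *)
have dg : \det g = 1.
  have e : v i0 i2 * (v i1 i0 * v i2 i1 - v i1 i1 * v i2 i0)
         - v i1 i2 * (v i0 i0 * v i2 i1 - v i0 i1 * v i2 i0)
         + v i2 i2 * (v i0 i0 * v i1 i1 - v i0 i1 * v i1 i0) =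
         (l i1 - l i0) * (3 * l i2 ^+ 2 - (\sum_k l k ^+ 2) / 2).
    by rewrite -(cv_diag J) !(vv_diff J) /skew3 !mx3E big3; ring.
  apply: (mulfI (nS i0)); apply: (mulfI (nS i1)); apply: (mulfI (nS i2)).
  rewrite mulr1; move: e; rewrite !vE det3 big3 !ordS3 l2E => e.
  move/eqP: e; rewrite -subr_eq0 => /eqP e.
  by apply: (eq_cof (e := 1) e); field.
exists g; split=> //.
- have Ag : A *m g = g *m diag_mx (\row_k l k).
    apply/matrixP => a i; rewrite mul_mx_diag [LHS]mxE [RHS]mxE.
    apply: (mulfI (nS i)); rewrite mulr_sumr.
    under eq_bigr do rewrite mulrCA -vE.
    by rewrite (j_Av J) vE [(\row_k l k) 0 i]mxE; ring.
  by rewrite /psi_A -Ag hE -mulmxA gh mulmx1.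
- by apply/matrixP => a i; rewrite vE [RHS]mxE.
- by apply/matrixP => i b; rewrite cE [RHS]mxE hE.
Qed.

Lemma W_psi x : W x -> in_image_psi (lqf x).
Proof.
case=> _ J rl; have [g [dg hA hv hc]] := joseph_psi J rl.
by exists g, (dl x); split=> //; [exact: j_suml J | apply: psi_lqf].
Qed.

End Psi.

(** * Diagram automorphisms *)

Section DiagramAutomorphisms.
Variable F : numClosedFieldType.
Implicit Types (x y : 'M[F]_8).

(** Root vectors, and Cartan elements for a = b; the element vanishes for b = [rev_ord a]. By
    [E8_rev] the 28 pairs with a + b < 7 suffice as a basis. *)
Definition E8 (a b : 'I_8) : 'M[F]_8 := delta_mx a b - delta_mx (rev_ord b) (rev_ord a).

Lemma E8_rev a b : E8 (rev_ord b) (rev_ord a) = - E8 a b.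
Proof. by rewrite /E8 !rev_ordK opprB. Qed.

Lemma E8E a b i j : E8 a b i j = (if (i == a) && (j == b) then 1 else 0)
   - (if (i == rev_ord b) && (j == rev_ord a) then 1 else 0).
Proof. by rewrite !mxE; do 2![case: ifP => _]. Qed.

Lemma E8_so8 a b : in_so8 (E8 a b).
Proof.
have r (p q : 'I_8) : (rev_ord p == q) = (p == rev_ord q).
  by rewrite -(inj_eq rev_ord_inj) rev_ordK.
apply/so8P => i j; rewrite !E8E opprB !(inj_eq rev_ord_inj) !r.
by rewrite [(j == b) && _]andbC [(j == rev_ord a) && _]andbC.
Qed.

Lemma so8_lin a x y : in_so8 x -> in_so8 y -> in_so8 (a *: x + y).
Proof.
move=> /so8P hx /so8P hy; apply/so8P => i j.
by rewrite !mxE hx hy; ring.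
Qed.

Lemma so8_0 : in_so8 (0 : 'M[F]_8).
Proof. by apply/so8P => i j; rewrite !mxE oppr0. Qed.

Lemma lie_E8 a b c d : lie (E8 a b) (E8 c d) =
  (if b == c then E8 a d else 0) - (if a == d then E8 c b else 0)
  - (if b == rev_ord d then E8 a (rev_ord c) else 0)
  - (if rev_ord a == c then E8 (rev_ord b) d else 0).
Proof.
rewrite /lie /E8 !(mulmxBl, mulmxBr) !mul_delta_mx_cond !(inj_eq rev_ord_inj) !rev_ordK.
rewrite [d == a]eq_sym [c == b]eq_sym.
have -> : (d == rev_ord b) = (b == rev_ord d).
  by rewrite -(inj_eq rev_ord_inj) rev_ordK eq_sym.
have -> : (rev_ord c == a) = (rev_ord a == c).
  by rewrite -(inj_eq rev_ord_inj) rev_ordK eq_sym.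
have H n (b' : bool) (M : 'M[F]_n) : M *+ b' = if b' then M else 0 by case: b'.
by rewrite !H; do 4![case: ifP => _]; apply/matrixP => i j; rewrite !mxE; ring.
Qed.

Lemma so8_sum x : in_so8 x ->
  x = \sum_(i < 8) \sum_(j < 8) (if (i + j < 7)%N then x i j else 0) *: E8 i j.
Proof.
move=> sx; have /so8P h := sx.
pose y (i j : 'I_8) := if (i + j < 7)%N then x i j else 0.
have D1 : \sum_i \sum_j y i j *: delta_mx i j = \matrix_(i, j) y i j :> 'M[F]_8.
  by rewrite [RHS]matrix_sum_delta; do 2![apply: eq_bigr => ? _]; rewrite mxE.
have D2 : \sum_i \sum_j y i j *: delta_mx (rev_ord j) (rev_ord i) =
    \matrix_(i, j) y (rev_ord j) (rev_ord i) :> 'M[F]_8.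
  rewrite [RHS]matrix_sum_delta (reindex_inj rev_ord_inj) exchange_big /=.
  rewrite (reindex_inj rev_ord_inj) /=; apply: eq_bigr => i _; apply: eq_bigr => j _.
  by rewrite !mxE !rev_ordK.
transitivity (\sum_i \sum_j y i j *: delta_mx i j
    - \sum_i \sum_j y i j *: delta_mx (rev_ord j) (rev_ord i)); last first.
  rewrite -sumrB; apply: eq_bigr => i _; rewrite -sumrB; apply: eq_bigr => j _.
  by rewrite /E8 scalerBr.
rewrite D1 D2; apply/matrixP => i j; rewrite !mxE /y.
have h0 := so8_mid0 _ sx.
move: (h0 q0) (h0 q1) (h0 q2) (h0 q3) (h0 q4) (h0 q5) (h0 q6) (h0 q7).
rewrite !rev8 => e0 e1 e2 e3 e4 e5 e6 e7.
elim/ord8_ind: i; elim/ord8_ind: j; rewrite !rev8 /= ?subr0 ?sub0r //.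
all: by rewrite ?oppr0 // h !rev8.
Qed.

Definition p0 : 'I_4 := @Ordinal 4 0 isT.
Definition p1 : 'I_4 := @Ordinal 4 1 isT.
Definition p2 : 'I_4 := @Ordinal 4 2 isT.
Definition p3 : 'I_4 := @Ordinal 4 3 isT.

Lemma chev_E8 :
  (chev_e F p0 = E8 q0 q1) * (chev_e F p1 = E8 q1 q2) *
  (chev_e F p2 = E8 q2 q3) * (chev_e F p3 = E8 q2 q4) *
  (chev_f F p0 = E8 q1 q0) * (chev_f F p1 = E8 q2 q1) *
  (chev_f F p2 = E8 q3 q2) * (chev_f F p3 = E8 q4 q2).
Proof.
have E a b c d : dm F a b - dm F c d = delta_mx (inord a) (inord b) - delta_mx (inord c) (inord d) by [].
do !split; rewrite /chev_f /chev_e /= E ?linearB /= ?trmx_delta /E8 !rev8 !inord8 //.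
Qed.

Section Image.
Variables (s : 'I_4 -> 'I_4) (phi : 'M[F]_8 -> 'M[F]_8).
Hypothesis H : diagram_aut s phi.

Let lin a x y : in_so8 x -> in_so8 y -> phi (a *: x + y) = a *: phi x + phi y.
Proof. by case: H => _ h _ _ _; apply: h. Qed.

Lemma aut_0 : phi 0 = 0.
Proof.
have := lin 1 so8_0 so8_0; rewrite !scale1r addr0 => /eqP.
by rewrite -subr_eq0 opprD addNKr oppr_eq0 => /eqP.
Qed.

Lemma aut_N x : in_so8 x -> phi (- x) = - phi x.
Proof.
by move=> sx; have := lin (-1) sx so8_0; rewrite aut_0 !addr0 !scaleN1r.
Qed.

Lemma aut_D x y : in_so8 x -> in_so8 y -> phi (x + y) = phi x + phi y.
Proof. by move=> sx sy; have := lin 1 sx sy; rewrite !scale1r. Qed.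

Lemma aut_sum x : in_so8 x ->
  phi x = \sum_(i < 8) \sum_(j < 8) (if (i + j < 7)%N then x i j else 0) *: phi (E8 i j).
Proof.
move=> sx; rewrite {1}(so8_sum sx) pair_bigA [RHS]pair_bigA /=.
elim: (index_enum _) => [|p r IH]; first by rewrite !big_nil aut_0.
rewrite !big_cons lin ?IH ?E8_so8 //.
elim: r {IH} => [|p' r IH]; rewrite ?big_nil ?so8_0 // big_cons.
by apply: so8_lin => //; apply: E8_so8.
Qed.

Lemma aut_lie a b c d : phi (lie (E8 a b) (E8 c d)) = lie (phi (E8 a b)) (phi (E8 c d)).
Proof. by case: H => _ _ h _ _; apply: h; apply: E8_so8. Qed.

Lemma aut_e i : phi (chev_e F i) = chev_e F (s i).
Proof. by case: H. Qed.

Lemma aut_f i : phi (chev_f F i) = chev_f F (s i).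
Proof. by case: H. Qed.

End Image.

Lemma lieN x y : ((lie (- x) y = - lie x y) * (lie x (- y) = - lie x y))%type.
Proof. by split; rewrite /lie !(mulNmx, mulmxN) opprB addrC opprK. Qed.

Lemma E8_low :
  (E8 q1 q7 = - E8 q0 q6) * (E8 q2 q6 = - E8 q1 q5) * (E8 q2 q7 = - E8 q0 q5) *
  (E8 q3 q5 = - E8 q2 q4) * (E8 q3 q6 = - E8 q1 q4) * (E8 q3 q7 = - E8 q0 q4) *
  (E8 q4 q4 = - E8 q3 q3) * (E8 q4 q5 = - E8 q2 q3) * (E8 q4 q6 = - E8 q1 q3) *
  (E8 q4 q7 = - E8 q0 q3) * (E8 q5 q3 = - E8 q4 q2) * (E8 q5 q4 = - E8 q3 q2) *
  (E8 q5 q5 = - E8 q2 q2) * (E8 q5 q6 = - E8 q1 q2) * (E8 q5 q7 = - E8 q0 q2) *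
  (E8 q6 q2 = - E8 q5 q1) * (E8 q6 q3 = - E8 q4 q1) * (E8 q6 q4 = - E8 q3 q1) *
  (E8 q6 q5 = - E8 q2 q1) * (E8 q6 q6 = - E8 q1 q1) * (E8 q6 q7 = - E8 q0 q1) *
  (E8 q7 q1 = - E8 q6 q0) * (E8 q7 q2 = - E8 q5 q0) * (E8 q7 q3 = - E8 q4 q0) *
  (E8 q7 q4 = - E8 q3 q0) * (E8 q7 q5 = - E8 q2 q0) * (E8 q7 q6 = - E8 q1 q0) *
  (E8 q7 q7 = - E8 q0 q0).
Proof. by do !split; rewrite -E8_rev !rev8. Qed.

Lemma inord4 : (inord 0 = p0) * (inord 2 = p2) * (inord 3 = p3).
Proof. by do !split; apply: val_inj; rewrite /= inordK. Qed.

Lemma swap13E : (swap13 p0 = p2) * (swap13 p1 = p1) * (swap13 p2 = p0) * (swap13 p3 = p3).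
Proof. by rewrite /swap13 !inord4 !permE. Qed.

Lemma swap34E : (swap34 p0 = p0) * (swap34 p1 = p1) * (swap34 p2 = p3) * (swap34 p3 = p2).
Proof. by rewrite /swap34 !inord4 !permE. Qed.

Ltac lie_simp := rewrite ?lieN ?lie_E8 ?rev8 /= ?E8_low ?subr0 ?sub0r ?addr0 ?add0r ?opprK ?oppr0.

(** Each root vector beyond the Chevalley generators is a bracket of two whose images are already
    known. The Cartan part comes from the images of the four simple coroots, and solving for the
    diagonal elements brings in the factor 1/2. *)
Lemma g13_E8 phi : diagram_aut swap13 phi ->
  (phi (E8 q0 q1) = E8 q2 q3) * (phi (E8 q1 q0) = E8 q3 q2) *
  (phi (E8 q1 q2) = E8 q1 q2) * (phi (E8 q2 q1) = E8 q2 q1) *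
  (phi (E8 q2 q3) = E8 q0 q1) * (phi (E8 q3 q2) = E8 q1 q0) *
  (phi (E8 q2 q4) = E8 q2 q4) * (phi (E8 q4 q2) = E8 q4 q2) *
  (phi (E8 q0 q2) = - E8 q1 q3) * (phi (E8 q2 q0) = - E8 q3 q1) *
  (phi (E8 q1 q3) = - E8 q0 q2) * (phi (E8 q1 q4) = E8 q1 q4) *
  (phi (E8 q3 q1) = - E8 q2 q0) * (phi (E8 q4 q1) = E8 q4 q1) *
  (phi (E8 q0 q3) = E8 q0 q3) * (phi (E8 q0 q4) = E8 q1 q5) *
  (phi (E8 q3 q0) = E8 q3 q0) * (phi (E8 q4 q0) = E8 q5 q1) *
  (phi (E8 q1 q5) = E8 q0 q4) * (phi (E8 q5 q1) = E8 q4 q0) *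
  (phi (E8 q0 q5) = E8 q0 q5) * (phi (E8 q5 q0) = E8 q5 q0) *
  (phi (E8 q0 q6) = E8 q0 q6) * (phi (E8 q6 q0) = E8 q6 q0) *
  (phi (E8 q0 q0) = 2^-1 *: (E8 q0 q0 + E8 q1 q1 + E8 q2 q2 - E8 q3 q3)) *
  (phi (E8 q1 q1) = 2^-1 *: (E8 q0 q0 + E8 q1 q1 - E8 q2 q2 + E8 q3 q3)) *
  (phi (E8 q2 q2) = 2^-1 *: (E8 q0 q0 - E8 q1 q1 + E8 q2 q2 + E8 q3 q3)) *
  (phi (E8 q3 q3) = 2^-1 *: (- E8 q0 q0 + E8 q1 q1 + E8 q2 q2 + E8 q3 q3)).
Proof.
move=> H.
have e01 : phi (E8 q0 q1) = E8 q2 q3 by rewrite -chev_E8 (aut_e H) swap13E chev_E8.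
have e10 : phi (E8 q1 q0) = E8 q3 q2 by rewrite -chev_E8 (aut_f H) swap13E chev_E8.
have e12 : phi (E8 q1 q2) = E8 q1 q2 by rewrite -chev_E8 (aut_e H) swap13E chev_E8.
have e21 : phi (E8 q2 q1) = E8 q2 q1 by rewrite -chev_E8 (aut_f H) swap13E chev_E8.
have e23 : phi (E8 q2 q3) = E8 q0 q1 by rewrite -chev_E8 (aut_e H) swap13E chev_E8.
have e32 : phi (E8 q3 q2) = E8 q1 q0 by rewrite -chev_E8 (aut_f H) swap13E chev_E8.
have e24 : phi (E8 q2 q4) = E8 q2 q4 by rewrite -chev_E8 (aut_e H) swap13E chev_E8.
have e42 : phi (E8 q4 q2) = E8 q4 q2 by rewrite -chev_E8 (aut_f H) swap13E chev_E8.
have e02 : phi (E8 q0 q2) = - E8 q1 q3.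
  by rewrite (_ : E8 q0 q2 = lie (E8 q0 q1) (E8 q1 q2)) ?(aut_lie H) ?e12 ?e01; lie_simp.
have e20 : phi (E8 q2 q0) = - E8 q3 q1.
  by rewrite (_ : E8 q2 q0 = lie (E8 q2 q1) (E8 q1 q0)) ?(aut_lie H) ?e21 ?e10; lie_simp.
have e13 : phi (E8 q1 q3) = - E8 q0 q2.
  by rewrite (_ : E8 q1 q3 = lie (E8 q1 q2) (E8 q2 q3)) ?(aut_lie H) ?e23 ?e12; lie_simp.
have e14 : phi (E8 q1 q4) = E8 q1 q4.
  by rewrite (_ : E8 q1 q4 = lie (E8 q1 q2) (E8 q2 q4)) ?(aut_lie H) ?e24 ?e12; lie_simp.
have e31 : phi (E8 q3 q1) = - E8 q2 q0.
  by rewrite (_ : E8 q3 q1 = lie (E8 q3 q2) (E8 q2 q1)) ?(aut_lie H) ?e32 ?e21; lie_simp.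
have e41 : phi (E8 q4 q1) = E8 q4 q1.
  by rewrite (_ : E8 q4 q1 = lie (E8 q4 q2) (E8 q2 q1)) ?(aut_lie H) ?e42 ?e21; lie_simp.
have e03 : phi (E8 q0 q3) = E8 q0 q3.
  by rewrite (_ : E8 q0 q3 = lie (E8 q0 q2) (E8 q2 q3)) ?(aut_lie H) ?e23 ?e02; lie_simp.
have e04 : phi (E8 q0 q4) = E8 q1 q5.
  by rewrite (_ : E8 q0 q4 = lie (E8 q0 q2) (E8 q2 q4)) ?(aut_lie H) ?e24 ?e02; lie_simp.
have e30 : phi (E8 q3 q0) = E8 q3 q0.
  by rewrite (_ : E8 q3 q0 = lie (E8 q3 q2) (E8 q2 q0)) ?(aut_lie H) ?e32 ?e20; lie_simp.
have e40 : phi (E8 q4 q0) = E8 q5 q1.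
  by rewrite (_ : E8 q4 q0 = lie (E8 q4 q2) (E8 q2 q0)) ?(aut_lie H) ?e42 ?e20; lie_simp.
have e15 : phi (E8 q1 q5) = E8 q0 q4.
  by rewrite (_ : E8 q1 q5 = lie (E8 q2 q4) (E8 q1 q3)) ?(aut_lie H) ?e24 ?e13; lie_simp.
have e51 : phi (E8 q5 q1) = E8 q4 q0.
  by rewrite (_ : E8 q5 q1 = lie (E8 q3 q1) (E8 q4 q2)) ?(aut_lie H) ?e42 ?e31; lie_simp.
have e05 : phi (E8 q0 q5) = E8 q0 q5.
  by rewrite (_ : E8 q0 q5 = lie (E8 q2 q4) (E8 q0 q3)) ?(aut_lie H) ?e24 ?e03; lie_simp.
have e50 : phi (E8 q5 q0) = E8 q5 q0.
  by rewrite (_ : E8 q5 q0 = lie (E8 q3 q0) (E8 q4 q2)) ?(aut_lie H) ?e42 ?e30; lie_simp.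
have e06 : phi (E8 q0 q6) = E8 q0 q6.
  by rewrite (_ : E8 q0 q6 = lie (E8 q1 q2) (E8 q0 q5)) ?(aut_lie H) ?e12 ?e05; lie_simp.
have e60 : phi (E8 q6 q0) = E8 q6 q0.
  by rewrite (_ : E8 q6 q0 = lie (E8 q5 q0) (E8 q2 q1)) ?(aut_lie H) ?e21 ?e50; lie_simp.
have so a := E8_so8 a a.
have soN a : in_so8 (- E8 a a) by rewrite -E8_rev E8_so8.
have d1 : phi (E8 q0 q0) - phi (E8 q1 q1) = E8 q2 q2 - E8 q3 q3.
  rewrite -(aut_N H) // -(aut_D H) // (_ : _ - _ = lie (E8 q0 q1) (E8 q1 q0)) ?(aut_lie H) ?e01 ?e10;
  by lie_simp.
have d2 : phi (E8 q1 q1) - phi (E8 q2 q2) = E8 q1 q1 - E8 q2 q2.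
  rewrite -(aut_N H) // -(aut_D H) // (_ : _ - _ = lie (E8 q1 q2) (E8 q2 q1)) ?(aut_lie H) ?e12 ?e21;
  by lie_simp.
have d3 : phi (E8 q2 q2) - phi (E8 q3 q3) = E8 q0 q0 - E8 q1 q1.
  rewrite -(aut_N H) // -(aut_D H) // (_ : _ - _ = lie (E8 q2 q3) (E8 q3 q2)) ?(aut_lie H) ?e23 ?e32;
  by lie_simp.
have d4 : phi (E8 q2 q2) + phi (E8 q3 q3) = E8 q2 q2 + E8 q3 q3.
  rewrite -(aut_D H) // (_ : _ + _ = lie (E8 q2 q4) (E8 q4 q2)) ?(aut_lie H) ?e24 ?e42;
  by lie_simp.
have e22 : phi (E8 q2 q2) = 2^-1 *: (E8 q0 q0 - E8 q1 q1 + E8 q2 q2 + E8 q3 q3).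
  rewrite -addrA -d3 -d4; apply/matrixP => i j; rewrite !mxE; by field.
have e33 : phi (E8 q3 q3) = 2^-1 *: (- E8 q0 q0 + E8 q1 q1 + E8 q2 q2 + E8 q3 q3).
  by rewrite -[LHS](addKr (phi (E8 q2 q2))) d4 e22; apply/matrixP => i j; rewrite !mxE; field.
have e11 : phi (E8 q1 q1) = 2^-1 *: (E8 q0 q0 + E8 q1 q1 - E8 q2 q2 + E8 q3 q3).
  by rewrite -[LHS](subrK (phi (E8 q2 q2))) d2 e22; apply/matrixP => i j; rewrite !mxE; field.
have e00 : phi (E8 q0 q0) = 2^-1 *: (E8 q0 q0 + E8 q1 q1 + E8 q2 q2 - E8 q3 q3).
  by rewrite -[LHS](subrK (phi (E8 q1 q1))) d1 e11; apply/matrixP => i j; rewrite !mxE; field.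
by do !split.
Qed.

(** The result is the exchange of the indices [q3] and [q4], that is conjugation by an orthogonal
    matrix of determinant -1, in contrast with the other automorphism. *)
Lemma g34_E8 phi : diagram_aut swap34 phi ->
  (phi (E8 q0 q1) = E8 q0 q1) * (phi (E8 q1 q0) = E8 q1 q0) *
  (phi (E8 q1 q2) = E8 q1 q2) * (phi (E8 q2 q1) = E8 q2 q1) *
  (phi (E8 q2 q3) = E8 q2 q4) * (phi (E8 q3 q2) = E8 q4 q2) *
  (phi (E8 q2 q4) = E8 q2 q3) * (phi (E8 q4 q2) = E8 q3 q2) *
  (phi (E8 q0 q2) = E8 q0 q2) * (phi (E8 q2 q0) = E8 q2 q0) *
  (phi (E8 q1 q3) = E8 q1 q4) * (phi (E8 q1 q4) = E8 q1 q3) *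
  (phi (E8 q3 q1) = E8 q4 q1) * (phi (E8 q4 q1) = E8 q3 q1) *
  (phi (E8 q0 q3) = E8 q0 q4) * (phi (E8 q0 q4) = E8 q0 q3) *
  (phi (E8 q3 q0) = E8 q4 q0) * (phi (E8 q4 q0) = E8 q3 q0) *
  (phi (E8 q1 q5) = E8 q1 q5) * (phi (E8 q5 q1) = E8 q5 q1) *
  (phi (E8 q0 q5) = E8 q0 q5) * (phi (E8 q5 q0) = E8 q5 q0) *
  (phi (E8 q0 q6) = E8 q0 q6) * (phi (E8 q6 q0) = E8 q6 q0) *
  (phi (E8 q0 q0) = E8 q0 q0) * (phi (E8 q1 q1) = E8 q1 q1) *
  (phi (E8 q2 q2) = E8 q2 q2) * (phi (E8 q3 q3) = - E8 q3 q3).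
Proof.
move=> H.
have e01 : phi (E8 q0 q1) = E8 q0 q1 by rewrite -chev_E8 (aut_e H) swap34E chev_E8.
have e10 : phi (E8 q1 q0) = E8 q1 q0 by rewrite -chev_E8 (aut_f H) swap34E chev_E8.
have e12 : phi (E8 q1 q2) = E8 q1 q2 by rewrite -chev_E8 (aut_e H) swap34E chev_E8.
have e21 : phi (E8 q2 q1) = E8 q2 q1 by rewrite -chev_E8 (aut_f H) swap34E chev_E8.
have e23 : phi (E8 q2 q3) = E8 q2 q4 by rewrite -chev_E8 (aut_e H) swap34E chev_E8.
have e32 : phi (E8 q3 q2) = E8 q4 q2 by rewrite -chev_E8 (aut_f H) swap34E chev_E8.
have e24 : phi (E8 q2 q4) = E8 q2 q3 by rewrite -chev_E8 (aut_e H) swap34E chev_E8.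
have e42 : phi (E8 q4 q2) = E8 q3 q2 by rewrite -chev_E8 (aut_f H) swap34E chev_E8.
have e02 : phi (E8 q0 q2) = E8 q0 q2.
  by rewrite (_ : E8 q0 q2 = lie (E8 q0 q1) (E8 q1 q2)) ?(aut_lie H) ?e12 ?e01; lie_simp.
have e20 : phi (E8 q2 q0) = E8 q2 q0.
  by rewrite (_ : E8 q2 q0 = lie (E8 q2 q1) (E8 q1 q0)) ?(aut_lie H) ?e21 ?e10; lie_simp.
have e13 : phi (E8 q1 q3) = E8 q1 q4.
  by rewrite (_ : E8 q1 q3 = lie (E8 q1 q2) (E8 q2 q3)) ?(aut_lie H) ?e23 ?e12; lie_simp.
have e14 : phi (E8 q1 q4) = E8 q1 q3.
  by rewrite (_ : E8 q1 q4 = lie (E8 q1 q2) (E8 q2 q4)) ?(aut_lie H) ?e24 ?e12; lie_simp.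
have e31 : phi (E8 q3 q1) = E8 q4 q1.
  by rewrite (_ : E8 q3 q1 = lie (E8 q3 q2) (E8 q2 q1)) ?(aut_lie H) ?e32 ?e21; lie_simp.
have e41 : phi (E8 q4 q1) = E8 q3 q1.
  by rewrite (_ : E8 q4 q1 = lie (E8 q4 q2) (E8 q2 q1)) ?(aut_lie H) ?e42 ?e21; lie_simp.
have e03 : phi (E8 q0 q3) = E8 q0 q4.
  by rewrite (_ : E8 q0 q3 = lie (E8 q0 q2) (E8 q2 q3)) ?(aut_lie H) ?e23 ?e02; lie_simp.
have e04 : phi (E8 q0 q4) = E8 q0 q3.
  by rewrite (_ : E8 q0 q4 = lie (E8 q0 q2) (E8 q2 q4)) ?(aut_lie H) ?e24 ?e02; lie_simp.
have e30 : phi (E8 q3 q0) = E8 q4 q0.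
  by rewrite (_ : E8 q3 q0 = lie (E8 q3 q2) (E8 q2 q0)) ?(aut_lie H) ?e32 ?e20; lie_simp.
have e40 : phi (E8 q4 q0) = E8 q3 q0.
  by rewrite (_ : E8 q4 q0 = lie (E8 q4 q2) (E8 q2 q0)) ?(aut_lie H) ?e42 ?e20; lie_simp.
have e15 : phi (E8 q1 q5) = E8 q1 q5.
  by rewrite (_ : E8 q1 q5 = lie (E8 q2 q4) (E8 q1 q3)) ?(aut_lie H) ?e24 ?e13; lie_simp.
have e51 : phi (E8 q5 q1) = E8 q5 q1.
  by rewrite (_ : E8 q5 q1 = lie (E8 q3 q1) (E8 q4 q2)) ?(aut_lie H) ?e42 ?e31; lie_simp.
have e05 : phi (E8 q0 q5) = E8 q0 q5.
  by rewrite (_ : E8 q0 q5 = lie (E8 q2 q4) (E8 q0 q3)) ?(aut_lie H) ?e24 ?e03; lie_simp.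
have e50 : phi (E8 q5 q0) = E8 q5 q0.
  by rewrite (_ : E8 q5 q0 = lie (E8 q3 q0) (E8 q4 q2)) ?(aut_lie H) ?e42 ?e30; lie_simp.
have e06 : phi (E8 q0 q6) = E8 q0 q6.
  by rewrite (_ : E8 q0 q6 = lie (E8 q1 q2) (E8 q0 q5)) ?(aut_lie H) ?e12 ?e05; lie_simp.
have e60 : phi (E8 q6 q0) = E8 q6 q0.
  by rewrite (_ : E8 q6 q0 = lie (E8 q5 q0) (E8 q2 q1)) ?(aut_lie H) ?e21 ?e50; lie_simp.
have so a := E8_so8 a a.
have soN a : in_so8 (- E8 a a) by rewrite -E8_rev E8_so8.
have d1 : phi (E8 q0 q0) - phi (E8 q1 q1) = E8 q0 q0 - E8 q1 q1.
  rewrite -(aut_N H) // -(aut_D H) // (_ : _ - _ = lie (E8 q0 q1) (E8 q1 q0)) ?(aut_lie H) ?e01 ?e10;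
  by lie_simp.
have d2 : phi (E8 q1 q1) - phi (E8 q2 q2) = E8 q1 q1 - E8 q2 q2.
  rewrite -(aut_N H) // -(aut_D H) // (_ : _ - _ = lie (E8 q1 q2) (E8 q2 q1)) ?(aut_lie H) ?e12 ?e21;
  by lie_simp.
have d3 : phi (E8 q2 q2) - phi (E8 q3 q3) = E8 q2 q2 + E8 q3 q3.
  rewrite -(aut_N H) // -(aut_D H) // (_ : _ - _ = lie (E8 q2 q3) (E8 q3 q2)) ?(aut_lie H) ?e23 ?e32;
  by lie_simp.
have d4 : phi (E8 q2 q2) + phi (E8 q3 q3) = E8 q2 q2 - E8 q3 q3.
  rewrite -(aut_D H) // (_ : _ + _ = lie (E8 q2 q4) (E8 q4 q2)) ?(aut_lie H) ?e24 ?e42;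
  by lie_simp.
have e22 : phi (E8 q2 q2) = E8 q2 q2.
  transitivity (2^-1 *: ((E8 q2 q2 + E8 q3 q3) + (E8 q2 q2 - E8 q3 q3))).
    by rewrite -d3 -d4; apply/matrixP => i j; rewrite !mxE; field.
  by apply/matrixP => i j; rewrite !mxE; field.
have e33 : phi (E8 q3 q3) = - E8 q3 q3.
  by rewrite -[LHS](addKr (phi (E8 q2 q2))) d4 e22 addKr.
have e11 : phi (E8 q1 q1) = E8 q1 q1.
  by rewrite -[LHS](subrK (phi (E8 q2 q2))) d2 e22 subrK.
have e00 : phi (E8 q0 q0) = E8 q0 q0.
  by rewrite -[LHS](subrK (phi (E8 q1 q1))) d1 e11 subrK.
by do !split.
Qed.

End DiagramAutomorphisms.

Lemma tperm3 :
  (tperm i1 i2 i0 = i0) * (tperm i1 i2 i1 = i2) * (tperm i1 i2 i2 = i1) *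
  (tperm i0 i1 i0 = i1) * (tperm i0 i1 i1 = i0) * (tperm i0 i1 i2 = i2).
Proof. by do !split; rewrite permE. Qed.

(** * The generators in terms of the coordinates *)

Section Action.
Variable F : numClosedFieldType.
Implicit Types (x y : 'M[F]_8).

Definition data_perm (s : 'I_3 -> 'I_3) x y :=
  [/\ dA y = dA x, forall i, dl y i = dl x (s i),
      forall a i, dv y a i = dv x a (s i) & forall i a, dc y i a = dc x (s i) a].

Definition data_sign (e : 'I_3 -> F) x y :=
  [/\ dA y = dA x, forall i, dl y i = dl x i,
      forall a i, dv y a i = e i * dv x a i & forall i a, dc y i a = e i * dc x i a].

Let addE (M N : 'M[F]_8) i j : (M + N) i j = M i j + N i j. Proof. by rewrite mxE. Qed.
Let oppE (M : 'M[F]_8) i j : (- M) i j = - M i j. Proof. by rewrite mxE. Qed.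
Let scaE a (M : 'M[F]_8) i j : (a *: M) i j = a * M i j. Proof. by rewrite mxE. Qed.

Lemma so8_low y : in_so8 y -> ((y q6 q6 = - y q1 q1) * (y q5 q5 = - y q2 q2) *
  (y q6 q5 = - y q2 q1) * (y q5 q6 = - y q1 q2))%type.
Proof. by move=> /so8P hy; do !split; rewrite [LHS]hy !rev8. Qed.

Lemma big_triangle8 (V : nmodType) (f : 'I_8 -> 'I_8 -> V) :
  (forall i j : 'I_8, (7 <= i + j)%N -> f i j = 0) -> \sum_i \sum_j f i j =
  f q0 q0 + f q0 q1 + f q0 q2 + f q0 q3 + f q0 q4 + f q0 q5 + f q0 q6 +
  f q1 q0 + f q1 q1 + f q1 q2 + f q1 q3 + f q1 q4 + f q1 q5 + f q2 q0 +
  f q2 q1 + f q2 q2 + f q2 q3 + f q2 q4 + f q3 q0 + f q3 q1 + f q3 q2 +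
  f q3 q3 + f q4 q0 + f q4 q1 + f q4 q2 + f q5 q0 + f q5 q1 + f q6 q0.
Proof.
move=> h; rewrite !big8.
rewrite [f q0 q7]h //.
rewrite [f q1 q6]h // [f q1 q7]h //.
rewrite [f q2 q5]h // [f q2 q6]h // [f q2 q7]h //.
rewrite [f q3 q4]h // [f q3 q5]h // [f q3 q6]h // [f q3 q7]h //.
rewrite [f q4 q3]h // [f q4 q4]h // [f q4 q5]h // [f q4 q6]h // [f q4 q7]h //.
rewrite [f q5 q2]h // [f q5 q3]h // [f q5 q4]h // [f q5 q5]h // [f q5 q6]h // [f q5 q7]h //.
rewrite [f q6 q1]h // [f q6 q2]h // [f q6 q3]h // [f q6 q4]h // [f q6 q5]h // [f q6 q6]h // [f q6 q7]h //.
rewrite [f q7 q0]h // [f q7 q1]h // [f q7 q2]h // [f q7 q3]h // [f q7 q4]h // [f q7 q5]h // [f q7 q6]h // [f q7 q7]h //.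
by rewrite !addr0 !addrA.
Qed.

(** The truncation of y to the triangle, minus its mirror image in the antidiagonal, is an element
    of so_8 with the prescribed entries; [so8_sum] expands it. *)
Lemma so8_coef (y : 'I_8 -> 'I_8 -> F) (a b : 'I_8) : (a + b < 7)%N ->
  (\sum_(i < 8) \sum_(j < 8) (if (i + j < 7)%N then y i j else 0) *: E8 F i j) a b = y a b.
Proof.
move=> ab; pose m : 'M[F]_8 := \matrix_(i, j) (if (i + j < 7)%N then y i j else 0).
have h : in_so8 (m - \matrix_(i, j) m (rev_ord j) (rev_ord i)).
  by apply/so8P => i j; rewrite !mxE !rev_ordK; ring.
have E (i j : 'I_8) : (i + j < 7)%N -> (m - \matrix_(i, j) m (rev_ord j) (rev_ord i)) i j = y i j.
  rewrite !mxE => ij; rewrite ij [X in _ - X](_ : _ = 0) ?subr0 //; case: ifP => //.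
  by move: ij; elim/ord8_ind: i; elim/ord8_ind: j.
rewrite -[RHS](E _ _ ab) [in RHS](so8_sum h); congr (fun_of_matrix _ a b).
by do 2![apply: eq_bigr => ? _]; case: ifP => // ij; rewrite E.
Qed.

Lemma g13_entries phi x : diagram_aut swap13 phi -> in_so8 x ->
  ((phi x q0 q0 = (x q0 q0 + x q1 q1 + x q2 q2 - x q3 q3) / 2) * (phi x q0 q1 = x q2 q3) * (phi x q0 q2 = - x q1 q3) *
   (phi x q0 q3 = x q0 q3) * (phi x q0 q4 = x q1 q5) * (phi x q0 q5 = x q0 q5) *
   (phi x q0 q6 = x q0 q6) * (phi x q1 q0 = x q3 q2) * (phi x q1 q1 = (x q0 q0 + x q1 q1 - x q2 q2 + x q3 q3) / 2) *
   (phi x q1 q2 = x q1 q2) * (phi x q1 q3 = - x q0 q2) * (phi x q1 q4 = x q1 q4) *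
   (phi x q1 q5 = x q0 q4) * (phi x q2 q0 = - x q3 q1) * (phi x q2 q1 = x q2 q1) *
   (phi x q2 q2 = (x q0 q0 - x q1 q1 + x q2 q2 + x q3 q3) / 2) * (phi x q2 q3 = x q0 q1) * (phi x q2 q4 = x q2 q4) *
   (phi x q3 q0 = x q3 q0) * (phi x q3 q1 = - x q2 q0) * (phi x q3 q2 = x q1 q0) *
   (phi x q3 q3 = (- x q0 q0 + x q1 q1 + x q2 q2 + x q3 q3) / 2) * (phi x q4 q0 = x q5 q1) * (phi x q4 q1 = x q4 q1) *
   (phi x q4 q2 = x q4 q2) * (phi x q5 q0 = x q5 q0) * (phi x q5 q1 = x q4 q0) *
   (phi x q6 q0 = x q6 q0))%type.
Proof.
move=> H sx; have := aut_sum H sx; rewrite big_triangle8; last first.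
  by move=> i j; rewrite leqNgt => /negPf->; rewrite scale0r.
rewrite /= !(g13_E8 H) => phiE.
pose y (i j : 'I_8) := nth 0 (nth [::]
  [:: [:: (x q0 q0 + x q1 q1 + x q2 q2 - x q3 q3) / 2; x q2 q3; - x q1 q3; x q0 q3; x q1 q5; x q0 q5; x q0 q6];
      [:: x q3 q2; (x q0 q0 + x q1 q1 - x q2 q2 + x q3 q3) / 2; x q1 q2; - x q0 q2; x q1 q4; x q0 q4];
      [:: - x q3 q1; x q2 q1; (x q0 q0 - x q1 q1 + x q2 q2 + x q3 q3) / 2; x q0 q1; x q2 q4];
      [:: x q3 q0; - x q2 q0; x q1 q0; (- x q0 q0 + x q1 q1 + x q2 q2 + x q3 q3) / 2];
      [:: x q5 q1; x q4 q1; x q4 q2];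
      [:: x q5 q0; x q4 q0];
      [:: x q6 q0]] i) j.
have {}phiE : phi x = \sum_(i < 8) \sum_(j < 8) (if (i + j < 7)%N then y i j else 0) *: E8 F i j.
  rewrite phiE [RHS]big_triangle8 /= => [|i j]; last first.
    by rewrite leqNgt => /negPf->; rewrite scale0r.
  move: (@E8 F) => e; apply/matrixP => i j.
  by rewrite /y /= !(addE, oppE, scaE); field.
by do !split; rewrite phiE so8_coef.
Qed.

Lemma g13_data phi x : diagram_aut swap13 phi -> in_so8 x ->
  in_so8 (phi x) /\ data_perm (tperm i1 i2) x (phi x).
Proof.
move=> H sx; have spx : in_so8 (phi x) by case: H => h _ _ _ _; apply: h.
split=> //; have lx := so8_low sx; have lp := so8_low spx; have E := g13_entries H sx.
split.
- by apply: mx3_eq; rewrite /dA /blocktr !mx3E ?lx ?lp !E; field.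
- by elim/ord3_ind; rewrite tperm3 /dl /blocktr /= ?lx ?lp !E; field.
- by do 2!elim/ord3_ind; rewrite tperm3 /dv !mx3E !E ?opprK.
- by do 2!elim/ord3_ind; rewrite tperm3 /dc !mx3E !E ?opprK.
Qed.

Lemma g34_entries phi x : diagram_aut swap34 phi -> in_so8 x ->
  ((phi x q0 q0 = x q0 q0) * (phi x q0 q1 = x q0 q1) * (phi x q0 q2 = x q0 q2) *
   (phi x q0 q3 = x q0 q4) * (phi x q0 q4 = x q0 q3) * (phi x q0 q5 = x q0 q5) *
   (phi x q0 q6 = x q0 q6) * (phi x q1 q0 = x q1 q0) * (phi x q1 q1 = x q1 q1) *
   (phi x q1 q2 = x q1 q2) * (phi x q1 q3 = x q1 q4) * (phi x q1 q4 = x q1 q3) *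
   (phi x q1 q5 = x q1 q5) * (phi x q2 q0 = x q2 q0) * (phi x q2 q1 = x q2 q1) *
   (phi x q2 q2 = x q2 q2) * (phi x q2 q3 = x q2 q4) * (phi x q2 q4 = x q2 q3) *
   (phi x q3 q0 = x q4 q0) * (phi x q3 q1 = x q4 q1) * (phi x q3 q2 = x q4 q2) *
   (phi x q3 q3 = - x q3 q3) * (phi x q4 q0 = x q3 q0) * (phi x q4 q1 = x q3 q1) *
   (phi x q4 q2 = x q3 q2) * (phi x q5 q0 = x q5 q0) * (phi x q5 q1 = x q5 q1) *
   (phi x q6 q0 = x q6 q0))%type.
Proof.
move=> H sx; have := aut_sum H sx; rewrite big_triangle8; last first.
  by move=> i j; rewrite leqNgt => /negPf->; rewrite scale0r.
rewrite /= !(g34_E8 H) => phiE.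
pose y (i j : 'I_8) := nth 0 (nth [::]
  [:: [:: x q0 q0; x q0 q1; x q0 q2; x q0 q4; x q0 q3; x q0 q5; x q0 q6];
      [:: x q1 q0; x q1 q1; x q1 q2; x q1 q4; x q1 q3; x q1 q5];
      [:: x q2 q0; x q2 q1; x q2 q2; x q2 q4; x q2 q3];
      [:: x q4 q0; x q4 q1; x q4 q2; - x q3 q3];
      [:: x q3 q0; x q3 q1; x q3 q2];
      [:: x q5 q0; x q5 q1];
      [:: x q6 q0]] i) j.
have {}phiE : phi x = \sum_(i < 8) \sum_(j < 8) (if (i + j < 7)%N then y i j else 0) *: E8 F i j.
  rewrite phiE [RHS]big_triangle8 /= => [|i j]; last first.
    by rewrite leqNgt => /negPf->; rewrite scale0r.
  move: (@E8 F) => e; apply/matrixP => i j.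
  by rewrite /y /= !(addE, oppE, scaE); field.
by do !split; rewrite phiE so8_coef.
Qed.

Lemma g34_data phi x : diagram_aut swap34 phi -> in_so8 x ->
  in_so8 (phi x) /\ data_perm (tperm i0 i1) x (phi x).
Proof.
move=> H sx; have spx : in_so8 (phi x) by case: H => h _ _ _ _; apply: h.
split=> //; have lx := so8_low sx; have lp := so8_low spx; have E := g34_entries H sx.
split.
- by apply: mx3_eq; rewrite /dA /blocktr !mx3E ?lx ?lp !E; field.
- by elim/ord3_ind; rewrite tperm3 /dl /blocktr /= ?lx ?lp !E; field.
- by do 2!elim/ord3_ind; rewrite tperm3 /dv !mx3E !E ?opprK.
- by do 2!elim/ord3_ind; rewrite tperm3 /dc !mx3E !E ?opprK.
Qed.

End Action.

(** * Invariance of the coordinates *)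

Section Stability.
Variable F : numClosedFieldType.
Implicit Types (x y : 'M[F]_8).

(** The signs of [Ad (t34 F)], which plays the part of (1 2)(3 4) in V_4, since (3 4) acts by its
    composite with (1 2). The other nontrivial elements arise by conjugation with S_3. *)
Definition sgn1 : 'I_3 -> F := fun i => nth 0 [:: 1; -1; -1] i.

Lemma Ad_t34E x i j : Ad (t34 F) x i j =
  [:: 1; -1; -1; 1; -1; 1; 1; -1]`_i * x i j * [:: 1; -1; -1; 1; -1; 1; 1; -1]`_j.
Proof.
(* Since the inverse of - 'i is 'i, the product of the two coroot values is 'i times a sign matrix;
   the scalar 'i cancels in the conjugation. *)
pose d : 'rV[F]_8 := \row_k ('i * [:: 1; -1; -1; 1; -1; 1; 1; -1]`_k).
have ii : 'i * 'i = -1 :> F by rewrite -expr2 sqrCi.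
have tE : t34 F = diag_mx d.
  rewrite /t34 /coroot1 /coroot3 mulmx_diag; congr diag_mx; apply/matrixP => a k.
  rewrite !mxE invrN invCi opprK.
  by elim/ord8_ind: k; rewrite /=; ring.
have tV : invmx (t34 F) = - diag_mx d.
  apply: mulmx1_inv; rewrite tE mulmxN mulmx_diag; apply/matrixP => a b; rewrite !mxE.
  have [->|_] := eqVneq a b; last by rewrite !mulr0n oppr0.
  rewrite !mulr1n mulrACA ii.
  by elim/ord8_ind: b; rewrite /=; ring.
rewrite /Ad tV tE mulmxN mul_diag_mx mul_mx_diag !mxE.
set p := nth _ _ i; set q := nth _ _ j.
have ii0 : 'i * 'i + 1 = 0 :> F by rewrite ii addNr.
by apply: (eq_cof (e := - (p * x i j * q)) ii0); ring.
Qed.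

Lemma Ad_data x : in_so8 x -> in_so8 (Ad (t34 F) x) /\ data_sign sgn1 x (Ad (t34 F) x).
Proof.
move=> sx; have /so8P h := sx; split.
  apply/so8P => i j; rewrite !Ad_t34E h.
  by elim/ord8_ind: i; elim/ord8_ind: j; rewrite !rev8 /=; ring.
split.
- by apply: mx3_eq; rewrite /dA /blocktr !mx3E !Ad_t34E /=; field.
- by elim/ord3_ind; rewrite /dl /blocktr !Ad_t34E /=; field.
- by do 2!elim/ord3_ind; rewrite /dv !mx3E !Ad_t34E /sgn1 /=; ring.
- by do 2!elim/ord3_ind; rewrite /dc !mx3E !Ad_t34E /sgn1 /=; ring.
Qed.

Lemma sgn1_sqr i : sgn1 i * sgn1 i = 1.
Proof. by elim/ord3_ind: i; rewrite /sgn1 /=; ring. Qed.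

Lemma sgn1_mul i j k : i != j -> j != k -> i != k -> sgn1 i * sgn1 j = sgn1 k.
Proof.
by elim/ord3_ind: i; elim/ord3_ind: j => //; elim/ord3_ind: k => // _ _ _; rewrite /sgn1 /=; ring.
Qed.

Lemma lqf_perm s x y : injective s -> data_perm s x y -> lqf y = lqf x.
Proof.
move=> si [hA _ hv hc]; rewrite /lqf hA; congr (_, _, _); apply/matrixP => a b.
  rewrite !mxE [RHS](reindex_inj si); apply: eq_bigr => i _.
  by rewrite ![_^T _ _]mxE !hv.
rewrite !mxE [RHS](reindex_inj si); apply: eq_bigr => i _.
by rewrite ![_^T _ _]mxE !hc.
Qed.

Lemma lqf_sign e x y : (forall i, e i * e i = 1) -> data_sign e x y -> lqf y = lqf x.
Proof.
move=> e2 [hA _ hv hc]; rewrite /lqf hA; congr (_, _, _); apply/matrixP => a b.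
  rewrite !mxE; apply: eq_bigr => i _.
  by rewrite ![_^T _ _]mxE !hv mulrACA e2 mul1r.
rewrite !mxE; apply: eq_bigr => i _.
by rewrite ![_^T _ _]mxE !hc mulrACA e2 mul1r.
Qed.

Lemma regularP (l : 'I_3 -> F) : reflect (injective l) (regular l).
Proof.
apply: (iffP idP) => [|li].
  rewrite /regular !mulf_eq0 !subr_eq0 !negb_or -!andbA => /and3P[n01 n12 n20].
  by do 2!elim/ord3_ind => //; move=> e; move: n01 n12 n20; rewrite ?e eqxx.
by rewrite /regular !mulf_neq0 // subr_eq0 (inj_eq li).
Qed.

Lemma W_perm s x y : injective s -> in_so8 y -> data_perm s x y -> W x -> W y.
Proof.
move=> si sy [hA hl hv hc] [_ [j1 j2 j3 j4 j5 j6 j7 j8 j9] rx].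
have sumE (f : F -> F) : \sum_i f (dl y i) = \sum_i f (dl x i).
  by rewrite [RHS](reindex_inj si); apply: eq_bigr => i _; rewrite hl.
split=> //; last first.
  by apply/regularP => i j; rewrite !hl => /(elimT (regularP _) rx)/si.
split; rewrite ?hA //.
- by rewrite (sumE id).
- by rewrite j3 -(sumE (fun t => t ^+ 2)).
- by move=> i a; rewrite hl hv -j4; apply: eq_bigr => b _; rewrite hv.
- by move=> i a; rewrite hl hc -j5; apply: eq_bigr => b _; rewrite hc.
- by move=> i a b; rewrite hl hv hc j6 (sumE (fun t => t ^+ 2)).
- move=> i j ij; rewrite -[RHS](j7 (s i) (s j)) ?(inj_eq si) //.
  by apply: eq_bigr => a _; rewrite hc hv.
- move=> i j k ij jk ik a b; rewrite !hv hl (j8 _ _ (s k)) ?(inj_eq si) //.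
  by congr (- _); apply: eq_bigr => e _; congr (_ * fun_of_matrix _ _ _); apply: eq_skew3 => f; rewrite hc.
- move=> i j k ij jk ik a b; rewrite !hc hl (j9 _ _ (s k)) ?(inj_eq si) //.
  by apply: eq_bigr => e _; congr (_ * fun_of_matrix _ _ _); apply: eq_skew3 => f; rewrite hv.
Qed.

(** In [j_vv] and [j_cc] a product at the indices i and j equals an expression linear at k, so they
    require e_i e_j = e_k, which is [sgn1_mul]. The other relations involve only squares of signs or
    are homogeneous. *)
Lemma W_sign x y : in_so8 y -> data_sign sgn1 x y -> W x -> W y.
Proof.
move=> sy [hA hl hv hc] [_ J rx].
have [j1 j2 j3 j4 j5 j6 j7 j8 j9] : joseph (dA y) (dl y) (dv x) (dc x).
  by rewrite hA; apply: eq_joseph J => i.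
split=> //; last by apply/regularP => i j; rewrite !hl => /(elimT (regularP _) rx).
split=> //.
- move=> i a; rewrite hv mulrCA -j4 mulr_sumr.
  by apply: eq_bigr => b _; rewrite hv mulrCA.
- move=> i a; rewrite hc mulrCA -j5 mulr_sumr.
  by apply: eq_bigr => b _; rewrite hc mulrA.
- by move=> i a b; rewrite hv hc mulrACA sgn1_sqr mul1r j6.
- move=> i j ij; under eq_bigr do rewrite hc hv mulrACA.
  by rewrite -mulr_sumr j7 // mulr0.
- move=> i j k ij jk ik a b.
  rewrite !hv mulrACA (sgn1_mul ij jk ik) (j8 _ _ _ ij jk ik) mulrN mulr_sumr.
  congr (- _); apply: eq_bigr => e _; rewrite mulrCA -skew3Z; congr (_ * fun_of_matrix _ _ _).
  by apply: eq_skew3 => f; rewrite hc.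
- move=> i j k ij jk ik a b.
  rewrite !hc mulrACA (sgn1_mul ij jk ik) (j9 _ _ _ ij jk ik) mulr_sumr.
  apply: eq_bigr => e _; rewrite mulrCA -skew3Z; congr (_ * fun_of_matrix _ _ _).
  by apply: eq_skew3 => f; rewrite hv.
Qed.

End Stability.

(** * Power sums *)

(** A subalgebra of functions closed under equality on [W], where alone the relations between the
    coordinates are available. *)
Record funalg (F : fieldType) (T : Type) (W : T -> Prop) (B : (T -> F) -> Prop) : Prop :=
  FunAlg {
    fa_ext : forall f g, (forall x, W x -> f x = g x) -> B f -> B g;
    fa_const : forall a, B (fun=> a);
    fa_add : forall f g, B f -> B g -> B (fun x => f x + g x);
    fa_mul : forall f g, B f -> B g -> B (fun x => f x * g x) }.

Section FunAlg.
Variables (F : fieldType) (T : Type) (W : T -> Prop) (B : (T -> F) -> Prop).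
Hypothesis BA : funalg W B.

Lemma fa_sum (I : Type) (r : seq I) (f : I -> T -> F) :
  (forall i, B (f i)) -> B (fun x => \sum_(i <- r) f i x).
Proof.
move=> h; elim: r => [|i r IH].
  by apply: (fa_ext BA) (fa_const BA 0) => x _; rewrite big_nil.
by apply: (fa_ext BA) (fa_add BA (h i) IH) => x _; rewrite big_cons.
Qed.

Lemma fa_sub f g : B f -> B g -> B (fun x => f x - g x).
Proof.
move=> hf hg; have h := fa_add BA hf (fa_mul BA (fa_const BA (-1)) hg).
by apply: (fa_ext BA) h => x _; rewrite mulN1r.
Qed.

Lemma fa_scale a f : B f -> B (fun x => a * f x).
Proof. by move=> hf; apply: (fa_mul BA (fa_const BA a) hf). Qed.
End FunAlg.

Section PowerSums.
Variables (F : numClosedFieldType) (T : Type) (W : T -> Prop) (B : (T -> F) -> Prop).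
Hypothesis BA : funalg W B.
Variables (A : T -> 'I_3 -> 'I_3 -> F) (l : T -> 'I_3 -> F) (v c : T -> 'I_3 -> 'I_3 -> F).
Variables (e2 : T -> F) (P : 'I_3 -> 'I_3 -> 'I_3 -> T -> F) (Q : 'I_3 -> 'I_3 -> 'I_3 -> F).
Hypothesis B_A : forall a b, B (fun x => A x a b).
Hypothesis B_S : forall a b, B (fun x => \sum_i v x a i * v x b i).
Hypothesis B_T : forall a b, B (fun x => \sum_i c x a i * c x b i).
Hypothesis B_e2 : B e2.
Hypothesis B_P : forall a b f, B (P a b f).
Hypothesis suml : forall x, W x -> \sum_i l x i = 0.
Hypothesis suml2 : forall x, W x -> \sum_i l x i ^+ 2 = 2 * e2 x.
Hypothesis Av : forall x, W x -> forall i a, \sum_b A x a b * v x b i = l x i * v x a i.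
Hypothesis Ac : forall x, W x -> forall i a, \sum_b A x b a * c x b i = l x i * c x a i.
Hypothesis vc : forall x, W x -> forall i a b, v x a i * c x b i =
  \sum_e A x a e * A x e b + l x i * A x a b + (l x i ^+ 2 - e2 x) * (a == b)%:R.
Hypothesis vv : forall x, W x -> forall i j k, i != j -> j != k -> i != k -> forall a b,
  v x a i * v x b j = \sum_f (P a b f x + l x j * Q a b f) * c x f k.

(** The determinant of A: for A of trace 0 with tr A^2 = 2 e2, Cayley-Hamilton says that A^3 - e2 A
    is det A times the identity, and this is its first entry. *)
Definition e3 x := \sum_e (\sum_f A x i0 f * A x f e) * A x e i0 - e2 x * A x i0 i0.

Lemma B_e3 : B e3.
Proof.
apply: (fa_sub BA); last exact: (fa_mul BA).
apply: (fa_sum BA) => e; apply: (fa_mul BA) => //.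
by apply: (fa_sum BA) => f; apply: (fa_mul BA).
Qed.

(** A - l_i annihilates v_i c_i = A^2 + l_i A + l_i^2 - e2, and the product is A^3 - e2 A - (l_i^3 -
    e2 l_i). The entry at ([i0], [i0]) gives the cubic equation. *)
Lemma l_cubic x i : W x -> l x i ^+ 3 = e2 x * l x i + e3 x.
Proof.
move=> Wx.
have h : \sum_e A x i0 e * (v x e i * c x i0 i) = l x i * (v x i0 i * c x i0 i).
  by rewrite mulrA -(Av Wx) mulr_suml; apply: eq_bigr => e _; rewrite mulrA.
move: h; rewrite /e3 (vc Wx) !big3 !(vc Wx) !big3 /= => /eqP; rewrite -subr_eq0 => /eqP h.
by apply: (eq_cof (e := -1) h); ring.
Qed.

(** A module over [B] of expressions that are the same for all three indices, so that summing over
    the index yields power sums. The bound n on the degree in v carries the induction. *)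
Inductive Nv (n : nat) : (T -> 'I_3 -> F) -> Prop :=
| Nv_lam k : Nv n (fun x i => l x i ^+ k)
| Nv_v s : ~~ odd (size s) -> (size s <= n)%N -> Nv n (fun x i => \prod_(a <- s) v x a i)
| Nv_add f g : Nv n f -> Nv n g -> Nv n (fun x i => f x i + g x i)
| Nv_scale b f : B b -> Nv n f -> Nv n (fun x i => b x * f x i)
| Nv_ext f g : (forall x, W x -> f x =1 g x) -> Nv n f -> Nv n g.

Lemma Nv_sum n (I : Type) (r : seq I) (f : I -> T -> 'I_3 -> F) :
  (forall i, Nv n (f i)) -> Nv n (fun x j => \sum_(i <- r) f i x j).
Proof.
move=> h; elim: r => [|i r IH].
  apply: Nv_ext (Nv_scale (fa_const BA 0) (Nv_lam n 0)) => x _ j.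
  by rewrite mul0r big_nil.
by apply: Nv_ext (Nv_add (h i) IH) => x _ j; rewrite big_cons.
Qed.

(** Next to a factor v_i, the factor l_i is absorbed by l_i v_i = A v_i, which keeps the degree in
    v; otherwise it raises the power of l_i. *)
Lemma Nv_l n f : Nv n f -> Nv n (fun x i => l x i * f x i).
Proof.
elim=> [k|s os ss|f1 f2 _ h1 _ h2|b f1 hb _ h1|f1 f2 e _ h1].
- by apply: Nv_ext (Nv_lam n k.+1) => x _ i; rewrite exprS.
- case: s os ss => [_ _|a s os ss].
    by apply: Nv_ext (Nv_lam n 1) => x _ i; rewrite big_nil mulr1 expr1.
  have h : Nv n (fun x i => \sum_b A x a b * \prod_(a <- b :: s) v x a i).
    by apply: Nv_sum => b; apply: Nv_scale => //; apply: Nv_v.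
  apply: Nv_ext h => x Wx i; rewrite big_cons mulrA -(Av Wx) mulr_suml.
  by apply: eq_bigr => b _; rewrite big_cons mulrA.
- by apply: Nv_ext (Nv_add h1 h2) => x _ i; rewrite mulrDr.
- by apply: Nv_ext (Nv_scale hb h1) => x _ i; rewrite mulrCA.
- by apply: Nv_ext h1 => x Wx i; rewrite e.
Qed.

Lemma Nv_vc n f a b : Nv n f -> Nv n (fun x i => v x a i * c x b i * f x i).
Proof.
move=> hf.
have h1 : B (fun x => \sum_e A x a e * A x e b).
  by apply: (fa_sum BA) => e; apply: (fa_mul BA).
have h2 : B (fun x => - (a == b)%:R * e2 x) by apply: (fa_scale BA).
have h := Nv_add (Nv_add (Nv_scale h1 hf) (Nv_scale (B_A a b) (Nv_l hf)))
  (Nv_add (Nv_scale (fa_const BA (a == b)%:R) (Nv_l (Nv_l hf))) (Nv_scale h2 hf)).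
by apply: Nv_ext h => x Wx i; rewrite (vc Wx); ring.
Qed.

Lemma B_suml k : B (fun x => \sum_i l x i ^+ k).
Proof.
elim/ltn_ind: k => [[|[|[|k]]]] IH.
- by apply: (fa_ext BA) (fa_const BA 3) => x _; rewrite big3 !expr0; ring.
- apply: (fa_ext BA) (fa_const BA 0) => x Wx.
  by rewrite -[LHS](suml Wx); apply: eq_bigr => i _; rewrite expr1.
- by apply: (fa_ext BA) (fa_scale BA 2 B_e2) => x Wx; rewrite suml2.
have h := fa_add BA (fa_mul BA B_e2 (IH k.+1 (leqnSn _))) (fa_mul BA B_e3 (IH k (leqW (leqnSn _)))).
apply: (fa_ext BA) h => x Wx; rewrite !mulr_sumr -big_split.
by apply: eq_bigr => i _ /=; rewrite -addn3 exprD (l_cubic _ Wx) exprS; ring.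
Qed.

Definition powers_in n :=
  forall s, ~~ odd (size s) -> (size s <= n)%N -> B (fun x => \sum_i \prod_(a <- s) v x a i).

Lemma Nv_in n f : powers_in n -> Nv n f -> B (fun x => \sum_i f x i).
Proof.
move=> hn; elim=> [k|s os ss|f1 f2 _ h1 _ h2|b f1 hb _ h1|f1 f2 e _ h1].
- exact: B_suml.
- exact: hn.
- by apply: (fa_ext BA) (fa_add BA h1 h2) => x _; rewrite big_split.
- by apply: (fa_ext BA) (fa_mul BA hb h1) => x _; rewrite mulr_sumr.
- by apply: (fa_ext BA) h1 => x Wx; apply: eq_bigr => i _; rewrite e.
Qed.

Lemma B_lcc k a b : B (fun x => \sum_i c x a i * c x b i * l x i ^+ k).
Proof.
elim: k a => [|k IH] a.
  by apply: (fa_ext BA) (B_T a b) => x _; apply: eq_bigr => i _; rewrite mulr1.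
have h : B (fun x => \sum_d A x d a * (\sum_i c x d i * c x b i * l x i ^+ k)).
  by apply: (fa_sum BA) => d; apply: (fa_mul BA).
apply: (fa_ext BA) h => x Wx; under eq_bigr do rewrite mulr_sumr.
rewrite exchange_big; apply: eq_bigr => i _ /=.
have -> : c x a i * c x b i * l x i ^+ k.+1 = (l x i * c x a i) * (c x b i * l x i ^+ k).
  by rewrite exprS; ring.
by rewrite -(Ac Wx) mulr_suml; apply: eq_bigr => d _; ring.
Qed.

(** Two factors v_i are paired with the two factors c_i, and each pair is a polynomial in A and l_i,
    so the degree in v drops. Powers of l_i alone are absorbed into c_i by [B_lcc]. *)
Lemma Nv_cc_in n f a b : powers_in n -> Nv n f -> B (fun x => \sum_i c x a i * c x b i * f x i).
Proof.
move=> hn; elim=> [k|s os ss|f1 f2 _ h1 _ h2|d f1 hd _ h1|f1 f2 e _ h1].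
- exact: B_lcc.
- case: s os ss => [|a1 [|b1 s]] // os ss.
    by apply: (fa_ext BA) (B_T a b) => x _; apply: eq_bigr => i _; rewrite big_nil mulr1.
  have hs : Nv n (fun x i => \prod_(a <- s) v x a i).
    apply: Nv_v; first by move: os; rewrite /= negbK.
    by apply: leq_trans ss; rewrite /= ltnW.
  apply: (fa_ext BA) (Nv_in hn (Nv_vc a1 a (Nv_vc b1 b hs))) => x _.
  by apply: eq_bigr => i _; rewrite !big_cons; ring.
- apply: (fa_ext BA) (fa_add BA h1 h2) => x _; rewrite -big_split.
  by apply: eq_bigr => i _; rewrite mulrDr.
- apply: (fa_ext BA) (fa_mul BA hd h1) => x _; rewrite mulr_sumr.
  by apply: eq_bigr => i _; rewrite mulrCA.
- by apply: (fa_ext BA) h1 => x Wx; apply: eq_bigr => i _; rewrite e.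
Qed.

(* [\sum_i v_i^(2m+4)] is [\sum_i v_i^2 * \sum_j v_j^(2m+2)] minus the terms with [i != j], in which
   the two products [v_i v_j] are traded for [c_k c_k], [k] being the third index. *)
Lemma powers_in_all n : powers_in n.
Proof.
(* Odd lengths contradict the hypothesis; lengths 0, 2 and at least 4 remain. *)
elim/ltn_ind: n => n IH [|a [|b [|a' [|b' s]]]] //= os ss.
- by apply: (fa_ext BA) (fa_const BA 3) => x _; rewrite big3 !big_nil; ring.
- by apply: (fa_ext BA) (B_S a b) => x _; apply: eq_bigr => i _; rewrite !big_cons big_nil mulr1.
have os' : ~~ odd (size s) by move: os; rewrite !negbK.
have hn : powers_in (size s).+2 by apply: IH (leq_trans (leqnSn _) ss).
have hm : powers_in (size s) by apply: IH (leq_trans (leqW (leqW (leqnSn _))) ss).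
(* [R] is the coefficient of c_f in the product of two v's at different indices. Two such products
   contribute the coefficient [G], of degree only [size s] in v, four less than the given
   monomial. *)
pose R a b f x i := P a b f x + l x i * Q a b f.
pose G f f' x i := R a a' f x i * R b b' f' x i * \prod_(d <- s) v x d i.
have NR g f d d' : Nv (size s) g -> Nv (size s) (fun x i => R d d' f x i * g x i).
  move=> hg; have h := Nv_add (Nv_scale (B_P d d' f) hg) (Nv_scale (fa_const BA (Q d d' f)) (Nv_l hg)).
  by apply: Nv_ext h => x _ i; rewrite /R; ring.
have NG f f' : Nv (size s) (G f f').
  have h := NR _ f a a' (NR _ f' b b' (Nv_v os' (leqnn _))).
  by apply: Nv_ext h => x _ i; rewrite /G mulrA.
have h1 : B (fun x => (\sum_i v x a i * v x b i) * \sum_i \prod_(d <- [:: a', b' & s]) v x d i).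
  by apply: (fa_mul BA) => //; apply: hn; rewrite //= negbK.
(* The sum over ordered pairs of distinct indices, as the full product minus the diagonal. *)
have h2 : B (fun x => \sum_f \sum_f' ((\sum_i c x f i * c x f' i) * (\sum_i G f f' x i)
    - \sum_i c x f i * c x f' i * G f f' x i)).
  apply: (fa_sum BA) => f; apply: (fa_sum BA) => f'; apply: (fa_sub BA).
    by apply: (fa_mul BA) => //; apply: Nv_in (NG f f').
  exact: Nv_cc_in (NG f f').
apply: (fa_ext BA) (fa_sub BA h1 h2) => x Wx.
have tr i j k : i != j -> j != k -> i != k ->
    v x a i * v x b i * \prod_(d <- [:: a', b' & s]) v x d j =
    \sum_f \sum_f' c x f k * c x f' k * G f f' x j.
  move=> ij jk ik; rewrite !big_cons.
  have -> : v x a i * v x b i * (v x a' j * (v x b' j * \prod_(d <- s) v x d j)) =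
     (v x a i * v x a' j) * (v x b i * v x b' j) * \prod_(d <- s) v x d j by ring.
  rewrite !(vv Wx ij jk ik) -mulrA mulr_suml; apply: eq_bigr => f _.
  rewrite mulr_suml mulr_sumr; apply: eq_bigr => f' _; rewrite /G /R; ring.
have -> : \sum_f \sum_f' ((\sum_i c x f i * c x f' i) * (\sum_i G f f' x i)
    - \sum_i c x f i * c x f' i * G f f' x i) =
  \sum_f \sum_f' c x f i2 * c x f' i2 * G f f' x i1 + \sum_f \sum_f' c x f i1 * c x f' i1 * G f f' x i2 +
  \sum_f \sum_f' c x f i2 * c x f' i2 * G f f' x i0 + \sum_f \sum_f' c x f i0 * c x f' i0 * G f f' x i2 +
  \sum_f \sum_f' c x f i1 * c x f' i1 * G f f' x i0 + \sum_f \sum_f' c x f i0 * c x f' i0 * G f f' x i1.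
  rewrite -!big_split; apply: eq_bigr => f _; rewrite -!big_split; apply: eq_bigr => f' _ /=.
  by rewrite !big3; ring.
rewrite -(tr i0 i1 i2) // -(tr i0 i2 i1) // -(tr i1 i0 i2) // -(tr i1 i2 i0) // -(tr i2 i0 i1) // -(tr i2 i1 i0) //.
by rewrite !big3 !big_cons; ring.
Qed.

Lemma power_sum_in s : ~~ odd (size s) -> B (fun x => \sum_i \prod_(a <- s) v x a i).
Proof. by move=> os; apply: (@powers_in_all (size s)). Qed.

End PowerSums.

(** * Invariants as polynomials in the quotient coordinates *)

Section Invariants.
Variable F : numClosedFieldType.
Local Notation T := 'M[F]_8.
Local Notation W := (@W F).
Implicit Types (x y : T) (f g h : T -> F) (u w : T -> 'I_3 -> F).

Definition InB f :=
  exists q : {mpoly F[3 * (3 + (3 + 3))]}, forall x, W x -> f x = q.@[coordT (lqf x)].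

Lemma InB_alg : funalg W InB.
Proof.
split.
- by move=> f g e [q hq]; exists q => x Wx; rewrite -e ?hq.
- by move=> a; exists a%:MP => x _; rewrite mevalC.
- by move=> f g [p hp] [q hq]; exists (p + q) => x Wx; rewrite mevalD hp ?hq.
- by move=> f g [p hp] [q hq]; exists (p * q) => x Wx; rewrite mevalM hp ?hq.
Qed.

Lemma InB_A a b : InB (fun x => dA x a b).
Proof.
exists 'X_(mxvec_index a (lshift _ b)) => x _.
by rewrite mevalXU /coordT mxvecE row_mxEl.
Qed.

Lemma InB_S a b : InB (fun x => \sum_i dv x a i * dv x b i).
Proof.
exists 'X_(mxvec_index a (rshift _ (lshift _ b))) => x _.
rewrite mevalXU /coordT mxvecE row_mxEr row_mxEl [RHS]mxE.
by apply: eq_bigr => i _; rewrite [_^T _ _]mxE.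
Qed.

Lemma InB_T a b : InB (fun x => \sum_i dc x i a * dc x i b).
Proof.
exists 'X_(mxvec_index a (rshift _ (rshift _ b))) => x _.
rewrite mevalXU /coordT mxvecE row_mxEr row_mxEr [RHS]mxE.
by apply: eq_bigr => i _; rewrite [_^T _ _]mxE.
Qed.

Definition e2 x := (\sum_a \sum_e dA x a e * dA x e a) / 2.

Lemma InB_e2 : InB e2.
Proof.
have h : InB (fun x => 2^-1 * \sum_a \sum_e dA x a e * dA x e a).
  apply: (fa_scale InB_alg); apply: (fa_sum InB_alg) => a; apply: (fa_sum InB_alg) => e.
  by apply: (fa_mul InB_alg); apply: InB_A.
by apply: (fa_ext InB_alg) h => x _; rewrite /e2 mulrC.
Qed.

Lemma W_joseph x : W x -> joseph (dA x) (dl x) (dv x) (dc x).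
Proof. by case. Qed.

Lemma suml2E x : W x -> \sum_i dl x i ^+ 2 = 2 * e2 x.
Proof. by move=> /W_joseph J; rewrite /e2 (j_trA2 J); field. Qed.

Lemma W_vc x : W x -> forall i a b, dv x a i * dc x i b =
  \sum_e dA x a e * dA x e b + dl x i * dA x a b + (dl x i ^+ 2 - e2 x) * (a == b)%:R.
Proof.
move=> Wx i a b; rewrite (j_vc (W_joseph Wx)) suml2E //.
by congr (_ + (_ - _) * _); field.
Qed.

(** The Levi-Civita symbol. *)
Definition eps (a b f : 'I_3) : F := skew3 (fun k => (k == f)%:R) a b.

Lemma skew3_eps (z : 'I_3 -> F) a b : skew3 z a b = \sum_f eps a b f * z f.
Proof.
by rewrite big3; elim/ord3_ind: a; elim/ord3_ind: b; rewrite /eps /skew3 !mx3E /=; ring.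
Qed.

Lemma W_vv x : W x -> forall i j k, i != j -> j != k -> i != k -> forall a b,
  dv x a i * dv x b j =
  \sum_f (- (\sum_e dA x a e * eps e b f) + dl x j * eps a b f) * dc x k f.
Proof.
move=> Wx i j k ij jk ik a b; rewrite (j_vv (W_joseph Wx) ij jk ik).
under eq_bigr do rewrite skew3_eps.
rewrite !big3; elim/ord3_ind: a; rewrite /=; ring.
Qed.

Lemma W_cc x : W x -> forall i j k, i != j -> j != k -> i != k -> forall a b,
  dc x i a * dc x j b =
  \sum_f (\sum_e dA x e a * eps e b f + dl x j * - eps a b f) * dv x f k.
Proof.
move=> Wx i j k ij jk ik a b; rewrite (j_cc (W_joseph Wx) ij jk ik).
under eq_bigr do rewrite skew3_eps.
rewrite !big3; elim/ord3_ind: a; rewrite /=; ring.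
Qed.

Lemma InB_powv s : ~~ odd (size s) -> InB (fun x => \sum_i \prod_(a <- s) dv x a i).
Proof.
apply: (@power_sum_in F T W InB InB_alg (fun x => dA x) (fun x => dl x) (fun x => dv x)
  (fun x a i => dc x i a) e2 (fun a b k x => - (\sum_e dA x a e * eps e b k)) eps).
- exact: InB_A.
- exact: InB_S.
- exact: InB_T.
- exact: InB_e2.
- move=> a b f; have h : InB (fun x => 0 - \sum_e dA x a e * eps e b f).
    apply: (fa_sub InB_alg); first exact: fa_const InB_alg 0.
    apply: (fa_sum InB_alg) => e; apply: (fa_mul InB_alg); first exact: InB_A.
    exact: fa_const InB_alg _.
  by apply: (fa_ext InB_alg) h => x _; rewrite sub0r.
- by move=> x /W_joseph J; apply: j_suml J.
- exact: suml2E.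
- by move=> x /W_joseph J; apply: j_Av J.
- move=> x /W_joseph J i a; rewrite -(j_cA J).
  by apply: eq_bigr => b _; rewrite mulrC.
- exact: W_vc.
- exact: W_vv.
Qed.

(** The second use of the abstract power-sum argument: v and c are exchanged, A is transposed, and
    [P] and [Q] change sign along with this. *)
Lemma InB_powc s : ~~ odd (size s) -> InB (fun x => \sum_i \prod_(a <- s) dc x i a).
Proof.
apply: (@power_sum_in F T W InB InB_alg (fun x a b => dA x b a) (fun x => dl x)
  (fun x a i => dc x i a) (fun x => dv x) e2
  (fun a b k x => \sum_e dA x e a * eps e b k) (fun a b k => - eps a b k)).
- by move=> a b; apply: InB_A.
- exact: InB_T.
- exact: InB_S.
- exact: InB_e2.
- move=> a b f; apply: (fa_sum InB_alg) => e; apply: (fa_mul InB_alg); first exact: InB_A.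
  exact: fa_const InB_alg _.
- by move=> x /W_joseph J; apply: j_suml J.
- exact: suml2E.
- move=> x /W_joseph J i a; rewrite -(j_cA J).
  by apply: eq_bigr => b _; rewrite mulrC.
- by move=> x /W_joseph J; apply: j_Av J.
- move=> x Wx i a b; rewrite mulrC (W_vc Wx) eq_sym; congr (_ + _ + _).
  by apply: eq_bigr => e _; rewrite mulrC.
- exact: W_cc.
Qed.

(** The analogue of [Nv] for v and c together, with no bound on degrees now that all power sums are
    available. Mixed monomials are absent because v_i c_i reduces to A and l_i. *)
Inductive Nf : (T -> 'I_3 -> F) -> Prop :=
| Nf_lam k : Nf (fun x i => dl x i ^+ k)
| Nf_v s : ~~ odd (size s) -> Nf (fun x i => \prod_(a <- s) dv x a i)
| Nf_c s : ~~ odd (size s) -> Nf (fun x i => \prod_(a <- s) dc x i a)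
| Nf_add u w : Nf u -> Nf w -> Nf (fun x i => u x i + w x i)
| Nf_scale b u : InB b -> Nf u -> Nf (fun x i => b x * u x i)
| Nf_ext u w : (forall x, W x -> u x =1 w x) -> Nf u -> Nf w.

Lemma InB_Nf u : Nf u -> InB (fun x => \sum_i u x i).
Proof.
elim=> {u} [k|s os|s os|u w _ h1 _ h2|b u hb _ h1|u w e _ h1].
- apply: (B_suml InB_alg (A := fun x => dA x) (v := fun x => dv x) (c := fun x a i => dc x i a) (e2 := e2)).
  + exact: InB_A.
  + exact: InB_e2.
  + by move=> x /W_joseph J; apply: j_suml J.
  + exact: suml2E.
  + by move=> x /W_joseph J; apply: j_Av J.
  + exact: W_vc.
- exact: InB_powv.
- exact: InB_powc.
- by apply: (fa_ext InB_alg) (fa_add InB_alg h1 h2) => x _; rewrite big_split.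
- by apply: (fa_ext InB_alg) (fa_mul InB_alg hb h1) => x _; rewrite mulr_sumr.
- by apply: (fa_ext InB_alg) h1 => x Wx; apply: eq_bigr => i _; rewrite e.
Qed.

Lemma Nf_sum (I : Type) (r : seq I) (u : I -> T -> 'I_3 -> F) :
  (forall i, Nf (u i)) -> Nf (fun x j => \sum_(i <- r) u i x j).
Proof.
move=> h; elim: r => [|i r IH].
  apply: Nf_ext (Nf_scale (fa_const InB_alg 0) (Nf_lam 0)) => x _ j.
  by rewrite mul0r big_nil.
by apply: Nf_ext (Nf_add (h i) IH) => x _ j; rewrite big_cons.
Qed.

Lemma Nf_l u : Nf u -> Nf (fun x i => dl x i * u x i).
Proof.
elim=> {u} [k|[|a s] os|[|a s] os|u w _ h1 _ h2|b u hb _ h1|u w e _ h1].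
- by apply: Nf_ext (Nf_lam k.+1) => x _ i; rewrite exprS.
- by apply: Nf_ext (Nf_lam 1) => x _ i; rewrite big_nil mulr1 expr1.
- have h : Nf (fun x i => \sum_b dA x a b * \prod_(a <- b :: s) dv x a i).
    by apply: Nf_sum => b; apply: Nf_scale; [apply: InB_A | apply: Nf_v].
  apply: Nf_ext h => x Wx i; rewrite big_cons mulrA -(j_Av (W_joseph Wx)) mulr_suml.
  by apply: eq_bigr => b _; rewrite big_cons mulrA.
- by apply: Nf_ext (Nf_lam 1) => x _ i; rewrite big_nil mulr1 expr1.
- have h : Nf (fun x i => \sum_b dA x b a * \prod_(a <- b :: s) dc x i a).
    by apply: Nf_sum => b; apply: Nf_scale; [apply: InB_A | apply: Nf_c].
  apply: Nf_ext h => x Wx i; rewrite big_cons mulrA -(j_cA (W_joseph Wx)) mulr_suml.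
  by apply: eq_bigr => b _; rewrite big_cons mulrA [dA _ _ _ * _]mulrC.
- by apply: Nf_ext (Nf_add h1 h2) => x _ i; rewrite mulrDr.
- by apply: Nf_ext (Nf_scale hb h1) => x _ i; rewrite mulrCA.
- by apply: Nf_ext h1 => x Wx i; rewrite e.
Qed.

Lemma Nf_lX k u : Nf u -> Nf (fun x i => dl x i ^+ k * u x i).
Proof.
move=> hu; elim: k => [|k IH]; first by apply: Nf_ext hu => x _ i; rewrite mul1r.
by apply: Nf_ext (Nf_l IH) => x _ i; rewrite exprS mulrA.
Qed.

Lemma Nf_vc u a b : Nf u -> Nf (fun x i => dv x a i * dc x i b * u x i).
Proof.
move=> hu.
have h1 : InB (fun x => \sum_e dA x a e * dA x e b).
  by apply: (fa_sum InB_alg) => e; apply: (fa_mul InB_alg); apply: InB_A.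
have h2 : InB (fun x => - (a == b)%:R * e2 x) := fa_scale InB_alg _ InB_e2.
have h := Nf_add (Nf_add (Nf_scale h1 hu) (Nf_scale (InB_A a b) (Nf_l hu)))
  (Nf_add (Nf_scale (fa_const InB_alg (a == b)%:R) (Nf_l (Nf_l hu))) (Nf_scale h2 hu)).
by apply: Nf_ext h => x Wx i; rewrite (W_vc Wx); ring.
Qed.

Lemma Nf_vv u a b : Nf u -> Nf (fun x i => dv x a i * dv x b i * u x i).
Proof.
have hab : Nf (fun x i => \prod_(a <- [:: a; b]) dv x a i) by apply: Nf_v.
elim=> {u} [k|s os|[|a1 [|b1 s]] // os|u w _ h1 _ h2|d u hd _ h1|u w e _ h1].
- by apply: Nf_ext (Nf_lX k hab) => x _ i; rewrite !big_cons big_nil; ring.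
- have h : Nf (fun x i => \prod_(a <- [:: a, b & s]) dv x a i) by apply: Nf_v; rewrite /= negbK.
  by apply: Nf_ext h => x _ i; rewrite !big_cons mulrA.
- by apply: Nf_ext hab => x _ i; rewrite !big_cons !big_nil; ring.
- have hs : Nf (fun x i => \prod_(a <- s) dc x i a) by apply: Nf_c; move: os; rewrite /= negbK.
  by apply: Nf_ext (Nf_vc a a1 (Nf_vc b b1 hs)) => x _ i; rewrite !big_cons; ring.
- by apply: Nf_ext (Nf_add h1 h2) => x _ i; rewrite mulrDr.
- by apply: Nf_ext (Nf_scale hd h1) => x _ i; rewrite mulrCA.
- by apply: Nf_ext h1 => x Wx i; rewrite e.
Qed.

Lemma Nf_cc u a b : Nf u -> Nf (fun x i => dc x i a * dc x i b * u x i).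
Proof.
have hab : Nf (fun x i => \prod_(a <- [:: a; b]) dc x i a) by apply: Nf_c.
elim=> {u} [k|[|a1 [|b1 s]] // os|s os|u w _ h1 _ h2|d u hd _ h1|u w e _ h1].
- by apply: Nf_ext (Nf_lX k hab) => x _ i; rewrite !big_cons big_nil; ring.
- by apply: Nf_ext hab => x _ i; rewrite !big_cons !big_nil; ring.
- have hs : Nf (fun x i => \prod_(a <- s) dv x a i) by apply: Nf_v; move: os; rewrite /= negbK.
  by apply: Nf_ext (Nf_vc a1 a (Nf_vc b1 b hs)) => x _ i; rewrite !big_cons; ring.
- have h : Nf (fun x i => \prod_(a <- [:: a, b & s]) dc x i a) by apply: Nf_c; rewrite /= negbK.
  by apply: Nf_ext h => x _ i; rewrite !big_cons mulrA.
- by apply: Nf_ext (Nf_add h1 h2) => x _ i; rewrite mulrDr.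
- by apply: Nf_ext (Nf_scale hd h1) => x _ i; rewrite mulrCA.
- by apply: Nf_ext h1 => x Wx i; rewrite e.
Qed.

End Invariants.

(** * Averaging over S_4 *)

Section Averaging.
Variable F : numClosedFieldType.
Local Notation T := 'M[F]_8.
Local Notation W := (@W F).
Local Notation InB := (@InB F).
Local Notation InB_alg := (InB_alg F).
Local Notation e2 := (@e2 F).
Local Notation eps := (eps F).
Implicit Types (x y : T) (f g h : T -> F) (u w : T -> 'I_3 -> F).

Inductive Y : (T -> 'I_3 -> F) -> Prop :=
| Y_B b : InB b -> Y (fun x _ => b x)
| Y_l : Y (fun x i => dl x i)
| Y_vv a b : Y (fun x i => dv x a i * dv x b i)
| Y_cc a b : Y (fun x i => dc x i a * dc x i b)
| Y_add u w : Y u -> Y w -> Y (fun x i => u x i + w x i)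
| Y_mul u w : Y u -> Y w -> Y (fun x i => u x i * w x i)
| Y_ext u w : (forall x, W x -> u x =1 w x) -> Y u -> Y w.

Lemma Y_Nf u : Y u -> Nf u.
Proof.
(* [Nf] is stable under multiplication by members of [Y]; the claim is the case of the constant 1,
   which is [Nf_lam] at exponent 0. *)
move=> Yu; suff h w : Nf w -> Nf (fun x i => u x i * w x i).
  by apply: Nf_ext (h _ (Nf_lam F 0)) => x _ i; rewrite mulr1.
elim: Yu w => {u} [b hb|| a b|a b|u1 u2 _ h1 _ h2|u1 u2 _ h1 _ h2|u1 u2 e _ h1] w hw.
- exact: Nf_scale.
- exact: Nf_l.
- exact: Nf_vv.
- exact: Nf_cc.
- by apply: Nf_ext (Nf_add (h1 _ hw) (h2 _ hw)) => x _ i; rewrite mulrDl.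
- by apply: Nf_ext (h1 _ (h2 _ hw)) => x _ i; rewrite mulrA.
- by apply: Nf_ext (h1 _ hw) => x Wx i; rewrite e.
Qed.

Lemma InB_Y u : Y u -> InB (fun x => \sum_i u x i).
Proof. by move=> /Y_Nf/InB_Nf. Qed.

Lemma Y_const a : Y (fun _ _ => a).
Proof. exact: Y_B (fa_const InB_alg a). Qed.

Lemma Y_vc a b : Y (fun x i => dv x a i * dc x i b).
Proof.
have h1 : InB (fun x => \sum_e dA x a e * dA x e b).
  by apply: (fa_sum InB_alg) => e; apply: (fa_mul InB_alg); apply: InB_A.
have h2 : InB (fun x => - (a == b)%:R * e2 x) := fa_scale InB_alg _ (InB_e2 F).
have h := Y_add (Y_add (Y_B h1) (Y_mul Y_l (Y_B (InB_A F a b))))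
  (Y_add (Y_mul (Y_const (a == b)%:R) (Y_mul Y_l Y_l)) (Y_B h2)).
by apply: Y_ext h => x Wx i; rewrite (W_vc Wx); ring.
Qed.

(** The functions on which V_4 acts trivially, as sums of pure tensors in the three indices: the
    form on which polarisation over S_3 operates. *)
Inductive G0 : (T -> F) -> Prop :=
| G0_prod u0 u1 u2 : Y u0 -> Y u1 -> Y u2 -> G0 (fun x => u0 x i0 * u1 x i1 * u2 x i2)
| G0_add f g : G0 f -> G0 g -> G0 (fun x => f x + g x)
| G0_ext f g : (forall x, W x -> f x = g x) -> G0 f -> G0 g.

Lemma G0_mul f g : G0 f -> G0 g -> G0 (fun x => f x * g x).
Proof.
move=> hf; elim: hf g => {f} [u0 u1 u2 h0 h1 h2|f1 f2 _ h1 _ h2|f1 f2 e _ h1] g hg.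
- elim: hg => {g} [w0 w1 w2 k0 k1 k2|g1 g2 _ h3 _ h4|g1 g2 e _ h3].
  + by apply: G0_ext (G0_prod (Y_mul h0 k0) (Y_mul h1 k1) (Y_mul h2 k2)) => x _; ring.
  + by apply: G0_ext (G0_add h3 h4) => x _; rewrite mulrDr.
  + by apply: G0_ext h3 => x Wx; rewrite e.
- by apply: G0_ext (G0_add (h1 _ hg) (h2 _ hg)) => x _; rewrite mulrDl.
- by apply: G0_ext (h1 _ hg) => x Wx; rewrite e.
Qed.

Lemma G0_Y i u : Y u -> G0 (fun x => u x i).
Proof.
move=> Yu; have Y1 := Y_const 1; elim/ord3_ind: i.
- by apply: G0_ext (G0_prod Yu Y1 Y1) => x _; rewrite !mulr1.
- by apply: G0_ext (G0_prod Y1 Yu Y1) => x _; rewrite mul1r mulr1.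
- by apply: G0_ext (G0_prod Y1 Y1 Yu) => x _; rewrite !mul1r.
Qed.

Lemma G0_B b : InB b -> G0 b.
Proof. by move=> hb; apply: (G0_Y i0 (Y_B hb)). Qed.

Lemma G0_const a : G0 (fun=> a).
Proof. exact: G0_B (fa_const InB_alg a). Qed.

Lemma G0_sum (I : Type) (r : seq I) (f : I -> T -> F) :
  (forall i, G0 (f i)) -> G0 (fun x => \sum_(i <- r) f i x).
Proof.
move=> h; elim: r => [|i r IH].
  by apply: G0_ext (G0_const 0) => x _; rewrite big_nil.
by apply: G0_ext (G0_add (h i) IH) => x _; rewrite big_cons.
Qed.

Lemma InB_lqf f x y : InB f -> W x -> W y -> lqf y = lqf x -> f y = f x.
Proof. by move=> [q hq] Wx Wy e; rewrite !hq // e. Qed.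

Lemma Y_perm s u x y : injective s -> Y u -> W x -> W y -> data_perm s x y ->
  forall i, u y i = u x (s i).
Proof.
move=> si Yu Wx Wy d; have [_ hl hv hc] := d.
elim: Yu => {u} [b hb||a b|a b|u1 u2 _ h1 _ h2|u1 u2 _ h1 _ h2|u1 u2 e _ h1] i.
- by apply: InB_lqf => //; apply: lqf_perm d.
- exact: hl.
- by rewrite !hv.
- by rewrite !hc.
- by rewrite h1 h2.
- by rewrite h1 h2.
- by rewrite -!e.
Qed.

Definition signs (e : 'I_3 -> F) := (forall i, e i * e i = 1) /\
  (forall i j k, i != j -> j != k -> i != k -> e i * e j = e k).

Lemma Y_sign e u x y : signs e -> Y u -> W x -> W y -> data_sign e x y -> u y =1 u x.
Proof.
move=> [ee _] Yu Wx Wy d; have [_ hl hv hc] := d.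
elim: Yu => {u} [b hb||a b|a b|u1 u2 _ h1 _ h2|u1 u2 _ h1 _ h2|u1 u2 E _ h1] i.
- by apply: InB_lqf => //; apply: lqf_sign d.
- exact: hl.
- by rewrite !hv mulrACA ee mul1r.
- by rewrite !hc mulrACA ee mul1r.
- by rewrite h1 h2.
- by rewrite h1 h2.
- by rewrite -!E.
Qed.

Lemma G0_sign e f x y : signs e -> G0 f -> W x -> W y -> data_sign e x y -> f y = f x.
Proof.
move=> se Gf Wx Wy d.
elim: Gf => {f} [u0 u1 u2 h0 h1 h2|f1 f2 _ h1 _ h2|f1 f2 E _ h1].
- by rewrite (Y_sign se h0 Wx Wy d) (Y_sign se h1 Wx Wy d) (Y_sign se h2 Wx Wy d).
- by rewrite h1 h2.
- by rewrite -!E.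
Qed.

Definition letter (b : bool) a i x := if b then dv x a i else dc x i a.

Lemma letter_sign e b a i x y : data_sign e x y -> letter b a i y = e i * letter b a i x.
Proof. by case=> _ _ hv hc; rewrite /letter; case: b; rewrite ?hv ?hc. Qed.

Lemma G0_letters b b' a a' i : G0 (fun x => letter b a i x * letter b' a' i x).
Proof.
rewrite /letter; case: b; case: b'.
- exact (G0_Y i (Y_vv a a')).
- exact (G0_Y i (Y_vc a a')).
- by apply: G0_ext (G0_Y i (Y_vc a' a)) => x _; rewrite mulrC.
- exact (G0_Y i (Y_cc a a')).
Qed.

(** These are [W_vv] and [W_cc]. They leave v_i c_j as the only irreducible product at two indices,
    hence the single kind of pair in [G]. *)
Lemma letter_same b a a' i j k : i != j -> j != k -> i != k ->
  exists2 g : 'I_3 -> T -> F, (forall d, G0 (g d)) &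
    forall x, W x -> letter b a i x * letter b a' j x = \sum_d g d x * letter (~~ b) d k x.
Proof.
move=> ij jk ik.
have hl := G0_Y j Y_l.
case: b; last first.
  exists (fun d x => \sum_e dA x e a * eps e a' d + dl x j * - eps a a' d) => [d|x Wx].
    apply: G0_add; last by apply: G0_mul hl (G0_const _).
    by apply: G0_sum => e; apply: G0_mul (G0_const _); apply/G0_B/InB_A.
  exact: W_cc.
exists (fun d x => - (\sum_e dA x a e * eps e a' d) + dl x j * eps a a' d) => [d|x Wx].
  apply: G0_add; last by apply: G0_mul hl (G0_const _).
  have h : G0 (fun x => -1 * \sum_e dA x a e * eps e a' d).
    apply: G0_mul (G0_const _) _.
    by apply: G0_sum => e; apply: G0_mul (G0_const _); apply/G0_B/InB_A.
  by apply: G0_ext h => x _; rewrite mulN1r.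
exact: W_vv.
Qed.

(* The functions on which [V_4] acts through its [k]-th nontrivial character. *)
Inductive G (k : 'I_3) : (T -> F) -> Prop :=
| G_letter b a g : G0 g -> G k (fun x => letter b a k x * g x)
| G_pair i j a a' g : i != j -> j != k -> i != k -> G0 g ->
    G k (fun x => letter true a i x * letter false a' j x * g x)
| G_add f g : G k f -> G k g -> G k (fun x => f x + g x)
| G_ext f g : (forall x, W x -> f x = g x) -> G k f -> G k g.

Lemma G_sign e k f x y : signs e -> G k f -> W x -> W y -> data_sign e x y ->
  f y = e k * f x.
Proof.
move=> se Gf Wx Wy d; have [_ e3] := se.
elim: Gf => {f} [b a g hg|i j a a' g ij jk ik hg|f1 f2 _ h1 _ h2|f1 f2 E _ h1].
- by rewrite (letter_sign _ _ _ d) (G0_sign se hg Wx Wy d); ring.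
- by rewrite !(letter_sign _ _ _ d) (G0_sign se hg Wx Wy d) -(e3 _ _ _ ij jk ik); ring.
- by rewrite h1 h2 mulrDr.
- by rewrite -!E.
Qed.

Lemma G_mul k f g : G0 g -> G k f -> G k (fun x => g x * f x).
Proof.
move=> hg; elim=> {f} [b a h hh|i j a a' h ij jk ik hh|f1 f2 _ h1 _ h2|f1 f2 E _ h1].
- by apply: G_ext (G_letter k b a (G0_mul hg hh)) => x _; ring.
- by apply: G_ext (G_pair a a' ij jk ik (G0_mul hg hh)) => x _; ring.
- by apply: G_ext (G_add h1 h2) => x _; rewrite mulrDr.
- by apply: G_ext h1 => x Wx; rewrite E.
Qed.

Lemma G_zero k : G k (fun=> 0).
Proof. by apply: G_ext (G_letter k true i0 (G0_const 0)) => x _; rewrite mulr0. Qed.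

Lemma G_sum k (I : Type) (r : seq I) (f : I -> T -> F) :
  (forall i, G k (f i)) -> G k (fun x => \sum_(i <- r) f i x).
Proof.
move=> h; elim: r => [|i r IH].
  by apply: G_ext (G_zero k) => x _; rewrite big_nil.
by apply: G_ext (G_add (h i) IH) => x _; rewrite big_cons.
Qed.

(** The k-th character squares to 1. Against a pair v_i c_j, the letter at k is merged with its own
    kind by [letter_same], which leaves two letters of one kind at one index. *)
Lemma letter_G k b a f : G k f -> G0 (fun x => letter b a k x * f x).
Proof.
elim=> {f} [b' a' g hg|i j a1 a2 g ij jk ik hg|f1 f2 _ h1 _ h2|f1 f2 E _ h1].
- by apply: G0_ext (G0_mul (G0_letters b b' a a' k) hg) => x _; ring.
- have ki : k != i by rewrite eq_sym.
  have kj : k != j by rewrite eq_sym.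
  have ji : j != i by rewrite eq_sym.
  case: b.
    have [h hh hE] := letter_same true a a1 ki ij kj.
    have H : G0 (fun x => \sum_d h d x * (letter false d j x * letter false a2 j x)).
      by apply: G0_sum => d; apply: G0_mul (G0_letters _ _ _ _ _).
    apply: G0_ext (G0_mul H hg) => x Wx; rewrite !mulrA hE //; congr (_ * _).
    by rewrite mulr_suml; apply: eq_bigr => d _; rewrite mulrA.
  have [h hh hE] := letter_same false a a2 kj ji ki.
  have H : G0 (fun x => \sum_d h d x * (letter true d i x * letter true a1 i x)).
    by apply: G0_sum => d; apply: G0_mul (G0_letters _ _ _ _ _).
  apply: G0_ext (G0_mul H hg) => x Wx.
  rewrite [letter true a1 i x * _]mulrC !mulrA hE //; congr (_ * _).
  by rewrite mulr_suml; apply: eq_bigr => d _; rewrite mulrA.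
- by apply: G0_ext (G0_add h1 h2) => x _; rewrite mulrDr.
- by apply: G0_ext h1 => x Wx; rewrite E.
Qed.

Lemma letter_G' i k m b a f : i != k -> k != m -> i != m -> G k f ->
  G m (fun x => letter b a i x * f x).
Proof.
move=> ik km im; elim=> {f} [b' a' g hg|i' j' a1 a2 g ij jk ik' hg|f1 f2 _ h1 _ h2|f1 f2 E _ h1].
- have [e|ne] := eqVneq b b'.
    have [h hh hE] := letter_same b a a' ik km im.
    have H : G m (fun x => \sum_d letter (~~ b) d m x * (h d x * g x)).
      by apply: G_sum => d; apply: G_letter; apply: G0_mul.
    apply: G_ext H => x Wx; rewrite -e mulrA hE // mulr_suml.
    by apply: eq_bigr => d _; ring.
  case: b b' ne => [] [] // _.
    by apply: G_ext (G_pair a a' ik km im hg) => x _; ring.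
  have ki : k != i by rewrite eq_sym.
  by apply: G_ext (G_pair a' a ki im km hg) => x _; ring.
- have [e|e] : i' = i /\ j' = m \/ i' = m /\ j' = i.
    move: ij jk ik' ik km im; clear.
    by elim/ord3_ind: i'; elim/ord3_ind: j' => //; elim/ord3_ind: k => // _ _ _;
      elim/ord3_ind: i => // _; elim/ord3_ind: m => //; tauto.
  + case: e => -> ->.
    apply: G_ext (G_letter m false a2 (G0_mul (G0_letters b true a a1 i) hg)) => x _; ring.
  + case: e => -> ->.
    apply: G_ext (G_letter m true a1 (G0_mul (G0_letters b false a a2 i) hg)) => x _; ring.
- by apply: G_ext (G_add h1 h2) => x _; rewrite mulrDr.
- by apply: G_ext h1 => x Wx; rewrite E.
Qed.

Definition Sp f := exists f0 f1 f2 f3, [/\ G0 f0, G i0 f1, G i1 f2, G i2 f3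
  & forall x, W x -> f x = f0 x + f1 x + f2 x + f3 x].

Lemma Sp_ext f g : (forall x, W x -> f x = g x) -> Sp f -> Sp g.
Proof.
move=> e [f0 [f1 [f2 [f3 [h0 h1 h2 h3 E]]]]]; exists f0, f1, f2, f3; split=> // x Wx.
by rewrite -e ?E.
Qed.

Lemma Sp_add f g : Sp f -> Sp g -> Sp (fun x => f x + g x).
Proof.
move=> [f0 [f1 [f2 [f3 [h0 h1 h2 h3 E]]]]] [g0 [g1 [g2 [g3 [k0 k1 k2 k3 E']]]]].
exists (fun x => f0 x + g0 x), (fun x => f1 x + g1 x), (fun x => f2 x + g2 x), (fun x => f3 x + g3 x).
split; [exact: G0_add|exact: G_add|exact: G_add|exact: G_add|].
by move=> x Wx; rewrite E // E' //; ring.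
Qed.

Lemma Sp_G0 f : G0 f -> Sp f.
Proof.
move=> h; exists f, (fun=> 0), (fun=> 0), (fun=> 0).
by split=> //; try exact: G_zero; move=> x _; rewrite !addr0.
Qed.

(** Multiplying [Sp] by one coordinate function at a time avoids the products between all pairs of
    isotypic parts. Polynomials follow, and are then applied to the constant 1. *)
Definition mult f := forall g, Sp g -> Sp (fun x => f x * g x).

Lemma mult_add f g : mult f -> mult g -> mult (fun x => f x + g x).
Proof.
by move=> hf hg h hh; apply: Sp_ext (Sp_add (hf _ hh) (hg _ hh)) => x _; rewrite mulrDl.
Qed.

Lemma mult_mul f g : mult f -> mult g -> mult (fun x => f x * g x).
Proof. by move=> hf hg h hh; apply: Sp_ext (hf _ (hg _ hh)) => x _; rewrite mulrA. Qed.

Lemma mult_ext f g : (forall x, W x -> f x = g x) -> mult f -> mult g.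
Proof. by move=> e hf h hh; apply: Sp_ext (hf _ hh) => x Wx; rewrite e. Qed.

Lemma mult_G0 f : G0 f -> mult f.
Proof.
move=> hf g [f0 [f1 [f2 [f3 [h0 h1 h2 h3 E]]]]].
exists (fun x => f x * f0 x), (fun x => f x * f1 x), (fun x => f x * f2 x), (fun x => f x * f3 x).
split; [exact: G0_mul|exact: G_mul|exact: G_mul|exact: G_mul|].
by move=> x Wx; rewrite E //; ring.
Qed.

Lemma mult_letter b a i : mult (letter b a i).
Proof.
move=> g [f0 [f1 [f2 [f3 [h0 h1 h2 h3 E]]]]]; pose L f x := letter b a i x * f x.
elim/ord3_ind: i @L => L.
(* The multiplication table of the four characters of V_4: a letter permutes the four parts. *)
- exists (L f1), (L f0), (L f3), (L f2); rewrite /L.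
  split; [exact: letter_G|exact: G_letter|exact: letter_G' h3|exact: letter_G' h2|].
  by move=> x Wx; rewrite E //; ring.
- exists (L f2), (L f3), (L f0), (L f1); rewrite /L.
  split; [exact: letter_G|exact: letter_G' h3|exact: G_letter|exact: letter_G' h1|].
  by move=> x Wx; rewrite E //; ring.
- exists (L f3), (L f2), (L f1), (L f0); rewrite /L.
  split; [exact: letter_G|exact: letter_G' h2|exact: letter_G' h1|exact: G_letter|].
  by move=> x Wx; rewrite E //; ring.
Qed.

Lemma mult_opp f : mult f -> mult (fun x => - f x).
Proof.
move=> hf; apply: mult_ext (mult_mul (mult_G0 (G0_const (-1))) hf) => x _.
by rewrite mulN1r.
Qed.

Lemma mult_sub f g : mult f -> mult g -> mult (fun x => f x - g x).
Proof. by move=> hf hg; apply: mult_add hf (mult_opp hg). Qed.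

Lemma mult_entry i j : mult (fun x => x i j).
Proof.
have hA a b : mult (fun x => dA x a b) by apply/mult_G0/G0_B/InB_A.
have hl k : mult (fun x => dl x k) by apply/mult_G0/(G0_Y k)/Y_l.
have hv a k : mult (fun x => dv x a k) := mult_letter true a k.
have hc k a : mult (fun x => dc x k a) := mult_letter false a k.
have h0 : mult (fun=> 0) := mult_G0 (G0_const 0).
have h : mult (fun x => X8 (dA x) (dl x) (dv x) (dc x) i j).
  elim/ord8_ind: i; elim/ord8_ind: j;
    (eapply mult_ext; [by move=> x _; rewrite mxE /=; reflexivity | ]);
    solve [repeat first [exact: hA | exact: hl | exact: hv | exact: hc | exact: h0
    | apply: mult_opp | apply: mult_sub]].
by apply: mult_ext h => x [sx _ _]; rewrite -so8E.
Qed.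

Lemma mult_prod (I : Type) (r : seq I) (f : I -> T -> F) :
  (forall i, mult (f i)) -> mult (fun x => \prod_(i <- r) f i x).
Proof.
move=> h; elim: r => [|i r IH].
  by apply: mult_ext (mult_G0 (G0_const 1)) => x _; rewrite big_nil.
by apply: mult_ext (mult_mul (h i) IH) => x _; rewrite big_cons.
Qed.

Lemma mult_exp f n : mult f -> mult (fun x => f x ^+ n).
Proof.
move=> hf; elim: n => [|n IH]; first exact: mult_G0 (G0_const 1).
by apply: mult_ext (mult_mul hf IH) => x _; rewrite exprS.
Qed.

Lemma mult_poly (p : {mpoly F[8 * 8]}) : mult (fun x => p.@[coord8 x]).
Proof.
have h : mult (fun x => \sum_(m <- msupp p) p@_m * \prod_i coord8 x i ^+ m i).
  elim: (msupp p) => [|m r IH].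
    by apply: mult_ext (mult_G0 (G0_const 0)) => x _; rewrite big_nil.
  have hm : mult (fun x => p@_m * \prod_i coord8 x i ^+ m i).
    apply: mult_mul (mult_G0 (G0_const _)) _; apply: mult_prod => k; apply: mult_exp.
    by case/mxvec_indexP: k => i j; apply: mult_ext (mult_entry i j) => x _; rewrite /coord8 mxvecE.
  by apply: mult_ext (mult_add hm IH) => x _; rewrite big_cons.
by apply: mult_ext h => x _; rewrite mevalE.
Qed.

Lemma Sp_poly (p : {mpoly F[8 * 8]}) : Sp (fun x => p.@[coord8 x]).
Proof.
by apply: Sp_ext (mult_poly p (Sp_G0 (G0_const 1))) => x _; rewrite mulr1.
Qed.

(** * Functions invariant under the generators *)

Section Group.
Variables t12 t01 a1 : T -> T.
Hypothesis t12P : forall x, W x -> W (t12 x) /\ data_perm (tperm i1 i2) x (t12 x).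
Hypothesis t01P : forall x, W x -> W (t01 x) /\ data_perm (tperm i0 i1) x (t01 x).
Hypothesis a1P : forall x, W x -> W (a1 x) /\ data_sign (sgn1 F) x (a1 x).
Variable f : T -> F.
Hypothesis f12 : forall x, W x -> f (t12 x) = f x.
Hypothesis f01 : forall x, W x -> f (t01 x) = f x.
Hypothesis fa1 : forall x, W x -> f (a1 x) = f x.

Let W12 x : W x -> W (t12 x). Proof. by case/t12P. Qed.
Let W01 x : W x -> W (t01 x). Proof. by case/t01P. Qed.

Lemma Y12 u x i : Y u -> W x -> u (t12 x) i = u x (tperm i1 i2 i).
Proof. by move=> Yu Wx; exact: (Y_perm perm_inj Yu Wx (W12 Wx) (proj2 (t12P Wx))). Qed.

Lemma Y01 u x i : Y u -> W x -> u (t01 x) i = u x (tperm i0 i1 i).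
Proof. by move=> Yu Wx; exact: (Y_perm perm_inj Yu Wx (W01 Wx) (proj2 (t01P Wx))). Qed.

Definition symm g x := g x + g (t12 x) + g (t01 x) + g (t12 (t01 x)) + g (t01 (t12 x))
  + g (t12 (t01 (t12 x))).

(* Weyl's polarisation: the sum over S_3 of [u0_i u1_j u2_k] is a polynomial in power sums. *)
Lemma InB_symm g : G0 g -> InB (symm g).
Proof.
elim=> {g} [u0 u1 u2 h0 h1 h2|g1 g2 _ h1 _ h2|g1 g2 e _ h1].
- have S0 := InB_Y h0; have S1 := InB_Y h1; have S2 := InB_Y h2.
  have S01 := InB_Y (Y_mul h0 h1); have S02 := InB_Y (Y_mul h0 h2); have S12 := InB_Y (Y_mul h1 h2).
  have S012 := InB_Y (Y_mul (Y_mul h0 h1) h2).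
  (* Inclusion-exclusion for distinct indices: S0 S1 S2 - S01 S2 - S02 S1 - S12 S0 + 2 S012. *)
  have h := fa_add InB_alg (fa_sub InB_alg (fa_sub InB_alg (fa_sub InB_alg
    (fa_mul InB_alg (fa_mul InB_alg S0 S1) S2) (fa_mul InB_alg S01 S2)) (fa_mul InB_alg S02 S1))
    (fa_mul InB_alg S12 S0)) (fa_scale InB_alg 2 S012).
  apply: (fa_ext InB_alg) h => x Wx; rewrite /symm !big3.
  have w1 := W12 Wx; have w2 := W01 Wx; have w3 := W01 w1.
  have val u (Yu : Y u) i : ((u (t12 x) i = u x (tperm i1 i2 i)) *
      (u (t01 x) i = u x (tperm i0 i1 i)) *
      (u (t12 (t01 x)) i = u x (tperm i0 i1 (tperm i1 i2 i))) *
      (u (t01 (t12 x)) i = u x (tperm i1 i2 (tperm i0 i1 i))) *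
      (u (t12 (t01 (t12 x))) i = u x (tperm i1 i2 (tperm i0 i1 (tperm i1 i2 i)))))%type.
    by do !split; rewrite ?(Y12 _ Yu w3) ?(Y01 _ Yu w1) ?(Y12 _ Yu w2) ?(Y12 _ Yu Wx) ?(Y01 _ Yu Wx).
  by rewrite !(val _ h0) !(val _ h1) !(val _ h2) !tperm3; ring.
- have h := fa_add InB_alg h1 h2.
  by apply: (fa_ext InB_alg) h => x Wx; rewrite /symm; ring.
- apply: (fa_ext InB_alg) h1 => x Wx.
  have w1 := W12 Wx; have w2 := W01 Wx; have w3 := W01 w1.
  by rewrite /symm (e _ Wx) (e _ w1) (e _ w2) (e _ (W12 w2)) (e _ w3) (e _ (W12 w3)).
Qed.

Lemma sgn1_signs : signs (sgn1 F).
Proof. by split; [apply: sgn1_sqr | apply: sgn1_mul]. Qed.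

(** Invariance under [a1], with signs (1, -1, -1), gives f_2 + f_3 = 0. A second element of V_4
    relates [t01 x] to [t01 (a1 x)]; its signs (-1, 1, -1) remove f_1. *)
Lemma Sp_G0_inv : Sp f -> exists2 g, G0 g & forall x, W x -> f x = g x.
Proof.
case=> f0 [f1 [f2 [f3 [h0 h1 h2 h3 E]]]].
have n2 : (2 : F) != 0 by rewrite pnatr_eq0.
have E1 x : W x -> f x = f0 x + f1 x.
  move=> Wx; have [Wy d] := a1P Wx; apply: (mulfI n2).
  have := fa1 Wx; rewrite (E _ Wy) (G0_sign sgn1_signs h0 Wx Wy d).
  rewrite (G_sign sgn1_signs h1 Wx Wy d) (G_sign sgn1_signs h2 Wx Wy d) (G_sign sgn1_signs h3 Wx Wy d).
  rewrite (E _ Wx) /sgn1 /= => /eqP; rewrite -subr_eq0 => /eqP e.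
  by apply: (eq_cof (e := -1) e); ring.
(* Applied twice, [t01] restores the values of every member of [Y], hence those of f_0. This brings
   the conclusion, which is obtained at [t01 x], back to the initial point. *)
have f0E x : W x -> f0 (t01 (t01 x)) = f0 x.
  move=> Wx; have Wy := W01 Wx; have Wz := W01 Wy.
  elim: {E E1} h0 => [u0 u1 u2 k0 k1 k2|g1 g2 _ k1 _ k2|g1 g2 e' _ k1].
  - by rewrite !(Y01 _ k0, Y01 _ k1, Y01 _ k2, tperm3).
  - by rewrite k1 k2.
  - by rewrite -!e'.
exists f0 => // x0 Wx0; rewrite -(f0E _ Wx0) -(f01 Wx0); have Wx := W01 Wx0.
move: (t01 x0) Wx => x Wx {x0 Wx0 f0E}.
have [Wy dy] := t01P Wx; have [Wx' dx'] := a1P Wx; have [Wy' dy'] := t01P Wx'.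
pose e i := sgn1 F (tperm i0 i1 i).
have se : signs e.
  have [s1 s2] := sgn1_signs; split=> [i|i j k ij jk ik]; first exact: s1.
  by apply: s2; rewrite (inj_eq perm_inj).
have d : data_sign e (t01 x) (t01 (a1 x)).
  case: dy dx' dy' => hA hl hv hc [hA1 hl1 hv1 hc1] [hA2 hl2 hv2 hc2].
  split; first by rewrite hA2 hA1 hA.
  - by move=> i; rewrite hl2 hl1 hl.
  - by move=> a i; rewrite hv2 hv1 hv.
  - by move=> i a; rewrite hc2 hc1 hc.
have e1 := E1 _ Wy; have e2 := E1 _ Wy'.
rewrite f01 // in e1; rewrite f01 // fa1 // in e2.
rewrite (G0_sign se h0 Wy Wy' d) (G_sign se h1 Wy Wy' d) /e tperm3 /sgn1 /= in e2.
apply: (mulfI n2); move/eqP: e1; rewrite -subr_eq0 => /eqP e1.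
by rewrite mulr2n !mulrDl !mul1r {1}e2; apply: (eq_cof (e := 1) e1); ring.
Qed.

Lemma invariant_InB : Sp f -> InB f.
Proof.
case/Sp_G0_inv => g Gg fE.
have h := fa_scale InB_alg 6^-1 (InB_symm Gg).
apply: (fa_ext InB_alg) h => x Wx.
have w1 := W12 Wx; have w2 := W01 Wx; have w3 := W01 w1.
rewrite /symm -(fE _ Wx) -(fE _ w1) -(fE _ w2) -(fE _ (W12 w2)) -(fE _ w3) -(fE _ (W12 w3)).
rewrite (f12 w3) (f12 w2) (f01 w1) (f12 Wx) (f01 Wx).
by field.
Qed.

End Group.
End Averaging.

(** * The quotient map *)

Section Quotient.
Variable F : numClosedFieldType.
Local Notation T := 'M[F]_8.
Implicit Types (x y : T) (l : 'I_3 -> F).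

Lemma eq_meval n (p : {mpoly F[n]}) (v v' : 'I_n -> F) : v =1 v' -> p.@[v] = p.@[v'].
Proof.
move=> e; rewrite !mevalE; apply: eq_bigr => m _; congr (_ * _).
by apply: eq_bigr => i _; rewrite e.
Qed.

Definition polyfun (f : T -> F) := exists p : {mpoly F[8 * 8]}, forall x, f x = p.@[coord8 x].

Lemma polyfun_alg : funalg (fun _ : T => True) polyfun.
Proof.
split.
- by move=> f g e [q hq]; exists q => x; rewrite -e ?hq.
- by move=> a; exists a%:MP => x; rewrite mevalC.
- by move=> f g [p hp] [q hq]; exists (p + q) => x; rewrite mevalD hp hq.
- by move=> f g [p hp] [q hq]; exists (p * q) => x; rewrite mevalM hp hq.
Qed.

Lemma polyfun_entry i j : polyfun (fun x => x i j).
Proof. by exists 'X_(mxvec_index i j) => x; rewrite mevalXU /coord8 mxvecE. Qed.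

Lemma polyfun_opp f : polyfun f -> polyfun (fun x => - f x).
Proof.
move=> h; apply: (fa_ext polyfun_alg) (fa_scale polyfun_alg (-1) h) => x _.
by rewrite mulN1r.
Qed.

Lemma polyfun_tr : polyfun (@blocktr F).
Proof.
by apply: (fa_add polyfun_alg); [apply: (fa_add polyfun_alg) | ]; apply: polyfun_entry.
Qed.

Lemma polyfun_dA a b : polyfun (fun x => dA x a b).
Proof.
have h := polyfun_entry; have k c := fa_mul polyfun_alg polyfun_tr (fa_const polyfun_alg c).
elim/ord3_ind: a; elim/ord3_ind: b;
  (eapply (fa_ext polyfun_alg); [by move=> x _; rewrite /dA mx3E; reflexivity | ]);
  solve [repeat first [exact: h | exact: k | apply: (fa_sub polyfun_alg)]].
Qed.

Lemma polyfun_dv a i : polyfun (fun x => dv x a i).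
Proof.
have h := polyfun_entry; elim/ord3_ind: a; elim/ord3_ind: i;
  (eapply (fa_ext polyfun_alg); [by move=> x _; rewrite /dv mx3E; reflexivity | ]);
  solve [repeat first [exact: h | apply: polyfun_opp]].
Qed.

Lemma polyfun_dc i a : polyfun (fun x => dc x i a).
Proof.
have h := polyfun_entry; elim/ord3_ind: a; elim/ord3_ind: i;
  (eapply (fa_ext polyfun_alg); [by move=> x _; rewrite /dc mx3E; reflexivity | ]);
  solve [repeat first [exact: h | apply: polyfun_opp]].
Qed.

Lemma polyfun_dl i : polyfun (fun x => dl x i).
Proof.
have h a b c := fa_mul polyfun_alg (polyfun_entry a b) (fa_const polyfun_alg c).
have k c := fa_mul polyfun_alg polyfun_tr (fa_const polyfun_alg c).
have k' := fa_mul polyfun_alg (polyfun_opp polyfun_tr) (fa_const polyfun_alg 3^-1).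
elim/ord3_ind: i; rewrite /dl /=.
- exact (fa_sub polyfun_alg (k 6^-1) (h q3 q3 2^-1)).
- exact (fa_add polyfun_alg (k 6^-1) (h q3 q3 2^-1)).
- exact k'.
Qed.

Lemma polyfun_D : polyfun (@D F).
Proof.
by apply: (fa_mul polyfun_alg); [apply: (fa_mul polyfun_alg) | ];
  apply: (fa_sub polyfun_alg); apply: polyfun_dl.
Qed.

Lemma polyfun_lqf k : polyfun (fun x => coordT (lqf x) k).
Proof.
rewrite /coordT; case/mxvec_indexP: k => a b.
eapply (fa_ext polyfun_alg); first by move=> x _; rewrite mxvecE; reflexivity.
case: (split_ordP b) => b' -> {b}.
  by apply: (fa_ext polyfun_alg) (polyfun_dA a b') => x _; rewrite row_mxEl.
case: (split_ordP b') => b -> {b'}.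
  have h : polyfun (fun x => \sum_i dv x a i * dv x b i).
    by apply: (fa_sum polyfun_alg) => i; apply: (fa_mul polyfun_alg); apply: polyfun_dv.
  apply: (fa_ext polyfun_alg) h => x _; rewrite row_mxEr row_mxEl [RHS]mxE.
  by apply: eq_bigr => i _; rewrite [_^T _ _]mxE.
have h : polyfun (fun x => \sum_i dc x i a * dc x i b).
  by apply: (fa_sum polyfun_alg) => i; apply: (fa_mul polyfun_alg); apply: polyfun_dc.
apply: (fa_ext polyfun_alg) h => x _; rewrite !row_mxEr [RHS]mxE.
by apply: eq_bigr => i _; rewrite [_^T _ _]mxE.
Qed.

(** A line in z through l on which all three differences of the l_i are nonconstant in t, so that it
    contains regular points even if l is not regular. *)
Definition shift l t : 'I_3 -> F := fun i => l i + t * [:: 0; 1; -1]`_i.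

Lemma shift_sum l t : \sum_i l i = 0 -> \sum_i shift l t i = 0.
Proof. by rewrite /shift !big3 /= => hl; rewrite -[RHS]hl; ring. Qed.

Lemma upoly_shift l i : upoly (fun t => shift l t i).
Proof.
by apply: upolyD; [apply: upoly_const | apply: upolyM; [apply: upoly_id | apply: upoly_const]].
Qed.

Lemma upoly_shiftB l i j : upoly (fun t => shift l t i - shift l t j).
Proof. by apply: upolyB; apply: upoly_shift. Qed.

Lemma shift_regular l : exists t, regular (shift l t).
Proof.
(* Each of the three values of t makes one difference equal to 1. *)
have [|||t [h1 h2 h3]] := @upoly_nonroot F _ _ _ (l i0 - l i1 - 1) ((1 - (l i1 - l i2)) / 2)
  (l i2 - l i0 - 1) (upoly_shiftB l i0 i1) (upoly_shiftB l i1 i2) (upoly_shiftB l i2 i0).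
- have -> : shift l (l i0 - l i1 - 1) i0 - shift l (l i0 - l i1 - 1) i1 = 1.
    by rewrite /shift /=; ring.
  exact: oner_neq0.
- set s := (X in shift l X i1); have -> : shift l s i1 - shift l s i2 = 1.
    by rewrite /s /shift /=; field.
  exact: oner_neq0.
- have -> : shift l (l i2 - l i0 - 1) i2 - shift l (l i2 - l i0 - 1) i0 = 1.
    by rewrite /shift /=; ring.
  exact: oner_neq0.
by exists t; rewrite /regular !mulf_neq0.
Qed.

Lemma upoly_psi (q : {mpoly F[3 * (3 + (3 + 3))]}) (g : 'M[F]_3) l :
  upoly (fun t => q.@[coordT (psi g (shift l t))]).
Proof.
have hv : upolymx (fun t => psi_v g (shift l t)).
  move=> a i; have h := upolyM (upoly_shiftB l i (ordS i)) (upoly_const (g a i)).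
  by apply: upoly_ext h => t; rewrite mxE.
have hc : upolymx (fun t => psi_c g (shift l t)).
  move=> i a; have h := upolyM (upoly_shiftB l i (ord_pred i)) (upoly_const (invmx g i a)).
  by apply: upoly_ext h => t; rewrite mxE.
have hT m n (M : F -> 'M[F]_(m, n)) : upolymx M -> upolymx (fun t => (M t)^T).
  by move=> hM i j; apply: upoly_ext (hM j i) => t; rewrite mxE.
apply: upoly_meval => k; rewrite /coordT; case/mxvec_indexP: k => a b.
eapply upoly_ext; first by move=> t; rewrite mxvecE psiE; reflexivity.
case: (split_ordP b) => b' -> {b}.
  have h : upoly (fun t => \sum_k g a k * shift l t k * invmx g k b').
    apply: upoly_sum => k; apply: upolyM; last exact: upoly_const.
    by apply: upolyM; [apply: upoly_const | apply: upoly_shift].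
  by apply: upoly_ext h => t; rewrite row_mxEl psi_AE.
case: (split_ordP b') => b -> {b'}.
  by apply: upoly_ext (upolymxM hv (hT _ _ _ hv) a b) => t; rewrite row_mxEr row_mxEl.
by apply: upoly_ext (upolymxM (hT _ _ _ hc) hc a b) => t; rewrite !row_mxEr.
Qed.

Lemma W_nonempty : exists x, W x.
Proof.
have [t rt] := shift_regular (fun=> 0).
have hl : \sum_i shift (fun=> 0 : F) t i = 0 by apply: shift_sum; rewrite big3 !addr0.
by have [x Wx _] := psi_W (det1 F 3) hl rt; exists x.
Qed.

(** If p were nonzero somewhere on [Omin], irreducibility would give a point where p and [D] are
    both nonzero, and that point is in [W]. *)
Lemma W_dense (p : {mpoly F[8 * 8]}) :
  (forall x, W x -> p.@[coord8 x] = 0) -> forall x, Omin x -> p.@[coord8 x] = 0.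
Proof.
move=> h x ox; apply/eqP; apply: contraT => nx.
have [y Wy] := W_nonempty; have [d dE] := polyfun_D.
have [|z [oz nz]] := @Omin_irreducible F p d x y ox (W_Omin Wy) nx.
  by rewrite -dE; case: Wy.
by rewrite -dE => Dz; rewrite h ?eqxx // in nz; apply: Omin_W.
Qed.

End Quotient.

(* C[closure(Omin)]^{S_4} is isomorphic, as an F-algebra, to
   C[closure(im psi)], realised as pull-back along a polynomial map. *)
Theorem theorem4p6 (F : numClosedFieldType)
  (g13 g34 : 'M[F]_8 -> 'M[F]_8) :
  diagram_aut swap13 g13 -> diagram_aut swap34 g34 ->
  let act : seq ('M[F]_8 -> 'M[F]_8) :=
    [:: g13; g34; fun x => g13 (Ad (t34 F) x)] in
  exists lq : (3 * (3 + (3 + 3))).-tuple {mpoly F[8 * 8]},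
    [/\ (* the pull-back lands in S_4-invariant functions on Omin *)
        forall (q : {mpoly F[3 * (3 + (3 + 3))]}) x i, Omin x -> (i < size act)%N ->
          (q \mPo lq).@[coord8 (nth id act i x)] = (q \mPo lq).@[coord8 x],
        (* it is well defined and injective on C[closure(im psi)] *)
        forall q : {mpoly F[3 * (3 + (3 + 3))]},
          (forall x, Omin x -> (q \mPo lq).@[coord8 x] = 0) <->
          (forall y, in_image_psi y -> q.@[coordT y] = 0) &
        (* and it is onto the invariants *)
        forall p : {mpoly F[8 * 8]},
          (forall x i, Omin x -> (i < size act)%N -> p.@[coord8 (nth id act i x)] = p.@[coord8 x]) ->
          exists q : {mpoly F[3 * (3 + (3 + 3))]},
            forall x, Omin x -> (q \mPo lq).@[coord8 x] = p.@[coord8 x]].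
Proof.
move=> H13 H34 act.
have [P PE] := fin_all_exists (@polyfun_lqf F).
pose lq := [tuple P k | k < 3 * (3 + (3 + 3))].
have lqE q x : (q \mPo lq).@[coord8 x] = q.@[coordT (lqf x)].
  by rewrite comp_mpoly_meval; apply: eq_meval => k; rewrite tnth_mktuple -PE.
have lq13 x : in_so8 x -> lqf (g13 x) = lqf x.
  by move=> sx; have [_ d] := g13_data H13 sx; apply: lqf_perm d; apply: perm_inj.
have lq34 x : in_so8 x -> lqf (g34 x) = lqf x.
  by move=> sx; have [_ d] := g34_data H34 sx; apply: lqf_perm d; apply: perm_inj.
have lqt x : in_so8 x -> lqf (Ad (t34 F) x) = lqf x.
  by move=> sx; have [_ d] := Ad_data sx; apply: lqf_sign d; apply: sgn1_sqr.
exists lq; split.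
- move=> q x i ox; have sx := Omin_so8 ox; rewrite !lqE; case: i => [|[|[|//]]] _ /=.
  + by rewrite lq13.
  + by rewrite lq34.
  + by have [st _] := Ad_data sx; rewrite lq13 // lqt.
- move=> q; split=> [h y [g [l [dg hl ->]]] | h x ox].
    (* Only regular l are reached from [W]. If q is nonzero at [psi g l], it is nonzero at
       [psi g (shift l t)] for some t making the point regular, which contradicts the vanishing on
       [Omin]. *)
    apply/eqP; apply: contraT => nq.
    have [t0 r0] := shift_regular l.
    have R : upoly (fun t => (shift l t i0 - shift l t i1) * (shift l t i1 - shift l t i2)
        * (shift l t i2 - shift l t i0)).
      by apply: upolyM; [apply: upolyM | ]; apply: upoly_shiftB.
    have [|t [nt rt _]] := @upoly_nonroot F _ _ _ 0 t0 t0 (upoly_psi q g l) R R _ r0 r0.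
      rewrite (@eq_meval _ _ _ _ (coordT (psi g l))) // => k; congr (coordT _ k).
      have e i : shift l 0 i = l i by rewrite /shift mul0r addr0.
      have Av : psi_v g (shift l 0) = psi_v g l by apply/matrixP => a i; rewrite !mxE !e.
      have Ac : psi_c g (shift l 0) = psi_c g l by apply/matrixP => i a; rewrite !mxE !e.
      have AA : psi_A g (shift l 0) = psi_A g l.
        by apply/matrixP => a b; rewrite !psi_AE; apply: eq_bigr => i _; rewrite e.
      by rewrite !psiE Av Ac AA.
    have [x Wx xE] := psi_W dg (shift_sum t hl) rt.
    by move: nt; rewrite -xE -lqE h ?eqxx //; apply: W_Omin.
  apply: W_dense ox => z Wz; rewrite lqE; apply: h; exact: W_psi.
- move=> p h.
  have P13 x : W x -> W (g13 x) /\ data_perm (tperm i1 i2) x (g13 x).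
    move=> Wx; have [sx _ _] := Wx; have [sy d] := g13_data H13 sx.
    by split=> //; apply: W_perm sy d Wx; apply: perm_inj.
  have P34 x : W x -> W (g34 x) /\ data_perm (tperm i0 i1) x (g34 x).
    move=> Wx; have [sx _ _] := Wx; have [sy d] := g34_data H34 sx.
    by split=> //; apply: W_perm sy d Wx; apply: perm_inj.
  have Pt x : W x -> W (Ad (t34 F) x) /\ data_sign (sgn1 F) x (Ad (t34 F) x).
    move=> Wx; have [sx _ _] := Wx; have [sy d] := Ad_data sx.
    by split=> //; apply: W_sign sy d Wx.
  have h13 x : W x -> p.@[coord8 (g13 x)] = p.@[coord8 x].
    by move=> /W_Omin ox; apply: (h x 0).
  have h34 x : W x -> p.@[coord8 (g34 x)] = p.@[coord8 x].
    by move=> /W_Omin ox; apply: (h x 1).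
  (* The third generator is [g13] after [Ad (t34 F)]; invariance under [g13] at the point
     [Ad (t34 F) x] of [W] isolates the second factor. *)
  have ht x : W x -> p.@[coord8 (Ad (t34 F) x)] = p.@[coord8 x].
    by move=> Wx; rewrite -(h13 _ (proj1 (Pt x Wx))); apply: (h x 2); first exact: W_Omin.
  have [q hq] := invariant_InB P13 P34 Pt h13 h34 ht (Sp_poly p).
  exists q => x ox; apply/eqP; rewrite -subr_eq0 -mevalB; apply/eqP.
  by apply: W_dense ox => z Wz; rewrite mevalB lqE hq // subrr.
Qed.
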